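(* Let $p>3$ be prime and $0\leq m\leq p-1$. Suppose $j(p,\overrightarrow{n},z) \in \mathfrak{F}(m,p)$. Let $A = \begin{pmatrix} a & b \\ p & d \end{pmatrix} \in \Gamma_0(p)$ with $1 \leq a,d \leq p-1$. Then \begin{equation*} j(p,\overrightarrow{n},z)\big|_{1} A =(-1)^{L(\overrightarrow{n},a,b,p)}\, \exp\left(\frac{2\pi iabm}{p}\right)\, \eta(pz)^{n_0}\prod_{k=1}^{\frac{1}{2}(p-1)}f_{p,ka}(z)^{n_k}, \end{equation*} where \begin{equation*} L(\overrightarrow{n},a,b,p)=b\,(a+1)\sum_{k=1}^{\frac{1}{2}(p-1)}kn_{k}+\sum_{k=1}^{\frac{1}{2}(p-1)}\left\lfloor\frac{ka}{p}\right\rfloor n_{k}. \end{equation*} Also \begin{equation*} j(p,\pi_r(\overrightarrow{n}),z) \in \mathfrak{F}(m',p), \end{equation*} where $1\leq r\leq\frac{1}{2}(p-1)$ and $m'\equiv r^2m \pmod p$.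
   Context: Here $q=\exp(2\pi i z)$, $\Im(z)>0$, $\eta(z)=q^{1/24}\prod_{n\ge1}(1-q^n)$, and (following Biagioli) $f_{N,\rho}(z) := q^{(N-2\rho)^2/(8N)}\,(q^\rho,q^{N-\rho},q^N;q^N)_\infty$ for $N\ge1$, $N\nmid\rho$; note $f_{N,\rho}=f_{N,N+\rho}=f_{N,-\rho}$. For $\overrightarrow{n}=(n_0,n_1,\dots,n_{\frac{1}{2}(p-1)}) \in \mathbb{Z}^{\frac{1}{2}(p+1)}$, $j(p,\overrightarrow{n},z)=\eta(pz)^{n_0}\prod_{k=1}^{\frac{1}{2}(p-1)}f_{p,k}(z)^{n_k}$. $\mathfrak{F}(m,p)$ is the set of such $j(p,\overrightarrow{n},z)$ satisfying (1) $n_0+\sum_{k=1}^{(p-1)/2}n_k=2$, (2) $\sum_{k=1}^{(p-1)/2}k^2 n_k \equiv 2m \pmod{p}$, (3) $n_0+3\sum_{k=1}^{(p-1)/2}n_k \equiv 0 \pmod{24}$ (such functions are weakly holomorphic modular forms of weight 1 on $\Gamma(p)$). The weight $k$ stroke operator is $F|_k A := (\det A)^{k/2}(cz+d)^{-k}F(Az)$ for $A=\begin{pmatrix} a&b\\c&d\end{pmatrix}$. For $1\le r\le \frac{1}{2}(p-1)$, $\pi_r$ is the permutation of $\{1,\dots,\frac{1}{2}(p-1)\}$ with $\pi_r(i)=i'$ where $ri'\equiv\pm i\pmod p$, and $\pi_r(\overrightarrow{n})=(n_0,n_{\pi_r(1)},\dots,n_{\pi_r(\frac{1}{2}(p-1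))})$.
   Formalization: The printed formula for f_{N,ρ} gives f_{N,N+ρ} = -f_{N,ρ}, contradicting the stated f_{N,ρ} = f_{N,N+ρ} = f_{N,-ρ}; here the formula is used for 0<ρ<N and extended N-periodically in ρ (Biagioli's factor (-1)^{⌊ρ/N⌋}), as the floor term in L requires. *)

(* Defs.v *)
From HB Require Import structures.
From mathcomp Require Import all_boot all_order all_algebra.
From mathcomp Require Import zify ring lra.
From mathcomp Require cyclic.
From mathcomp Require Import complex.
From mathcomp Require Import all_classical all_reals all_analysis.

Set Implicit Arguments.
Unset Strict Implicit.
Unset Printing Implicit Defensive.

Import Order.TTheory GRing.Theory Num.Theory.
Import numFieldNormedType.Exports.

Local Open Scope classical_set_scope.
Local Open Scope ring_scope.
Local Open Scope complex_scope.

Definition cexp (R : realType) (z : R[i]) : R[i] :=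
  (expR (complex.Re z))%:C * (cos (complex.Im z) +i* sin (complex.Im z)).

(* q^s with q = exp(2 pi i z); for fractional s this fixes the branch
   exp(2 pi i s z). *)
Definition qpow (R : realType) (z : R[i]) (s : rat) : R[i] :=
  cexp (2 * pi%:C * 'i%C * ratr s * z).

(* The limit is taken for the norm topology of R[i], which is carried by the
   alias R[i]^o. *)
Definition qpoch (R : realType) (a q : R[i]) : R[i] :=
  lim ((\prod_(j < n) (1 - a * q ^+ j) : R[i]^o) @[n --> \oo]).

Definition dedekind_eta (R : realType) (z : R[i]) : R[i] :=
  qpow z (1 / 24) * qpoch (qpow z 1) (qpow z 1).

(* The formula
     q^((N - 2 rho)^2 / (8 N)) (q^rho, q^(N - rho), q^N; q^N)_oo
   changes sign under rho |-> N + rho and rho |-> - rho, so it is compatible with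
   f_(N,rho) = f_(N,N+rho) = f_(N,-rho) only after Biagioli's normalising factor
   (-1)^floor(rho / N) is inserted.  This amounts to using the formula for
   0 < rho < N and extending it N-periodically, as is done here; see
   fBiagioliD and fBiagioliN below. *)
Definition fBiagioli (R : realType) (N : nat) (rho : int) (z : R[i]) : R[i] :=
  let r := (rho %% N%:Z)%Z in
  let qN := qpow z N%:R in
  qpow z ((N%:R - 2 * r%:~R) ^+ 2 / (8 * N%:R)) *
  (qpoch (qpow z r%:~R) qN * qpoch (qpow z (N%:R - r%:~R)) qN * qpoch qN qN).

(* (n_0, n_1, ..., n_((p-1)/2)), for odd p. *)
Definition expvec (p : nat) := {ffun 'I_((p.-1)./2).+1 -> int}.

Definition jfun (R : realType) (p : nat) (n : expvec p) (z : R[i]) : R[i] :=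
  dedekind_eta (p%:R * z) ^ n ord0 *
  \prod_(k < ((p.-1)./2).+1 | (0 < k)%N) fBiagioli p k%:Z z ^ n k.

Definition frakF_cond (m : int) (p : nat) (n : expvec p) : Prop :=
  [/\ n ord0 + \sum_(k < ((p.-1)./2).+1 | (0 < k)%N) n k = 2,
      (\sum_(k < ((p.-1)./2).+1 | (0 < k)%N) k%:Z ^+ 2 * n k
         = 2 * m %[mod p%:Z])%Z
    & (n ord0 + 3 * \sum_(k < ((p.-1)./2).+1 | (0 < k)%N) n k
         = 0 %[mod 24])%Z].

(* Functions on the upper half plane are represented by functions on R[i] up to
   equality on Im z > 0. *)
Definition frakF (R : realType) (m : int) (p : nat) : set (R[i] -> R[i]) :=
  [set g | exists2 n : expvec p, frakF_cond m n &
           forall z : R[i], 0 < complex.Im z -> g z = jfun n z].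

Definition mat2 (T : Type) (a b c d : T) : 'M[T]_2 :=
  \matrix_(i, j) if i == 0 then (if j == 0 then a else b)
                 else (if j == 0 then c else d).

Definition Gamma0 (N : nat) : set 'M[int]_2 :=
  [set A : 'M[int]_2 | \det A = 1 /\ (N%:Z %| A 1%R 0%R)%Z].

Definition moebius (R : realType) (A : 'M[R]_2) (z : R[i]) : R[i] :=
  ((A 0 0)%:C * z + (A 0 1)%:C) / ((A 1 0)%:C * z + (A 1 1)%:C).

(* (det A)^(k/2) is (sqrt (det A))^k. *)
Definition stroke (R : realType) (k : int) (F : R[i] -> R[i]) (A : 'M[R]_2)
    (z : R[i]) : R[i] :=
  (Num.sqrt (\det A) ^ k)%:C * ((A 1 0)%:C * z + (A 1 1)%:C) ^ (- k) *
  F (moebius A z).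

(* %/ is the floor of the quotient since p > 0. *)
Definition Lexp (p : nat) (n : expvec p) (a b : int) : int :=
  b * (a + 1) * (\sum_(k < ((p.-1)./2).+1 | (0 < k)%N) k%:Z * n k) +
  \sum_(k < ((p.-1)./2).+1 | (0 < k)%N) ((k%:Z * a) %/ p%:Z)%Z * n k.

Definition pi_rel (p r i i' : nat) : bool :=
  (r * i' == i %[mod p])%N || (p %| r * i' + i)%N.

(* The i' in {1, ..., (p-1)/2} with r i' = i or r i' = -i mod p; by pi_idxP and
   pi_idx_uniq it exists and is unique, so the default i is never used. *)
Definition pi_idx (p r : nat) (i : 'I_((p.-1)./2).+1) : 'I_((p.-1)./2).+1 :=
  odflt i [pick i' : 'I_((p.-1)./2).+1 | (0 < i')%N && pi_rel p r i i'].

Definition pi_vec (p r : nat) (n : expvec p) : expvec p :=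
  [ffun i : 'I_((p.-1)./2).+1 => if (0 < i)%N then n (pi_idx r i) else n ord0].

Lemma fBiagioliD (R : realType) (N : nat) (rho : int) (z : R[i]) :
  fBiagioli N (N%:Z + rho) z = fBiagioli N rho z.
Proof. by rewrite /fBiagioli modzDl. Qed.

Lemma fBiagioliN (R : realType) (N : nat) (rho : int) (z : R[i]) :
  (0 < N)%N -> ~~ (N%:Z %| rho)%Z -> fBiagioli N (- rho) z = fBiagioli N rho z.
Proof.
move=> N0 ndvd; have N0' : N%:Z != 0 by rewrite eqz_nat -lt0n.
have r0 : (rho %% N%:Z)%Z != 0 by apply: contra ndvd => /eqP /dvdz_mod0P.
have E : (- rho %% N%:Z)%Z = N%:Z - (rho %% N%:Z)%Z.
  have := modz_ge0 rho N0'; have : (rho %% N%:Z)%Z < N%:Z.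
    by rewrite ltz_pmod // ltz_nat.
  move=> h1 h2; rewrite {1}(divz_eq rho N%:Z).
  have -> : - ((rho %/ N%:Z)%Z * N%:Z + (rho %% N%:Z)%Z) =
      (- (rho %/ N%:Z)%Z - 1) * N%:Z + (N%:Z - (rho %% N%:Z)%Z) by ring.
  rewrite modzMDl modz_small //; lia.
rewrite /fBiagioli E intrB /= -[(N%:Z)%:~R]/(N%:R).
set r : rat := (_ %% _)%Z%:~R.
have -> : (N%:R - 2 * (N%:R - r)) ^+ 2 = (N%:R - 2 * r) ^+ 2 by ring.
by rewrite subKr (mulrC (qpoch (qpow z (_ - _)) _)).
Qed.

Lemma pi_idxP (p r : nat) (i : 'I_((p.-1)./2).+1) :
  prime p -> (2 < p)%N -> (0 < r <= (p.-1)./2)%N -> (0 < i)%N ->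
  (0 < pi_idx r i)%N && pi_rel p r i (pi_idx r i).
Proof.
move=> pp p2 /andP[r0 rh] i0; rewrite /pi_idx; case: pickP => [//|/= nex].
have podd : odd p by case/even_prime: pp => // pE; rewrite pE in p2.
have pE : p = ((p.-1)./2).*2.+1.
  by rewrite -[LHS](odd_double_half p) podd; congr (_.+1); lia.
have ile := ltn_ord i; have rp : coprime p r.
  by rewrite prime_coprime // gtnNdvd //; lia.
have cop : coprime p i by rewrite prime_coprime // gtnNdvd //; lia.
pose x := (r ^ (p - 2) * i %% p)%N.
have xlt : (x < p)%N by rewrite ltn_mod; lia.
have rx : r * x = i %[mod p].
  rewrite modnMmr mulnA -expnS; have -> : (p - 2).+1 = p.-1 by lia.
  have := cyclic.Euler_exp_totient (a := r) (n := p); rewrite coprime_sym rp => /(_ isT).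
  by rewrite totient_prime // => h; rewrite -modnMml h modnMml mul1n.
have x0 : (0 < x)%N.
  rewrite lt0n; apply/eqP => xE; move: rx; rewrite xE muln0 mod0n => /esym/eqP.
  by rewrite -/(dvdn p i) gtnNdvd //; lia.
have [xh|xh] := leqP x (p.-1)./2.
  by have := nex (Ordinal (xh : (x < ((p.-1)./2).+1)%N)); rewrite /= x0 /pi_rel rx eqxx.
have yh : (p - x < ((p.-1)./2).+1)%N by lia.
have := nex (Ordinal yh); rewrite /= /pi_rel.
have -> : (p %| r * (p - x) + i)%N.
  rewrite /dvdn -modnDmr -rx modnDmr -mulnDr subnK ?(ltnW xlt) //.
  by rewrite modnMl.
by rewrite orbT andbT subn_gt0 xlt.
Qed.

Lemma pi_idx_uniq (p r : nat) (i i1 i2 : 'I_((p.-1)./2).+1) :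
  prime p -> (2 < p)%N -> (0 < r <= (p.-1)./2)%N ->
  (0 < i1)%N -> (0 < i2)%N -> pi_rel p r i i1 -> pi_rel p r i i2 -> i1 = i2.
Proof.
move=> pp p2 /andP[r0 rh] i10 i20 h1 h2.
have podd : odd p by case/even_prime: pp => // pE; rewrite pE in p2.
have pE : p = ((p.-1)./2).*2.+1.
  by rewrite -[LHS](odd_double_half p) podd; congr (_.+1); lia.
have l1 := ltn_ord i1; have l2 := ltn_ord i2.
have rp : ~~ (p %| r)%N by rewrite gtnNdvd //; lia.
have tr u : pi_rel p r i u ->
    (p%:Z %| r%:Z * u%:Z - i%:Z)%Z \/ (p%:Z %| r%:Z * u%:Z + i%:Z)%Z.
  case/orP => [h|h]; [left|right].
    by rewrite -eqz_mod_dvd -PoszM !modz_nat eqz_nat.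
  by rewrite -PoszM -PoszD.
have key : (p%:Z %| r%:Z * (i1%:Z - i2%:Z))%Z \/ (p%:Z %| r%:Z * (i1%:Z + i2%:Z))%Z.
  case: (tr _ h1) (tr _ h2) => d1 [] d2; [left|right|right|left].
  - have -> : r%:Z * (i1%:Z - i2%:Z) =
      (r%:Z * i1%:Z - i%:Z) - (r%:Z * i2%:Z - i%:Z) by ring.
    exact: rpredB.
  - have -> : r%:Z * (i1%:Z + i2%:Z) =
      (r%:Z * i1%:Z - i%:Z) + (r%:Z * i2%:Z + i%:Z) by ring.
    exact: rpredD.
  - have -> : r%:Z * (i1%:Z + i2%:Z) =
      (r%:Z * i1%:Z + i%:Z) + (r%:Z * i2%:Z - i%:Z) by ring.
    exact: rpredD.
  - have -> : r%:Z * (i1%:Z - i2%:Z) =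
      (r%:Z * i1%:Z + i%:Z) - (r%:Z * i2%:Z + i%:Z) by ring.
    exact: rpredB.
have nr x : (p%:Z %| r%:Z * x)%Z -> (p %| `|x|)%N.
  by rewrite dvdzE abszM /= Euclid_dvdM // (negbTE rp).
case: key => /nr d; apply: val_inj => /=; last first.
  by move: d; rewrite -PoszD /= gtnNdvd //; lia.
have [|dn0] := posnP `|i1%:Z - i2%:Z|%N; first by lia.
by move: d; rewrite gtnNdvd //; lia.
Qed.

(* Main.v *)
(* On tau = p z a matrix of Gamma_0(p) with lower row (p, d) acts as
   tau |-> a - 1 / (tau + d), so a single inversion has to be understood.  By
   condition (1) and condition (3), j is a power of the discriminant times a
   product of Klein forms K(k z | p z) of weight -1, and no multiplier system
   survives.

   K(u | t) is the product of (1 - u / w) over the lattice Z t + Z, taken row by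
   row; inversion takes it column by column.  For y(u) = 1 - u^2 / w^2, the
   quotient y(k u) / y(u)^(k^2) is 1 + O(w^-4), and the order of the product is
   then immaterial.  Hence the defect h(u) of the expected inversion formula, a
   doubly periodic function, satisfies h(k u) = h(u)^(k^2), which forces h = 1 at
   all torsion points; these are the only points needed.  The three points of
   order 2 give the inversion formula of the discriminant.

   Membership of j in F(m, p) only provides some exponent vector with the same j;
   it is the given one because the expansion at q = 0 determines the exponents. *)
From HB Require Import structures.
Require Import Defs.
From mathcomp Require Import all_boot all_order all_algebra.
From mathcomp Require Import complex.
From mathcomp Require Import all_classical all_reals all_analysis.
From mathcomp Require Import zify ring lra.

Set Implicit Arguments.
Unset Strict Implicit.
Unset Printing Implicit Defensive.

Import Order.TTheory GRing.Theory Num.Theory.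
Import numFieldNormedType.Exports.
Local Open Scope classical_set_scope.
Local Open Scope ring_scope.
Local Open Scope complex_scope.

(** Liouville's theorem would make the zero-free doubly periodic defect constant at once. The
    scaling law replaces it by the absolute convergence of one double product and algebra with roots
    of unity. The exponent [k^2] is dictated by the expansion in [s = u^2 / w^2]: in
    [(1 - k^2 s) / (1 - s)^(k^2)] the terms in [w^-2], whose sum over the lattice converges only
    conditionally, cancel. The Gaussian [exp (pi i u^2 / t)] that pays for the reordering is
    quadratic in [u], so it obeys the same law. For the matrix, the torsion points are
    [u = k (a z + b)] modulo [Z t + Z] with [t = p z + d]. The sign [(-1)^L] has three sources:
    removing the integer [k b] from [u], reducing [k a] modulo [p] (the floors), and the exponents
    [k^2 a b / (2 p)] left by the Gaussians, which condition (2) fixes only up to a half-integer,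
    whose parity is read off from [k^2 = k] modulo 2. *)

Notation nc := (@Normc.normc _).

(** * The real-valued modulus of a complex number *)

Section Modulus.
Variable R : realType.
Implicit Types (x y z : R[i]) (r : R).

Lemma nc_normE z : `|z| = (nc z)%:C.
Proof. by case: z. Qed.

Lemma nc_ge0 z : 0 <= nc z.
Proof. by case: z => a b; exact: sqrtr_ge0. Qed.

Lemma ncM x y : nc (x * y) = nc x * nc y.
Proof. exact: Normc.normcM. Qed.

Lemma ncV x : nc x^-1 = (nc x)^-1.
Proof. exact: Normc.normcV. Qed.

Lemma nc1 : nc (1 : R[i]) = 1.
Proof. exact: Normc.normc1. Qed.

Lemma nc0 : nc (0 : R[i]) = 0.
Proof. exact: Normc.normc0. Qed.

Lemma ncD x y : nc (x + y) <= nc x + nc y.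
Proof. exact: (@le_normcD R x y). Qed.

Lemma ncN x : nc (- x) = nc x.
Proof. exact: (@normcN R x). Qed.

Lemma ncB x y : nc (x - y) <= nc x + nc y.
Proof. by rewrite -(ncN y) ncD. Qed.

Lemma nc_distC x y : nc (x - y) = nc (y - x).
Proof. by rewrite -ncN opprB. Qed.

Lemma nc_lerB x y : nc x - nc y <= nc (x - y).
Proof. by rewrite lerBlDr -{1}(subrK y x) ncD. Qed.

Lemma ncX x n : nc (x ^+ n) = nc x ^+ n.
Proof. by elim: n => [|n IH]; rewrite ?expr0 ?nc1 // !exprS ncM IH. Qed.

Lemma nc_eq0 x : (nc x == 0) = (x == 0).
Proof.
by apply/eqP/eqP => [/Normc.eq0_normc //|->]; rewrite nc0.
Qed.

Lemma nc_gt0 x : (0 < nc x) = (x != 0).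
Proof. by rewrite lt0r nc_ge0 andbT nc_eq0. Qed.

Lemma nc_real r : nc r%:C = `|r|.
Proof. by rewrite /Normc.normc /= expr0n /= addr0 sqrtr_sqr. Qed.

Lemma nc_nat n : nc (n%:R : R[i]) = n%:R.
Proof.
have -> : (n%:R : R[i]) = (n%:R : R)%:C by rewrite rmorph_nat.
by rewrite nc_real ger0_norm.
Qed.

Lemma nc_i : nc ('i%C : R[i]) = 1.
Proof. by rewrite /Normc.normc /= expr0n expr1n add0r sqrtr1. Qed.

Lemma nc_Re z : `|complex.Re z| <= nc z.
Proof.
by case: z => a b /=; rewrite -sqrtr_sqr ler_wsqrtr // lerDl sqr_ge0.
Qed.

Lemma nc_Im z : `|complex.Im z| <= nc z.
Proof.
by case: z => a b /=; rewrite -sqrtr_sqr ler_wsqrtr // lerDr sqr_ge0.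
Qed.

Lemma nc_le_ReIm z : nc z <= `|complex.Re z| + `|complex.Im z|.
Proof.
case: z => a b /=.
rewrite -[leRHS]ger0_norm ?addr_ge0 // -sqrtr_sqr ler_wsqrtr //.
have -> : (`|a| + `|b|) ^+ 2 = a ^+ 2 + b ^+ 2 + 2 * (`|a| * `|b|).
  by rewrite -(real_normK (num_real a)) -(real_normK (num_real b)); ring.
by rewrite lerDl !mulr_ge0.
Qed.

Lemma nc_prod (I : Type) (s : seq I) (P : pred I) (F : I -> R[i]) :
  nc (\prod_(i <- s | P i) F i) = \prod_(i <- s | P i) nc (F i).
Proof. by elim/big_rec2: _ => [|i x y _ <-]; rewrite ?nc1 ?ncM. Qed.

End Modulus.

(** * Limits of complex sequences *)

Section Limits.
Variable R : realType.
Implicit Types (f g : nat -> R[i]) (l k : R[i]).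

(* A sealed form of convergence in [R[i]^o]: unfolding the topology of [R[i]^o]
   makes unification prohibitively slow. *)
Variant ccvg f l : Prop :=
  Ccvg of (fun n => nc (f n - l)) @ \oo --> (0 : R).

Lemma ccvgP f l : ccvg f l -> (fun n => nc (f n - l)) @ \oo --> (0 : R).
Proof. by case. Qed.

Lemma ccvg_cvg f l : ccvg f l -> (f : nat -> R[i]^o) @ \oo --> (l : R[i]^o).
Proof.
case=> /cvgrPdist_lt h; apply/cvgrPdist_lt => e e0.
have eE : e = (complex.Re e)%:C.
  by move: e0; case: (e) => a b; rewrite ltcE /= => /andP[/eqP -> _].
have e0' : 0 < complex.Re e by move: e0; rewrite eE ltcR.
apply: filterS (h _ e0') => n /=.
rewrite sub0r normrN ger0_norm ?nc_ge0 // => hn.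
by rewrite distrC nc_normE eE ltcR.
Qed.

Lemma ccvg_lim f l : ccvg f l -> lim ((f n : R[i]^o) @[n --> \oo]) = l.
Proof. by move=> h; apply: (cvg_lim (@norm_hausdorff _ R[i]^o) (ccvg_cvg h)). Qed.

Lemma ccvg_squeeze f l (u : nat -> R) :
  (forall n, nc (f n - l) <= u n) -> u @ \oo --> 0 -> ccvg f l.
Proof.
move=> h u0; split; apply: (squeeze_cvgr _ (cvg_cst (0 : R)) u0).
by apply: nearW => n; rewrite nc_ge0 h.
Qed.

Lemma ccvg_unique f l k : ccvg f l -> ccvg f k -> l = k.
Proof.
move=> /ccvgP h1 /ccvgP h2; apply/eqP; rewrite -subr_eq0 -nc_eq0.
have h : (fun n => nc (f n - l) + nc (f n - k)) @ \oo --> (0 : R).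
  by rewrite -[0]addr0; exact: cvgD.
have hc : (fun _ : nat => nc (l - k)) @ \oo --> (0 : R).
  apply: (squeeze_cvgr _ (cvg_cst (0 : R)) h).
  apply: nearW => n; rewrite nc_ge0 /= nc_distC.
  have -> : k - l = (f n - l) - (f n - k) by ring.
  exact: ncB.
by rewrite (cvg_unique (@Rhausdorff R) (cvg_cst (nc (l - k))) hc).
Qed.

Lemma ccvg_cst l : ccvg (fun=> l) l.
Proof. by split; rewrite subrr nc0; exact: cvg_cst. Qed.

Lemma eq_ccvg f g l : ccvg f l -> f =1 g -> ccvg g l.
Proof. by move=> h /funext <-. Qed.

Lemma ccvg_nc f l : ccvg f l -> (fun n => nc (f n)) @ \oo --> nc l.
Proof.
move=> /ccvgP h; apply/subr_cvg0.
apply/norm_cvg0P; apply: (squeeze_cvgr _ (cvg_cst (0 : R)) h).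
apply: nearW => n; rewrite normr_ge0 /= ler_norml; apply/andP; split.
  by rewrite lerNl opprB nc_distC nc_lerB.
exact: nc_lerB.
Qed.

Lemma ccvgD f g l k : ccvg f l -> ccvg g k -> ccvg (fun n => f n + g n) (l + k).
Proof.
move=> /ccvgP h1 /ccvgP h2.
apply: (@ccvg_squeeze _ _ (fun n => nc (f n - l) + nc (g n - k))).
  by move=> n; rewrite opprD addrACA ncD.
by rewrite -[0]addr0; exact: cvgD.
Qed.

Lemma ccvgM f g l k : ccvg f l -> ccvg g k -> ccvg (fun n => f n * g n) (l * k).
Proof.
move=> /ccvgP h1 /ccvgP h2.
apply: (@ccvg_squeeze _ _ (fun n => nc (f n - l) * nc (g n - k) +
  (nc l * nc (g n - k) + nc (f n - l) * nc k))).
  move=> n; have -> : f n * g n - l * k =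
    (f n - l) * (g n - k) + (l * (g n - k) + (f n - l) * k) by ring.
  rewrite (le_trans (ncD _ _)) // ncM lerD2l (le_trans (ncD _ _)) //.
  by rewrite !ncM.
have -> : 0 = 0 * 0 + (nc l * 0 + 0 * nc k) :> R by rewrite !(mul0r, mulr0) !addr0.
by apply: cvgD; [exact: cvgM | apply: cvgD; apply: cvgM => //; exact: cvg_cst].
Qed.

Lemma ccvgZ a f l : ccvg f l -> ccvg (fun n => a * f n) (a * l).
Proof. by move=> h; apply: ccvgM => //; exact: ccvg_cst. Qed.

Lemma ccvgN f l : ccvg f l -> ccvg (fun n => - f n) (- l).
Proof.
move=> h; rewrite -mulN1r; apply: (eq_ccvg (ccvgZ (-1) h)) => n.
by rewrite mulN1r.
Qed.

Lemma ccvgB f g l k : ccvg f l -> ccvg g k -> ccvg (fun n => f n - g n) (l - k).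
Proof. by move=> h1 h2; apply: ccvgD => //; exact: ccvgN. Qed.

Lemma ccvgV f l : l != 0 -> ccvg f l -> ccvg (fun n => (f n)^-1) l^-1.
Proof.
move=> l0 h; have hn := ccvg_nc h; have /ccvgP h0 := h.
have ln0 : nc l != 0 by rewrite nc_eq0.
have hV : (fun n => nc (f n - l) * ((nc (f n))^-1 * (nc l)^-1)) @ \oo --> (0 : R).
  rewrite -[X in _ --> X](mul0r ((nc l)^-1 * (nc l)^-1)).
  by apply: cvgM => //; apply: cvgM; [exact: cvgV | exact: cvg_cst].
split; apply: (squeeze_cvgr _ (cvg_cst (0 : R)) hV).
have : \forall n \near \oo, 0 < nc (f n).
  by apply: (cvgr_gt (nc l)) => //; rewrite nc_gt0.
apply: filterS => n fn0; rewrite nc_ge0 /=.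
have fn0' : f n != 0 by rewrite -nc_gt0.
have -> : (f n)^-1 - l^-1 = (l - f n) * ((f n)^-1 * l^-1).
  by field; rewrite l0 fn0'.
by rewrite !ncM !ncV nc_distC.
Qed.

Lemma ccvgX f l m : ccvg f l -> ccvg (fun n => f n ^+ m) (l ^+ m).
Proof.
move=> h; elim: m => [|m IH].
  by rewrite expr0; exact: (eq_ccvg (ccvg_cst 1)).
by rewrite exprS; apply: (eq_ccvg (ccvgM h IH)) => n; rewrite exprS.
Qed.

Lemma ccvg_comp f l (phi : nat -> nat) :
  phi @ \oo --> \oo -> ccvg f l -> ccvg (f \o phi) l.
Proof.
by move=> h1 /ccvgP h2; split; exact: (cvg_comp phi (fun n => nc (f n - l)) h1 h2).
Qed.

Lemma ccvgS f l : ccvg f l -> ccvg (fun n => f n.+1) l.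
Proof.
by move=> /ccvgP; rewrite -(cvg_shiftS (fun n => nc (f n - l))).
Qed.

Lemma ccvg_le f l b : ccvg f l -> (forall n, nc (f n) <= b) -> nc l <= b.
Proof.
move=> /ccvg_nc h hb; rewrite -(cvg_lim (@Rhausdorff R) h).
apply: limr_le; first by apply/cvg_ex; exists (nc l).
exact: nearW.
Qed.

Lemma ccvg_ge f l b : ccvg f l -> (\forall n \near \oo, b <= nc (f n)) -> b <= nc l.
Proof.
move=> /ccvg_nc h hb; rewrite -(cvg_lim (@Rhausdorff R) h).
by apply: limr_ge => //; apply/cvg_ex; exists (nc l).
Qed.

Lemma ccvg_ReIm f (a b : R) :
  (fun n => complex.Re (f n)) @ \oo --> a ->
  (fun n => complex.Im (f n)) @ \oo --> b -> ccvg f (a +i* b).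
Proof.
move=> ha hb.
apply: (@ccvg_squeeze _ _
  (fun n => `|complex.Re (f n) - a| + `|complex.Im (f n) - b|)).
  by move=> n; rewrite (le_trans (nc_le_ReIm _)) //; case: (f n).
rewrite -[0]addr0; apply: cvgD.
  by apply/norm_cvg0P/subr_cvg0.
by apply/norm_cvg0P/subr_cvg0.
Qed.

Lemma ccvg_bounded f l : ccvg f l -> exists2 b, 0 < b & forall n, nc (f n) <= b.
Proof.
move=> /ccvg_nc h.
have /cvg_ex/cvg_seq_bounded/pinfty_ex_gt0[M M0 /= hM] :
    exists l' : R, (fun n => nc (f n)) @ \oo --> l' by exists (nc l).
by exists M => // n; rewrite -[leLHS]ger0_norm ?nc_ge0 //; exact: hM.
Qed.

End Limits.

(** * Infinite products with summable majorants *)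

Section Products.
Variable R : realType.
Implicit Types (x y : nat -> R[i]) (M : nat -> R).

Lemma summableZ M (B : R) : cvgn (series M) -> cvgn (series (fun n => B * M n)).
Proof. by move=> cM; have := @is_cvg_seriesZ _ M B cM. Qed.

Lemma prod1D_le_expR (I : Type) (s : seq I) (F : I -> R) :
  (forall i, 0 <= F i) -> \prod_(i <- s) (1 + F i) <= expR (\sum_(i <- s) F i).
Proof.
move=> F0; elim: s => [|i s IH]; first by rewrite !big_nil expR0.
rewrite !big_cons expRD ler_pM ?addr_ge0 ?prodr_ge0 ?expR_ge1Dx //.
by move=> j _; rewrite addr_ge0.
Qed.

Lemma nc_prod1D_sub1 (I : Type) (s : seq I) (F : I -> R[i]) :
  nc (\prod_(i <- s) (1 + F i) - 1) <= expR (\sum_(i <- s) nc (F i)) - 1.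
Proof.
elim: s => [|i s IH]; first by rewrite !big_nil subrr nc0 expR0 subrr.
rewrite !big_cons expRD.
set P := \prod_(j <- s) _ in IH *; set E := expR _ in IH *.
have -> : (1 + F i) * P - 1 = (1 + F i) * (P - 1) + F i by ring.
rewrite (le_trans (ncD _ _)) // ncM.
have h1 : nc (1 + F i) <= expR (nc (F i)).
  by rewrite (le_trans (ncD _ _)) // nc1 expR_ge1Dx.
have h2 : 1 + nc (F i) <= expR (nc (F i)) := expR_ge1Dx _.
have h3 : nc (1 + F i) * nc (P - 1) <= expR (nc (F i)) * (E - 1).
  by rewrite ler_pM ?nc_ge0.
rewrite (_ : _ * E - 1 = expR (nc (F i)) * (E - 1) + (expR (nc (F i)) - 1)); last by ring.
by rewrite lerD // lerBrDl.
Qed.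

(** Exchange one factor at a time; since [1 + F i >= 1], each mixed product of the other factors
    stays below the full product of the majorants. *)
Lemma nc_prodB (I : Type) (s : seq I) (a b : I -> R[i]) (F : I -> R) :
  (forall i, 0 <= F i) -> (forall i, nc (a i) <= 1 + F i) ->
  (forall i, nc (b i) <= 1 + F i) ->
  nc (\prod_(i <- s) a i - \prod_(i <- s) b i) <=
  \prod_(i <- s) (1 + F i) * \sum_(i <- s) nc (a i - b i).
Proof.
move=> F0 ha hb; elim: s => [|i s IH]; first by rewrite !big_nil subrr nc0 mulr0.
rewrite !big_cons.
set A := \prod_(j <- s) a j in IH *; set B := \prod_(j <- s) b j in IH *.
set P := \prod_(j <- s) (1 + F j) in IH *; set S := \sum_(j <- s) _ in IH *.
have -> : a i * A - b i * B = (a i - b i) * A + b i * (A - B) by ring.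
have hA : nc A <= P.
  by rewrite /A nc_prod; apply: ler_prod => j _; rewrite nc_ge0 ha.
have P0 : 0 <= P := le_trans (nc_ge0 _) hA.
have S0 : 0 <= S by apply: sumr_ge0 => j _; exact: nc_ge0.
rewrite (le_trans (ncD _ _)) // !ncM.
have h1 : nc (a i - b i) * nc A <= (1 + F i) * P * nc (a i - b i).
  rewrite mulrC ler_wpM2r ?nc_ge0 // (le_trans hA) // ler_peMl //.
  by rewrite lerDl.
have h2 : nc (b i) * nc (A - B) <= (1 + F i) * (P * S) by rewrite ler_pM ?nc_ge0.
by rewrite mulrDr lerD // -mulrA.
Qed.

Lemma ler_series_lim M n : (forall j, 0 <= M j) -> cvgn (series M) ->
  \sum_(j < n) M j <= limn (series M).
Proof.
move=> M0 cM; rewrite -(big_mkord xpredT M).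
apply: (nondecreasing_cvgn_le (u_ := series M)) => //.
exact: nondecreasing_series.
Qed.

Lemma prod_ccvg x M : (forall j, nc (x j) <= M j) -> cvgn (series M) ->
  exists l, ccvg (fun n => \prod_(j < n) (1 + x j)) l.
Proof.
move=> xM cM; have M0 j : 0 <= M j := le_trans (nc_ge0 _) (xM j).
pose P n := \prod_(j < n) (1 + x j); pose B := expR (limn (series M)).
have PB n : nc (P n) <= B.
  rewrite nc_prod (@le_trans _ _ (\prod_(j < n) (1 + M j))) //.
    apply: ler_prod => j _; rewrite nc_ge0 (le_trans (ncD _ _)) //.
    by rewrite nc1 lerD2l.
  rewrite (le_trans (prod1D_le_expR _ _)) // ler_expR.
  exact: ler_series_lim.
have B0 : 0 <= B := expR_ge0 _.
have dP n : nc (P n.+1 - P n) <= B * M n.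
  rewrite /P big_ord_recr /= -/(P n).
  have -> : P n * (1 + x n) - P n = P n * x n by ring.
  by rewrite ncM ler_pM ?nc_ge0.
have cBM : cvgn (series (fun n => B * M n)).
  exact: summableZ.
(* [g] is the real or the imaginary part: the partial products converge because their increments
   form two absolutely convergent real series. *)
have key (g : R[i] -> R) : (forall u v, g (u - v) = g u - g v) ->
    (forall u, `|g u| <= nc u) -> exists a : R, (fun n => g (P n)) @ \oo --> a.
  move=> gB gn; pose u n := g (P n).
  have cu : cvgn (series (telescope u)).
    apply: normed_cvg; apply: (series_le_cvg _ _ _ cBM) => n.
    - exact: normr_ge0.
    - by rewrite mulr_ge0.
    have /= := gn (P n.+1 - P n); rewrite gB => hg.
    exact: le_trans hg (dP n).
  exists (u 0%N + limn (series (telescope u))).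
  rewrite (_ : (fun n => _) = (fun n => u 0%N + series (telescope u) n)).
    by apply: cvgD => //; exact: cvg_cst.
  by apply/funext => n; rewrite -eq_sum_telescope.
have [a ha] := key _ (@raddfB _ _ (@complex.Re R)) (@nc_Re R).
have [b hb] := key _ (@raddfB _ _ (@complex.Im R)) (@nc_Im R).
by exists (a +i* b); exact: ccvg_ReIm.
Qed.

(** Tannery's theorem for sums, with [N] both the parameter and the length: beyond a fixed [J] the
    tail of [M] controls the sum, and the first [J] terms tend to 0 one by one. *)
Lemma dominated_sum (a : nat -> nat -> R) M :
  (forall N j, 0 <= a N j <= M j) -> (forall j, a ^~ j @ \oo --> 0) ->
  cvgn (series M) -> (fun N => \sum_(j < N) a N j) @ \oo --> 0.
Proof.
move=> aM a0 cM.
have M0 j : 0 <= M j by have /andP[h1 h2] := aM 0%N j; exact: le_trans h2.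
apply/cvgrPdist_lt => e e0.
have e20 : 0 < e / 2 by rewrite divr_gt0.
have /cvgrPdist_lt/(_ _ e20)[J _ hJ] := cM.
have hs : (fun N => \sum_(j < J) a N j) @ \oo --> (0 : R).
  elim: (J) => [|K IH].
    by under eq_fun do rewrite big_ord0; exact: cvg_cst.
  rewrite (_ : (fun N => _) = (fun N => \sum_(j < K) a N j + a N K)); last first.
    by apply/funext => N; rewrite big_ord_recr.
  by rewrite -[X in _ --> X]addr0; apply: cvgD => //; exact: a0.
have /cvgrPdist_lt/(_ _ e20)[J2 _ hJ2] := hs.
exists (maxn J J2) => // N /=; rewrite geq_max => /andP[JN J2N].
rewrite sub0r normrN ger0_norm; last first.
  by apply: sumr_ge0 => j _; have /andP[] := aM N j.
have := hJ2 _ J2N; rewrite sub0r normrN ger0_norm; last first.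
  by apply: sumr_ge0 => j _; have /andP[] := aM N j.
move=> h2; have h1 := hJ J (leqnn J).
rewrite -(big_mkord xpredT) (big_cat_nat (n := J)) //= big_mkord.
have -> : e = e / 2 + e / 2 by rewrite -splitr.
apply: ltr_leD => //.
rewrite (@le_trans _ _ (\sum_(J <= j < N) M j)) //.
  by apply: ler_sum => j _; have /andP[] := aM N j.
have h3 : series M N <= limn (series M).
  by rewrite /series /= big_mkord ler_series_lim.
have h4 : series M N = series M J + \sum_(J <= j < N) M j.
  by rewrite /series /= -big_cat_nat.
have := ltW (le_lt_trans (ler_norm _) h1); lra.
Qed.

(* Tannery's theorem for infinite products. *)
Lemma dominated_prod (x : nat -> nat -> R[i]) y M Y :
  (forall N j, nc (x N j) <= M j) -> (forall j, ccvg (x ^~ j) (y j)) ->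
  cvgn (series M) -> ccvg (fun n => \prod_(j < n) (1 + y j)) Y ->
  ccvg (fun N => \prod_(j < N) (1 + x N j)) Y.
Proof.
move=> xM xy cM hY; have M0 j : 0 <= M j := le_trans (nc_ge0 _) (xM 0%N j).
have yM j : nc (y j) <= M j by apply: ccvg_le (xy j) _ => N; exact: xM.
have -> : Y = Y + 0 by rewrite addr0.
pose D N := \prod_(j < N) (1 + x N j) - \prod_(j < N) (1 + y j).
have hD : ccvg D 0.
  apply: (@ccvg_squeeze _ _ _
    (fun N => expR (limn (series M)) * \sum_(j < N) nc (x N j - y j))).
    move=> N; rewrite subr0.
    have h := @nc_prodB 'I_N (index_enum 'I_N)
      (fun j => 1 + x N j) (fun j => 1 + y j) (fun j => M j).
    rewrite (le_trans (h _ _ _)) //.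
    - by move=> j; rewrite (le_trans (ncD _ _)) // nc1 lerD2l.
    - by move=> j; rewrite (le_trans (ncD _ _)) // nc1 lerD2l.
    have -> : \sum_(j < N) nc (1 + x N j - (1 + y j)) =
        \sum_(j < N) nc (x N j - y j).
      by apply: eq_bigr => j _; congr nc; ring.
    rewrite ler_wpM2r //; first by apply: sumr_ge0 => j _; exact: nc_ge0.
    by rewrite (le_trans (prod1D_le_expR _ _)) // ler_expR ler_series_lim.
  rewrite -[X in _ --> X](mulr0 (expR (limn (series M)))).
  apply: cvgM; first exact: cvg_cst.
  apply: (@dominated_sum (fun N j => nc (x N j - y j)) (fun j => M j + M j)).
  - move=> N j; rewrite nc_ge0 (le_trans (ncB _ _)) // lerD //.
  - by move=> j; exact: (ccvgP (xy j)).
  - by have := is_cvg_seriesD cM cM.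
apply: (eq_ccvg (ccvgD hY hD)) => N; rewrite /D; ring.
Qed.

(** Both iterated products are limits of the products over the squares [m, n < N]. Indeed the row
    products truncated at [N] differ from 1 by at most a multiple of [M m], uniformly in [N], so
    [dominated_prod] applies to them; columns are the rows of the transposed array. *)
Lemma prod_fubini (y : nat -> nat -> R[i]) (K : R) M (r c : nat -> R[i]) X Y :
  (forall j, 0 <= M j) -> cvgn (series M) ->
  (forall m n, nc (y m n) <= K * M m * M n) ->
  (forall m, ccvg (fun N => \prod_(n < N) (1 + y m n)) (r m)) ->
  (forall n, ccvg (fun N => \prod_(m < N) (1 + y m n)) (c n)) ->
  ccvg (fun N => \prod_(m < N) r m) X -> ccvg (fun N => \prod_(n < N) c n) Y ->
  X = Y.
Proof.
move=> M0 cM.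
have key (z : nat -> nat -> R[i]) s Z : (forall m n, nc (z m n) <= K * M m * M n) ->
    (forall m, ccvg (fun N => \prod_(n < N) (1 + z m n)) (s m)) ->
    ccvg (fun N => \prod_(m < N) s m) Z ->
    ccvg (fun N => \prod_(m < N) \prod_(n < N) (1 + z m n)) Z.
  move=> zM hs hZ; pose L : R := limn (series M).
  have L0 : 0 <= L.
    by apply: le_trans (ler_series_lim 0 M0 cM); rewrite big_ord0.
  pose K' : R := `|K|; have K'0 : 0 <= K' := normr_ge0 K.
  pose T : R := K' * L * L.
  have zM' m n : nc (z m n) <= K' * M m * M n.
    rewrite (le_trans (zM m n)) // ler_wpM2r // ler_wpM2r //.
    exact: ler_norm.
  have sumM m N : \sum_(n < N) nc (z m n) <= K' * M m * L.
    rewrite (@le_trans _ _ (\sum_(n < N) K' * M m * M n)) //.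
      by apply: ler_sum => n _; exact: zM'.
    by rewrite -mulr_sumr ler_wpM2l ?mulr_ge0 // ler_series_lim.
  have ML m : M m <= L.
    apply: le_trans (ler_series_lim m.+1 M0 cM).
    by rewrite big_ord_recr /= lerDr sumr_ge0.
  pose B m : R := (K' * L * expR T) * M m.
  have bnd N m : nc (\prod_(n < N) (1 + z m n) - 1) <= B m.
    rewrite (le_trans (nc_prod1D_sub1 _ _)) //.
    pose t : R := K' * M m * L.
    have t0 : 0 <= t by rewrite !mulr_ge0.
    have tT : t <= T by rewrite /t /T ler_wpM2r // ler_wpM2l.
    rewrite (@le_trans _ _ (expR t - 1)) //.
      by rewrite lerD2r ler_expR sumM.
    have h1 : expR t - 1 <= t * expR t.
      have h : 1 - t <= expR (- t) by have := expR_ge1Dx (- t).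
      have : (1 - t) * expR t <= 1.
        by rewrite (le_trans (ler_wpM2r (expR_ge0 t) h)) // -expRD addNr expR0.
      rewrite mulrBl mul1r => h2; lra.
    rewrite (le_trans h1) // /B.
    have -> : K' * L * expR T * M m = t * expR T by rewrite /t; ring.
    by rewrite ler_wpM2l // ler_expR.
  have := @dominated_prod (fun N m => \prod_(n < N) (1 + z m n) - 1)
    (fun m => s m - 1) B Z bnd.
  have cB : cvgn (series B) by exact: summableZ.
  have hsm m : ccvg ((fun N m => \prod_(n < N) (1 + z m n) - 1) ^~ m) (s m - 1).
    by apply: ccvgB => //; exact: ccvg_cst.
  move=> /(_ hsm cB) hc; have /hc h : ccvg (fun N => \prod_(m < N) (1 + (s m - 1))) Z.
    by apply: (eq_ccvg hZ) => N; apply: eq_bigr => m _; ring.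
  apply: (eq_ccvg h); by move=> N; apply: eq_bigr => m _; ring.
move=> yM hr hcc hX hY; apply: (ccvg_unique (key _ _ _ yM hr hX)).
have yM' m n : nc (y n m) <= K * M m * M n.
  by rewrite mulrAC; exact: yM.
apply: (eq_ccvg (key (fun m n => y n m) _ _ yM' hcc hY)) => N.
by rewrite exchange_big.
Qed.

(** Once the tail of the majorant is below [ln (3 / 2)], the remaining partial products stay within
    [3/2 - 1 = 1/2] of 1, so the limit has at least half the modulus of the nonzero head. *)
Lemma prod_ccvg_neq0 x M l : (forall j, nc (x j) <= M j) -> cvgn (series M) ->
  (forall j, 1 + x j != 0) -> ccvg (fun n => \prod_(j < n) (1 + x j)) l -> l != 0.
Proof.
move=> xM cM x0 hl; have M0 j : 0 <= M j := le_trans (nc_ge0 _) (xM j).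
pose L : R := limn (series M).
have e0 : 0 < ln (3 / 2 : R) by apply: ln_gt0; lra.
have /cvgrPdist_lt/(_ _ e0)[J _ hJ] := cM.
pose P n := \prod_(j < n) (1 + x j).
have PJ : 0 < nc (P J).
  by rewrite nc_gt0; apply/prodf_neq0 => j _; exact: x0.
suff : nc (P J) / 2 <= nc l by rewrite -nc_gt0; apply: lt_le_trans; rewrite divr_gt0.
apply: (ccvg_ge hl); exists J => // n /= Jn.
have -> : \prod_(j < n) (1 + x j) = P J * \prod_(J <= j < n) (1 + x j).
  by rewrite -(big_mkord xpredT (fun j => 1 + x j)) (big_cat_nat (n := J)) //= big_mkord.
rewrite ncM ler_pM2l //.
have h : nc (\prod_(J <= j < n) (1 + x j) - 1) <= 1 / 2.
  rewrite (le_trans (nc_prod1D_sub1 _ _)) //.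
  have -> : 1 / 2 = expR (ln (3 / 2)) - 1 :> R by rewrite lnK ?posrE; lra.
  rewrite lerD2r ler_expR (@le_trans _ _ (\sum_(J <= j < n) M j)) //.
    by apply: ler_sum => j _; exact: xM.
  have h3 : series M n <= L by rewrite /series /= big_mkord ler_series_lim.
  have h4 : series M n = series M J + \sum_(J <= j < n) M j.
    by rewrite /series /= -big_cat_nat.
  have := hJ J (leqnn J); rewrite -/L => h5.
  have := ltW (le_lt_trans (ler_norm _) h5); lra.
have := nc_lerB 1 (\prod_(J <= j < n) (1 + x j)).
rewrite nc_distC nc1; lra.
Qed.

End Products.

(* Locked, because otherwise rewriting unfolds exponentials into products. *)
HB.lock Definition ee (R : realType) (z : R[i]) : R[i] :=
  cexp (2 * pi%:C * 'i%C * z).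

(** * The exponential [exp (2 pi i z)] *)

Section Exponential.
Variable R : realType.
Local Notation ee := (@ee R).
Implicit Types (x y z : R[i]).

Lemma cexpD x y : cexp (x + y) = cexp x * cexp y.
Proof.
case: x y => a b [c d]; rewrite /cexp /= expRD cosD sinD.
by apply/eqP; rewrite eq_complex /=; apply/andP; split; apply/eqP; ring.
Qed.

Lemma cexp0 : cexp (0 : R[i]) = 1.
Proof. by rewrite /cexp /= expR0 cos0 sin0 mul1r. Qed.

Lemma nc_cexp z : nc (cexp z) = expR (complex.Re z).
Proof.
rewrite /cexp ncM nc_real ger0_norm ?expR_ge0 // /Normc.normc /=.
by rewrite cos2Dsin2 sqrtr1 mulr1.
Qed.

Lemma natrC n : (n%:R : R[i]) = (n%:R : R)%:C.
Proof. by rewrite rmorph_nat. Qed.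

Lemma intrC (n : int) : (n%:~R : R[i]) = (n%:~R : R)%:C.
Proof. by rewrite rmorph_int. Qed.

Lemma eeE z : ee z = cexp (2 * pi%:C * 'i%C * z).
Proof. by rewrite unlock. Qed.

Lemma two_pi_iE (a b : R) :
  2 * pi%:C * 'i%C * (a +i* b) = (- (2 * pi * b)) +i* (2 * pi * a).
Proof.
by rewrite natrC; apply/eqP; rewrite eq_complex /=; apply/andP; split; apply/eqP; ring.
Qed.

Lemma eeD x y : ee (x + y) = ee x * ee y.
Proof. by rewrite !eeE mulrDr cexpD. Qed.

Lemma ee0 : ee 0 = 1.
Proof. by rewrite !eeE mulr0 cexp0. Qed.

Lemma nc_ee z : nc (ee z) = expR (- (2 * pi * complex.Im z)).
Proof. by rewrite !eeE nc_cexp; case: z => a b; rewrite two_pi_iE. Qed.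

Lemma ee_neq0 z : ee z != 0.
Proof. by rewrite -nc_gt0 nc_ee expR_gt0. Qed.

Lemma eeN z : ee (- z) = (ee z)^-1.
Proof.
by apply: (mulIf (ee_neq0 z)); rewrite mulVf ?ee_neq0 // -eeD addNr ee0.
Qed.

Lemma ee_natM n z : ee (n%:R * z) = ee z ^+ n.
Proof.
elim: n => [|n IH]; first by rewrite mul0r ee0.
by rewrite mulrSr mulrDl mul1r eeD IH exprSr.
Qed.

Lemma ee_intM (n : int) z : ee (n%:~R * z) = ee z ^ n.
Proof.
case: n => n; first by rewrite -pmulrn ee_natM.
by rewrite NegzE mulrNz mulNr eeN -pmulrn ee_natM -exprnN.
Qed.

Lemma ee_half : ee (1 / 2) = -1.
Proof.
have -> : 1 / 2 = (1 / 2) +i* 0 :> R[i].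
  have -> : (1 / 2) +i* 0 = (1 / 2 : R)%:C by [].
  by rewrite rmorphM fmorphV rmorph1 rmorph_nat.
rewrite !eeE two_pi_iE /cexp /= mulr0 oppr0 expR0.
have -> : 2 * pi * (1 / 2) = pi :> R by field.
by rewrite cospi sinpi mul1r; apply/eqP; rewrite eq_complex /= oppr0 !eqxx.
Qed.

Lemma ee1 : ee 1 = 1.
Proof.
rewrite [X in ee X](splitr 1).
by rewrite eeD ee_half mulrNN mulr1.
Qed.

Lemma ee_int (n : int) : ee n%:~R = 1.
Proof. by rewrite -[n%:~R]mulr1 ee_intM ee1 exp1rz. Qed.

Lemma ee_intD (n : int) z : ee (z + n%:~R) = ee z.
Proof. by rewrite eeD ee_int mulr1. Qed.

Lemma ee_half_int (n : int) : ee (n%:~R / 2) = (-1) ^ n.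
Proof. by rewrite -ee_half -ee_intM mul1r. Qed.

(** The modulus forces [Im z = 0]. For the fractional part [f] of [Re z], [cos (2 pi f) = 1] gives
    [sin (pi f) = 0], which is impossible for [0 < f < 1]. *)
Lemma ee_eq1 z : ee z = 1 -> exists n : int, z = n%:~R.
Proof.
move=> h; have : nc (ee z) = 1 by rewrite h nc1.
rewrite nc_ee -[1 in RHS]expR0 => /expR_inj/eqP; rewrite oppr_eq0 mulf_eq0.
have -> /= : (2 * pi == 0 :> R) = false by rewrite gt_eqF // mulr_gt0 ?pi_gt0.
move=> /eqP z0; exists (Num.floor (complex.Re z)).
set n := Num.floor _; pose f := complex.Re z - n%:~R.
have f0 : 0 <= f by rewrite subr_ge0 floor_le_tmp.
have f1 : f < 1 by rewrite ltrBlDl -intrD1 floorD1_gt.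
have zE : z = f%:C + n%:~R.
  rewrite intrC -rmorphD /= /f subrK; move: z0; case: (z) => a b /= -> //.
have hf : ee f%:C = 1 by rewrite -h zE ee_intD.
have : cos (2 * pi * f) = 1.
  have := congr1 (@complex.Re R) hf.
  by rewrite !eeE two_pi_iE /cexp /= !mulr0 oppr0 expR0 mul1r mul0r subr0.
have -> : 2 * pi * f = (pi * f) *+ 2 by rewrite mulr2n; ring.
rewrite cos_mulr2n => hc.
have s0 : sin (pi * f) = 0.
  have := cos2Dsin2 (pi * f) => hs.
  by apply/eqP; rewrite -sqrf_eq0; apply/eqP; lra.
have [fE|fn0] := eqVneq f 0; first by rewrite zE fE add0r.
have : 0 < sin (pi * f).
  apply: sin_gt0_pi; rewrite mulr_gt0 ?pi_gt0 ?lt0r ?fn0 //=.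
  by rewrite gtr_pMr ?pi_gt0.
by rewrite s0 ltxx.
Qed.

Lemma derive_seq (f : R -> R) (df : R) : is_derive (0 : R) (1 : R) f df ->
  (fun N => N.+1%:R * (f (N.+1%:R^-1) - f 0)) @ \oo --> df.
Proof.
move=> [/cvg_ex[l hl] hd].
have {}hl : (fun h : R => h^-1 *: (f (h *: 1 + 0) - f 0)) @ 0^' --> df.
  by rewrite -hd /derive (cvg_lim (@Rhausdorff R) hl).
have hh : (fun N => N.+1%:R^-1 : R) @ \oo --> 0^'.
  move=> A hA; have h : \forall N \near \oo,
      harmonic N != 0 :> R -> A (harmonic N) := @cvg_harmonic R _ hA.
  apply: filterS h => N; apply.
  by rewrite /harmonic /= invr_eq0.
have := cvg_comp _ _ hh hl.
apply: cvg_trans; apply: near_eq_cvg; apply: nearW => N /=.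
by rewrite invrK addr0 /GRing.scale /= mulr1.
Qed.

(** The derivative of the exponential at 0, sampled at [1 / (N + 1)]; it is what turns the finite
    factorisation of the sine into the infinite one. *)
Lemma cexp_seq x :
  ccvg (fun N => N.+1%:R * (cexp (x / N.+1%:R) - 1)) x.
Proof.
case: x => a b.
have divE N : (a +i* b) / N.+1%:R = (a / N.+1%:R) +i* (b / N.+1%:R) :> R[i].
  rewrite natrC -fmorphV /=.
  by apply/eqP; rewrite eq_complex /= !mulr0 subr0 add0r !eqxx.
apply: ccvg_ReIm.
- have d : is_derive (0 : R) (1 : R) (fun t : R => expR (a * t) * cos (b * t)) a.
    apply: is_derive_eq.
    rewrite !mulr0 expR0 cos0 sin0 /GRing.scale /=; ring.
  have := derive_seq d; apply: cvg_trans; apply: near_eq_cvg; apply: nearW => N.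
  rewrite divE natrC /cexp /= !mulr0 expR0 cos0; ring.
- have d : is_derive (0 : R) (1 : R) (fun t : R => expR (a * t) * sin (b * t)) b.
    apply: is_derive_eq.
    rewrite !mulr0 expR0 cos0 sin0 /GRing.scale /=; ring.
  have := derive_seq d; apply: cvg_trans; apply: near_eq_cvg; apply: nearW => N.
  rewrite divE natrC /cexp /= !mulr0 expR0 sin0; ring.
Qed.

End Exponential.

(* 2 i sin (pi x) *)
HB.lock Definition Sc (R : realType) (x : R[i]) : R[i] := ee (x / 2) - ee (- (x / 2)).

(** * Finite factorisation of the sine *)

Section Sine.
Variable R : realType.
Local Notation ee := (@ee R).
Local Notation Sc := (@Sc R).
Implicit Types (x y z a b c : R[i]).

Lemma ScE x : Sc x = ee (x / 2) - ee (- (x / 2)).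
Proof. by rewrite unlock. Qed.

Definition integer x := exists n : int, x = n%:~R.

Lemma ScN x : Sc (- x) = - Sc x.
Proof. by rewrite !ScE mulNr opprK opprB. Qed.

Lemma ee_sub1 x : ee x - 1 = ee (x / 2) * Sc x.
Proof.
rewrite !ScE mulrBr -!eeD -splitr subrr ee0; congr (ee _ - 1).
Qed.

Lemma sub1_ee x : 1 - ee x = - (ee (x / 2) * Sc x).
Proof. by rewrite -ee_sub1 opprB. Qed.

Lemma Sc_eq0 x : Sc x = 0 -> integer x.
Proof.
by move=> h; apply: ee_eq1; apply/eqP; rewrite -subr_eq0 ee_sub1 h mulr0.
Qed.

Lemma Sc_int (n : int) : Sc n%:~R = 0.
Proof.
by apply: (mulfI (ee_neq0 (n%:~R / 2))); rewrite -ee_sub1 ee_int subrr mulr0.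
Qed.

Lemma Sc_intD x (n : int) : Sc (x + n%:~R) = (-1) ^ n * Sc x.
Proof.
have hN : ee (- (n%:~R / 2)) = (-1) ^ n :> R[i].
  rewrite -ee_half_int -[RHS](ee_intD (- n)) rmorphN /=; congr ee; by field.
by rewrite !ScE mulrDl opprD !eeD hN ee_half_int mulrBr [X in X - _]mulrC [X in _ - X]mulrC.
Qed.

Lemma ee_pair c b : (ee c - ee b) * (ee c - ee (- b)) = ee c * (Sc c ^+ 2 - Sc b ^+ 2).
Proof.
rewrite !ScE !eeN [in LHS](splitr c) [in LHS](splitr b) [in X in _ = X * _](splitr c) !eeD.
have := ee_neq0 (c / 2); have := ee_neq0 (b / 2).
by set A := ee _; set B := ee _ => A0 B0; field; rewrite A0 B0.
Qed.

Lemma ee_prim_root N : (0 < N)%N -> N.-primitive_root (ee (1 / N%:R) : R[i]).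
Proof.
move=> N0; have N0' : (N%:R : R[i]) != 0 by rewrite pnatr_eq0 -lt0n.
have EX k : ee (1 / N%:R) ^+ k = ee (k%:R / N%:R) :> R[i].
  by rewrite -ee_natM mulrA mulr1.
rewrite /primitive_root_of_unity N0 /=; apply/forallP => i; apply/eqP.
rewrite unity_rootE EX; apply/eqP/eqP => [/ee_eq1[n hn]|->]; last first.
  by rewrite divff // ee1.
have h : i.+1%:Z = n * N%:Z.
  apply/eqP; rewrite -(eqr_int R[i]) intrM /= -!pmulrn -hn mulfVK //.
have n1 : (0 < n)%R by rewrite -(pmulr_lgt0 _ (_ : 0 < N%:Z)) // -h.
have iN := ltn_ord i.
by apply/eqP; rewrite eqn_leq iN /= -lez_nat h ler_peMl //; lia.
Qed.

Lemma prod_pair (F : nat -> R[i]) M :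
  \prod_(1 <= i < M.*2.+1) F i = \prod_(k < M) (F k.+1 * F (M.*2.+1 - k.+1)%N).
Proof.
rewrite (big_cat_nat (n := M.+1)) //=; last by lia.
rewrite big_split /=; congr (_ * _); first by rewrite big_add1 /= big_mkord.
rewrite big_nat_rev /= -{1}[M.+1]add0n big_addn.
have -> : (M.*2.+1 - M.+1 = M)%N by lia.
rewrite big_mkord; apply: eq_bigr => k _; congr F.
have := ltn_ord k; lia.
Qed.

(** Evaluate [(X^N - 1) / (X - 1)], the product of [X - zeta^i] over [0 < i < N], at [X = ee c]. As
    [N] is odd, the roots pair up as [zeta^k] and [zeta^(N - k)], and [ee_pair] makes each pair
    [ee c] times a difference of squared sines. *)
Lemma sum_ee_prod M c : let N := M.*2.+1 in
  \sum_(i < N) ee c ^+ i =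
  ee c ^+ M * \prod_(k < M) (Sc c ^+ 2 - Sc (k.+1%:R / N%:R) ^+ 2) :> R[i].
Proof.
move=> N; have N0 : (0 < N)%N by [].
have N0' : (N%:R : R[i]) != 0 by rewrite pnatr_eq0 -lt0n.
have EX k : ee (1 / N%:R) ^+ k = ee (k%:R / N%:R) :> R[i].
  by rewrite -ee_natM mulrA mulr1.
have := factor_Xn_sub_1 (ee_prim_root N0).
rewrite big_ltn // expr0 subrX1 => /(mulfI _) => /(_ (negbT (polyXsubC_eq0 _))).
move=> /(congr1 (fun p => p.[ee c])); rewrite horner_prod horner_sum prod_pair => h.
have -> : \sum_(i < N) ee c ^+ i = \sum_(i < N) 'X^i.[ee c].
  by apply: eq_bigr => i _; rewrite hornerXn.
rewrite -h.
rewrite (_ : ee c ^+ M = \prod_(k < M) ee c); last by rewrite prodr_const card_ord.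
rewrite -big_split /=; apply: eq_bigr => k _.
rewrite -ee_pair !hornerXsubC !EX; congr (_ * (_ - _)).
have kN : (k.+1 <= N)%N by have := ltn_ord k; rewrite /N; lia.
by rewrite natrB // mulrBl divff // eeD ee1 mul1r.
Qed.

Lemma Sc_mulN M c : let N := M.*2.+1 in
  Sc (N%:R * c) = Sc c * \prod_(k < M) (Sc c ^+ 2 - Sc (k.+1%:R / N%:R) ^+ 2).
Proof.
move=> N; apply: (mulfI (ee_neq0 (N%:R * c / 2))).
rewrite -ee_sub1 ee_natM subrX1 sum_ee_prod ee_sub1.
have -> : N%:R * c / 2 = M%:R * c + c / 2.
  by rewrite /N -addn1 -muln2 natrD natrM; field.
by rewrite eeD ee_natM; ring.
Qed.

Lemma prod_Sc_nat M : let N := M.*2.+1 in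
  \prod_(k < M) (- Sc (k.+1%:R / N%:R) ^+ 2) = N%:R :> R[i].
Proof.
move=> N; have := sum_ee_prod M 0; cbv zeta; rewrite -/N ee0 expr1n mul1r.
have -> : Sc 0 = 0 by exact: (Sc_int 0).
under [in X in _ = X]eq_bigr do rewrite expr0n /= sub0r.
by move=> <-; under eq_bigr do rewrite expr1n; rewrite sumr_const card_ord.
Qed.

(** The finite form of Euler's sine product: for [c = x / N] the factors tend to [1 - x^2 / k^2] as
    [N] grows. The constant [N] is the case [c = 0] of the cyclotomic factorisation. *)
Lemma Sc_mulN_ratio M c : let N := M.*2.+1 in
  Sc (N%:R * c) =
  N%:R * Sc c * \prod_(k < M) (1 - Sc c ^+ 2 / Sc (k.+1%:R / N%:R) ^+ 2).
Proof.
move=> N; rewrite Sc_mulN -/N; have := prod_Sc_nat M; cbv zeta; rewrite -/N => hN.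
rewrite -[X in _ = X * Sc c * _]hN [RHS]mulrAC mulrC.
congr (_ * _); rewrite -big_split /=; apply: eq_bigr => k _.
have h : Sc (k.+1%:R / N%:R) != 0.
  apply/eqP => /Sc_eq0[n hn].
  have N0' : (N%:R : R[i]) != 0 by rewrite pnatr_eq0.
  have : k.+1%:Z = n * N%:Z.
    by apply/eqP; rewrite -(eqr_int R[i]) intrM /= -!pmulrn -hn mulfVK.
  have := ltn_ord k; rewrite /N => kM h.
  have n0 : (0 < n)%R by nia.
  nia.
by field.
Qed.

(** A weak Jordan inequality, from [sin y = 2 sin v cos v] with [v = y / 2]: [sin v >= v cos v] by
    the mean value theorem, and [cos v ^ 2 >= 1 / 2] because [v <= pi / 4]. It bounds the
    denominators [Sc (k / N)] from below, linearly in [k]. *)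
Lemma sin_ge_half (y : R) : 0 <= y <= pi / 2 -> y / 2 <= sin y.
Proof.
move=> /andP[y0 y1]; pose v := y / 2.
have yE : y = v *+ 2 by rewrite /v mulr2n; field.
have v0 : 0 <= v by rewrite /v; lra.
have v1 : v <= pi / 4 by rewrite /v; lra.
have pi0 := pi_gt0 R.
have c1 : cos v >= cos (pi / 4).
  have [->//|vn] := eqVneq v (pi / 4).
  have vl : v < pi / 4 by rewrite lt_neqAle vn.
  by apply/ltW; rewrite ltr_cos // in_itv /=; apply/andP; split; lra.
have c2 : cos (pi / 4) ^+ 2 = 1 / 2 :> R.
  have := cos_mulr2n (pi / 4 : R).
  have -> : (pi / 4) *+ 2 = pi / 2 :> R by rewrite mulr2n; field.
  rewrite cos_pihalf mulr2n => h; lra.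
have c0 : 0 < cos (pi / 4) :> R.
  by apply: cos_gt0_pihalf; apply/andP; split; lra.
have s1 : v * cos v <= sin v.
  have [->|vn] := eqVneq v 0; first by rewrite mul0r sin0.
  have vp : 0 < v by rewrite lt0r vn.
  have [|xi xiv] := @MVT R sin cos 0 v vp (fun t _ => is_derive_sin t).
    by apply: continuous_subspaceT => t; exact: continuous_sin.
  rewrite sin0 !subr0 => ->; rewrite mulrC ler_wpM2r //.
  move: xiv; rewrite in_itv /= => /andP[x0 x1].
  by apply/ltW; rewrite ltr_cos // in_itv /=; apply/andP; split; lra.
rewrite yE sin_mulr2n -yE.
have h1 : v * cos v * cos v <= sin v * cos v.
  by rewrite ler_wpM2r // (le_trans (ltW c0)).
have h2 : 1 / 2 <= cos v * cos v.
  by rewrite -c2 expr2 ler_pM // ltW.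
have h3 : v * (1 / 2) <= v * (cos v * cos v) by rewrite ler_wpM2l.
have h4 : v * cos v * cos v = v * (cos v * cos v) by ring.
rewrite -/v mulr2n; lra.
Qed.

Lemma nc_Sc_real (t : R) : nc (Sc t%:C) = 2 * `|sin (pi * t)|.
Proof.
have E (s : R) : ee (s%:C / 2) = cos (pi * s) +i* sin (pi * s).
  have -> : s%:C / 2 = (s / 2)%:C :> R[i].
    by rewrite rmorphM fmorphV rmorph_nat.
  rewrite !eeE two_pi_iE /cexp /= mulr0 oppr0 expR0 mul1r.
  by have -> : 2 * pi * (s / 2) = pi * s by field.
have EN : - (t%:C / 2) = (- t)%:C / 2 :> R[i] by rewrite rmorphN mulNr.
rewrite !ScE EN !E mulrN cosN sinN.
rewrite /Normc.normc /= subrr expr0n add0r sqrtr_sqr opprK.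
by rewrite -mulr2n normrMn mulr_natl.
Qed.

Lemma nc_Sc_ge M k : (k < M)%N ->
  pi * (k.+1%:R / M.*2.+1%:R) <= nc (Sc (k.+1%:R / M.*2.+1%:R) : R[i]).
Proof.
move=> kM; set N := M.*2.+1.
have -> : k.+1%:R / N%:R = (k.+1%:R / N%:R : R)%:C :> R[i].
  by rewrite rmorphM fmorphV !rmorph_nat.
rewrite nc_Sc_real; set t := _ / _.
have N0 : 0 < N%:R :> R by rewrite ltr0n.
have t0 : 0 <= t by rewrite divr_ge0.
have t1 : t <= 1 / 2.
  have h : k.+1%:R * 2 <= N%:R :> R by rewrite -natrM ler_nat /N; lia.
  by rewrite ler_pdivrMr //; lra.
have pi0 := pi_gt0 R.
have h : pi * t / 2 <= sin (pi * t).
  apply: sin_ge_half; rewrite mulr_ge0 ?(ltW pi0) //=.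
  by rewrite ler_pM2l //; lra.
rewrite ger0_norm; first lra.
by apply: le_trans h; rewrite divr_ge0 // mulr_ge0 // ltW.
Qed.

End Sine.

(** * Euler's product for the sine *)

Section SineProduct.
Variable R : realType.
Local Notation ee := (@ee R).
Local Notation Sc := (@Sc R).
Implicit Types (x y z : R[i]).

Definition invsq (k : nat) : R := (k.+1%:R ^+ 2)^-1.

Lemma invsq_ge0 k : 0 <= invsq k.
Proof. by rewrite invr_ge0 sqr_ge0. Qed.

Lemma summable_invsq : cvgn (series invsq).
Proof.
apply: nondecreasing_is_cvgn.
  by apply: nondecreasing_series => n _ _; exact: invsq_ge0.
exists 2 => _ [n _ <-]; rewrite /series /=.
(* The correction [1 / (m + 1)] makes the induction close, by
   [1 / (a + 1)^2 <= 1 / a - 1 / (a + 1)]. *)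
have h m : \sum_(0 <= k < m.+1) invsq k <= 2 - m.+1%:R^-1.
  elim: m => [|m IH]; first by rewrite big_nat1 /invsq expr1n invr1; lra.
  rewrite big_nat_recr //= (le_trans (lerD IH (lexx _))) // /invsq.
  set a : R := m.+1%:R; have a0 : 0 < a by rewrite ltr0n.
  have -> : m.+2%:R = a + 1 :> R by rewrite -natr1.
  have a1 : 0 < a + 1 by rewrite addr_gt0.
  have : ((a + 1) ^+ 2)^-1 <= (a * (a + 1))^-1.
    rewrite lef_pV2 ?posrE ?mulr_gt0 ?exprn_gt0 // expr2 ler_wpM2r ?(ltW a1) //.
    by rewrite lerDl.
  have -> : (a * (a + 1))^-1 = a^-1 - (a + 1)^-1.
    by field; rewrite !gt_eqF.
  by move: (a^-1) ((a + 1)^-1) ((a + 1) ^- 2) => u v w; lra.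
apply: (@le_trans _ _ (\sum_(0 <= k < n.+1) invsq k)).
  by rewrite big_nat_recr //= lerDl invsq_ge0.
by rewrite (le_trans (h n)) // lerBlDr lerDl invr_ge0.
Qed.

Lemma inv_nat_cvg : ccvg (fun N => N.+1%:R^-1) (0 : R[i]).
Proof.
apply: (@ccvg_squeeze _ _ _ harmonic); last exact: cvg_harmonic.
by move=> n; rewrite subr0 ncV nc_nat.
Qed.

Lemma Sc_seq x :
  ccvg (fun N => N.+1%:R * Sc (x / N.+1%:R)) (2 * pi%:C * 'i%C * x).
Proof.
have h1 (w : R[i]) : ccvg (fun N => N.+1%:R * (ee (w / N.+1%:R) - 1)) (2 * pi%:C * 'i%C * w).
  by apply: (eq_ccvg (cexp_seq _)) => N; rewrite !eeE mulrA.
have h2 (w : R[i]) : ccvg (fun N => ee (w / N.+1%:R)) 1.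
  have := ccvgD (ccvgM inv_nat_cvg (h1 w)) (ccvg_cst 1).
  rewrite mul0r add0r => h; apply: (eq_ccvg h) => N.
  by rewrite mulKf ?pnatr_eq0 // subrK.
rewrite -[2 * _ * _ * x]mul1r.
apply: (eq_ccvg (ccvgM (h2 (- (x / 2))) (h1 x))) => N.
rewrite ee_sub1 mulrCA; congr (_ * _); rewrite mulrA -eeD.
have -> : - (x / 2) / N.+1%:R + x / N.+1%:R / 2 = 0 by rewrite mulNr mulrAC addNr.
by rewrite ee0 mul1r.
Qed.

Lemma double_oo : (fun M : nat => M.*2) @ \oo --> \oo.
Proof.
move=> A [n _ hn]; exists n => // m /= nm; apply: hn => /=.
by rewrite (leq_trans nm) // -addnn leq_addr.
Qed.

Lemma near_eq_ccvg (f g : nat -> R[i]) l m :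
  ccvg f l -> (forall n, (m <= n)%N -> f n = g n) -> ccvg g l.
Proof.
move=> /ccvgP h fg; split; apply: cvg_trans h; apply: near_eq_cvg.
by exists m => // n /= mn; rewrite fg.
Qed.

Lemma two_pi_i_neq0 : 2 * pi%:C * 'i%C != 0 :> R[i].
Proof.
rewrite -nc_eq0 !ncM nc_i nc_nat nc_real mulr1 mulf_neq0 ?pnatr_eq0 //.
by rewrite normr_eq0 gt_eqF ?pi_gt0.
Qed.

Lemma integer_div x N : integer (x / N.+1%:R) -> integer x.
Proof.
move=> [n hn]; exists (n * N.+1%:Z); rewrite intrM /= -pmulrn -hn mulfVK //.
Qed.

Lemma sine_prod x : ~ integer x ->
  ccvg (fun M => \prod_(k < M) (1 - x ^+ 2 / k.+1%:R ^+ 2))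
       (Sc x / (2 * pi%:C * 'i%C * x)).
Proof.
move=> xZ; have x0 : x != 0 by apply/eqP => x0; apply: xZ; exists 0.
have NZ N : Sc (x / N.+1%:R) != 0.
  by apply/eqP => /Sc_eq0/integer_div.
pose a M := M.*2.+1%:R * Sc (x / M.*2.+1%:R).
have ha : ccvg a (2 * pi%:C * 'i%C * x) := ccvg_comp double_oo (Sc_seq x).
pose b k M := M.*2.+1%:R * Sc (k.+1%:R / M.*2.+1%:R) : R[i].
have hb k : ccvg (b k) (2 * pi%:C * 'i%C * k.+1%:R) :=
  ccvg_comp double_oo (Sc_seq k.+1%:R).
have b0 k M : (k < M)%N -> b k M != 0.
  move=> kM; rewrite mulf_neq0 ?pnatr_eq0 // -nc_gt0.
  apply: lt_le_trans (nc_Sc_ge R kM).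
  by rewrite mulr_gt0 ?pi_gt0 // divr_gt0 // ltr0n.
have [C C0 hC] := ccvg_bounded ha.
(* Tannery's theorem asks for a bound at all pairs [M], [k], but [b k M] is bounded below only for
   [k < M]; hence the value 0 elsewhere. *)
pose X M k := if (k < M)%N then - (a M ^+ 2 / b k M ^+ 2) else 0.
have hX M : \prod_(k < M) (1 + X M k) = Sc x / a M.
  have := Sc_mulN_ratio M (x / M.*2.+1%:R); cbv zeta.
  have N0 : (M.*2.+1%:R : R[i]) != 0 by rewrite pnatr_eq0.
  rewrite mulrCA divff // mulr1 -/(a M) => ->.
  have aM0 : a M != 0 by rewrite mulf_neq0.
  rewrite mulrAC divff // mul1r; apply: eq_bigr => k _.
  rewrite /X ltn_ord /a /b !exprMn; congr (_ - _).
  have := b0 k M (ltn_ord k); rewrite /b mulf_eq0 negb_or => /andP[_ s0].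
  by rewrite -mulf_div divff ?mul1r // expf_neq0.
have XM M k : nc (X M k) <= (C / pi) ^+ 2 * invsq k.
  rewrite /X; case: ifP => kM; last first.
    by rewrite nc0 mulr_ge0 ?sqr_ge0 ?invsq_ge0.
  rewrite ncN ncM ncV !ncX.
  have h : pi * k.+1%:R <= nc (b k M).
    rewrite /b ncM nc_nat.
    have N0 : 0 < M.*2.+1%:R :> R by rewrite ltr0n.
    have := nc_Sc_ge R kM; rewrite -(ler_pM2l N0); apply: le_trans.
    by rewrite mulrCA ler_pM2l ?pi_gt0 // mulrC divfK ?gt_eqF.
  have pk0 : 0 < pi * k.+1%:R :> R by rewrite mulr_gt0 ?pi_gt0 ?ltr0n.
  have -> : (C / pi) ^+ 2 * invsq k = C ^+ 2 / (pi * k.+1%:R) ^+ 2.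
    rewrite /invsq exprMn exprVn -mulrA; congr (_ * _).
    have pn : pi != 0 :> R by rewrite gt_eqF ?pi_gt0.
    have kn : k.+1%:R != 0 :> R by rewrite pnatr_eq0.
    move: pn kn; move: (pi : R) (k.+1%:R : R) => v w v0 w0.
    by field; rewrite v0 w0.
  rewrite ler_pM ?invr_ge0 ?exprn_ge0 ?nc_ge0 //.
    by rewrite ler_pXn2r ?nnegrE ?nc_ge0 // ltW.
  by rewrite lef_pV2 ?posrE ?exprn_gt0 ?(lt_le_trans pk0 h) // ler_pXn2r ?nnegrE ?nc_ge0 // ltW.
have cM : cvgn (series (fun k => (C / pi) ^+ 2 * invsq k)).
  exact: summableZ summable_invsq.
have Xl k : ccvg (X ^~ k) (- (x ^+ 2 / k.+1%:R ^+ 2)).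
  have k0 : (k.+1%:R : R[i]) != 0 by rewrite pnatr_eq0.
  have p0 := two_pi_i_neq0.
  have -> : x ^+ 2 / k.+1%:R ^+ 2 = (2 * pi%:C * 'i%C * x) ^+ 2 /
      (2 * pi%:C * 'i%C * k.+1%:R) ^+ 2.
    move: p0; set p := 2 * _ * _ => p0.
    by rewrite !(exprMn _ p) -[in RHS]mulf_div divff ?mul1r // expf_neq0.
  apply: (@near_eq_ccvg (fun M => - (a M ^+ 2 / b k M ^+ 2)) _ _ k.+1).
    apply: ccvgN; apply: ccvgM; first exact: ccvgX.
    by apply: ccvgV; [rewrite expf_neq0 // mulf_neq0 | exact: ccvgX].
  by move=> M kM; rewrite /X kM.
have yM k : nc (- (x ^+ 2 / k.+1%:R ^+ 2)) <= (C / pi) ^+ 2 * invsq k.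
  by apply: ccvg_le (Xl k) _ => M; exact: XM.
have [Y hY] := prod_ccvg yM cM.
have hXY := dominated_prod XM Xl cM hY.
have hXS : ccvg (fun M => \prod_(k < M) (1 + X M k)) (Sc x / (2 * pi%:C * 'i%C * x)).
  have a0 : 2 * pi%:C * 'i%C * x != 0 by rewrite mulf_neq0 // two_pi_i_neq0.
  by apply: (eq_ccvg (ccvgM (ccvg_cst (Sc x)) (ccvgV a0 ha))) => M; rewrite hX.
by rewrite (ccvg_unique hXS hXY).
Qed.

End SineProduct.

(** * Infinite q-Pochhammer symbols *)

Section QPochhammer.
Variable R : realType.
Implicit Types (a q : R[i]).

Lemma qpoch_cvg a q : nc q < 1 ->
  ccvg (fun n => \prod_(j < n) (1 - a * q ^+ j)) (qpoch a q).
Proof.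
move=> q1.
have [l hl] : exists l, ccvg (fun n => \prod_(j < n) (1 + (- (a * q ^+ j)))) l.
  apply: (@prod_ccvg _ (fun j => - (a * q ^+ j)) (geometric (nc a) (nc q))).
    by move=> j; rewrite ncN ncM ncX.
  by apply: is_cvg_geometric_series; rewrite ger0_norm ?nc_ge0.
by rewrite /qpoch (ccvg_lim hl).
Qed.

Lemma qpochS a q : nc q < 1 -> qpoch a q = (1 - a) * qpoch (a * q) q.
Proof.
move=> q1; apply: (ccvg_unique (ccvgS (qpoch_cvg a q1))).
apply: (eq_ccvg (ccvgZ (1 - a) (qpoch_cvg (a * q) q1))) => n.
rewrite big_ord_recl expr0 mulr1; congr (_ * _); apply: eq_bigr => j _.
by rewrite /= exprS mulrA.
Qed.

Lemma qpoch_neq0 a q : nc q < 1 -> (forall j : nat, a * q ^+ j != 1) -> qpoch a q != 0.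
Proof.
move=> q1 h.
apply: (@prod_ccvg_neq0 _ (fun j => - (a * q ^+ j)) (geometric (nc a) (nc q))).
- by move=> j; rewrite ncN ncM ncX.
- by apply: is_cvg_geometric_series; rewrite ger0_norm ?nc_ge0.
- by move=> j; rewrite subr_eq0 eq_sym.
- exact: qpoch_cvg.
Qed.

(** Explicit in [a] and [q], so that it gives [1 + O(a)] with one constant for all small [q]; the
    expansion of [j] at [q = 0] rests on it. *)
Lemma nc_qpoch_sub1 a q : nc q < 1 ->
  nc (qpoch a q - 1) <= expR (nc a / (1 - nc q)) - 1.
Proof.
move=> q1; have q0 := nc_ge0 q.
apply: (ccvg_le (ccvgB (qpoch_cvg a q1) (ccvg_cst 1))) => n.
rewrite (le_trans (nc_prod1D_sub1 _ (fun j : 'I_n => - (a * q ^+ j)))) //.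
rewrite lerD2r ler_expR.
have h := @cvg_geometric_series R (nc a) (nc q).
rewrite ger0_norm // in h; have {}h := h q1.
rewrite -(cvg_lim (@Rhausdorff R) h).
under eq_bigr do rewrite ncN ncM ncX.
apply: (@ler_series_lim R (geometric (nc a) (nc q))).
  by move=> j; rewrite /= mulr_ge0 ?exprn_ge0 ?nc_ge0.
by apply/cvg_ex; eexists; exact: h.
Qed.

Lemma nc_sqr_lt1 q : nc q < 1 -> nc (q ^+ 2) < 1.
Proof. by move=> q1; rewrite ncX expr_lt1 ?nc_ge0. Qed.

Lemma qpoch_mulN a q : nc q < 1 ->
  qpoch a q * qpoch (- a) q = qpoch (a ^+ 2) (q ^+ 2).
Proof.
move=> q1; apply: (ccvg_unique (ccvgM (qpoch_cvg a q1) (qpoch_cvg (- a) q1))).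
apply: (eq_ccvg (qpoch_cvg (a ^+ 2) (nc_sqr_lt1 q1))) => n.
rewrite -big_split /=; apply: eq_bigr => j _.
by rewrite exprAC -exprMn mulNr opprK; ring.
Qed.

Lemma qpoch_split a q : nc q < 1 ->
  qpoch a q = qpoch a (q ^+ 2) * qpoch (a * q) (q ^+ 2).
Proof.
move=> q1; have q2 := nc_sqr_lt1 q1.
apply: (ccvg_unique (ccvg_comp double_oo (qpoch_cvg a q1))).
apply: (eq_ccvg (ccvgM (qpoch_cvg a q2) (qpoch_cvg (a * q) q2))) => n /=.
elim: n => [|n IH]; first by rewrite !big_ord0 mulr1.
rewrite doubleS !big_ord_recr /= -IH -!exprM mul2n.
rewrite [q ^+ n.*2.+1]exprS; ring.
Qed.

(* Euler's identity (-q; q) (q; q^2) = 1 in disguise. *)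
Lemma qpoch_half_periods (s : R[i]) : let q := s ^+ 2 in nc q < 1 ->
  qpoch (- q) q * qpoch s q * qpoch (- s) q = 1.
Proof.
move=> q q1; have q2 := nc_sqr_lt1 q1.
have qq0 : qpoch q q != 0.
  apply: qpoch_neq0 => // j; apply/eqP => h.
  have : nc (q * q ^+ j) < 1 by rewrite -exprS ncX expr_lt1 ?nc_ge0.
  by rewrite h nc1 ltxx.
rewrite -mulrA qpoch_mulN // -/q; apply: (mulfI qq0).
rewrite mulrA qpoch_mulN // mulr1 [RHS]qpoch_split // mulrC -expr2.
by [].
Qed.

End QPochhammer.

(** The part of the Klein form due to the rows [m t + Z] with [m != 0]; the row [m = 0] gives the
    factor [Sc u] of [Kf]. *)
HB.lock Definition Kq (R : realType) (t u : R[i]) : R[i] :=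
  qpoch (ee t * ee u) (ee t) * qpoch (ee t * ee (- u)) (ee t) /
  qpoch (ee t) (ee t) ^+ 2.

(* The Klein form of the lattice Z t + Z, times 2 pi i. *)
HB.lock Definition Kf (R : realType) (t u : R[i]) : R[i] := Sc u * Kq t u.

(** This is [sin (pi x) / (pi x)], the product of [1 - x^2 / k^2] over [k >= 1]. *)
HB.lock Definition sinc (R : realType) (x : R[i]) : R[i] :=
  Sc x / (2 * pi%:C * 'i%C * x).

(** * Klein forms as q-products and as products over lattice rows *)

Section Klein.
Variable R : realType.
Local Notation ee := (@ee R).
Local Notation Sc := (@Sc R).
Implicit Types (t u : R[i]) (m n : nat).

Lemma KqE t u : Kq t u = qpoch (ee t * ee u) (ee t) *
  qpoch (ee t * ee (- u)) (ee t) / qpoch (ee t) (ee t) ^+ 2.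
Proof. by rewrite unlock. Qed.

Lemma KfE t u : Kf t u = Sc u * Kq t u.
Proof. by rewrite unlock. Qed.

Definition lattice t u := exists a b : int, u = a%:~R * t + b%:~R.

Lemma nc_ee_lt1 t : 0 < complex.Im t -> nc (ee t) < 1.
Proof.
move=> t0; rewrite nc_ee -expR0 ltr_expR oppr_lt0.
by rewrite mulr_gt0 // mulr_gt0 // pi_gt0.
Qed.

Lemma ee_natMexp t j u : ee t * ee u * ee t ^+ j = ee (u + j.+1%:R * t).
Proof. by rewrite eeD ee_natM exprS; ring. Qed.

Lemma KfN t u : Kf t (- u) = - Kf t u.
Proof. by rewrite !KfE !KqE ScN opprK mulNr [qpoch (_ * ee (- u)) _ * _]mulrC. Qed.

Lemma Kq_int t u (n : int) : Kq t (u + n%:~R) = Kq t u.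
Proof. by rewrite !KqE ee_intD opprD -rmorphN /= ee_intD. Qed.

Lemma Kf_int t u (n : int) : Kf t (u + n%:~R) = (-1) ^ n * Kf t u.
Proof. by rewrite !KfE Kq_int Sc_intD -mulrA. Qed.

Lemma Kf_modint t u (n : int) : Kf (t + n%:~R) u = Kf t u.
Proof. by rewrite !KfE !KqE ee_intD. Qed.

Lemma Kf_period t u : 0 < complex.Im t ->
  Kf t (u + t) = - ee (- u - t / 2) * Kf t u.
Proof.
move=> t0; have q1 := nc_ee_lt1 t0; rewrite !KfE !KqE.
have e1 : ee t * ee (u + t) = ee t * ee u * ee t by rewrite eeD; ring.
have e2 : ee t * ee (- (u + t)) = ee (- u).
  by rewrite opprD eeD !eeN mulrC mulfVK // ee_neq0.
have e3 : ee (- u) * ee t = ee t * ee (- u) by rewrite mulrC.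
rewrite e1 e2 (qpochS (ee (- u)) q1) e3 (qpochS (ee t * ee u) q1).
set A := qpoch _ _; set B := qpoch _ _; set D := qpoch _ _ ^+ 2.
have -> : ee t * ee u = ee (u + t) by rewrite eeD mulrC.
rewrite !sub1_ee.
suff : Sc (u + t) * ee (- u / 2) * Sc (- u) =
   - ee (- u - t / 2) * Sc u * ee ((u + t) / 2) * Sc (u + t).
  by move=> h; transitivity (- (Sc (u + t) * ee (- u / 2) * Sc (- u)) * (A * B / D));
    [ring | rewrite h; ring].
rewrite ScN; have -> : - u / 2 = (- u - t / 2) + (u + t) / 2 by field.
rewrite eeD; ring.
Qed.

Lemma lattice_ee t u j : ee (u + j%:R * t) = 1 -> lattice t u.
Proof.
move=> /ee_eq1[n hn]; exists (- j%:Z), n.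
by rewrite rmorphN /= -pmulrn -hn; ring.
Qed.

Lemma latticeN t u : lattice t (- u) -> lattice t u.
Proof.
move=> [a [b h]]; exists (- a), (- b).
by rewrite !rmorphN /= -[LHS]opprK h; ring.
Qed.

Lemma Kq_neq0 t u : 0 < complex.Im t -> ~ lattice t u -> Kq t u != 0.
Proof.
move=> t0 hu; have q1 := nc_ee_lt1 t0.
rewrite !KqE !mulf_neq0 ?invr_neq0 ?expf_neq0 //; apply: qpoch_neq0 => // j.
- by rewrite ee_natMexp; apply/eqP => /lattice_ee.
- by rewrite ee_natMexp; apply/eqP => /lattice_ee/latticeN.
- apply/eqP => h; have : nc (ee t * ee t ^+ j) < 1.
    by rewrite -exprS ncX expr_lt1 ?nc_ge0.
  by rewrite h nc1 ltxx.
Qed.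

Lemma integer_lattice t u : integer u -> lattice t u.
Proof. by move=> [n ->]; exists 0, n; rewrite mul0r add0r. Qed.

Lemma Sc_neq0 t u : ~ lattice t u -> Sc u != 0.
Proof. by move=> h; apply/eqP => /Sc_eq0/(integer_lattice t). Qed.

Lemma Kf_neq0 t u : 0 < complex.Im t -> ~ lattice t u -> Kf t u != 0.
Proof. by move=> t0 hu; rewrite !KfE mulf_neq0 ?Kq_neq0 // (Sc_neq0 hu). Qed.

Lemma sincE (x : R[i]) : sinc x = Sc x / (2 * pi%:C * 'i%C * x).
Proof. by rewrite unlock. Qed.

Lemma sinc_prod (x : R[i]) : ~ integer x ->
  ccvg (fun M => \prod_(k < M) (1 - x ^+ 2 / k.+1%:R ^+ 2)) (sinc x).
Proof. by rewrite sincE; exact: sine_prod. Qed.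

(** The contribution of the four points [+-(m+1) t +- (n+1)]. Over all [m] and [n] these are the
    lattice points off both axes; the axes contribute [sinc u] and [sinc (u / t)]. *)
Definition xrow t u m n := (1 - u ^+ 2 / (m.+1%:R * t + n.+1%:R) ^+ 2) *
  (1 - u ^+ 2 / (m.+1%:R * t - n.+1%:R) ^+ 2).

(** The product of [xrow t u m n] over [n]: with [a = (m+1) t] and [w = n + 1], the factors of the
    three sine products combine by [w^2 - (a +- u)^2 = (w - a -+ u) (w + a +- u)]. *)
Definition rrow t u m := sinc (m.+1%:R * t + u) * sinc (m.+1%:R * t - u) /
  sinc (m.+1%:R * t) ^+ 2.

Lemma sinc_neq0 (x : R[i]) : ~ integer x -> sinc x != 0.
Proof.
move=> h; rewrite sincE; apply: mulf_neq0; first by apply/eqP => /Sc_eq0.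
apply: invr_neq0; apply: (mulf_neq0 (two_pi_i_neq0 R)).
by apply/eqP => x0; apply: h; exists 0.
Qed.

Section Fixed.
Variables (t u : R[i]).
Hypotheses (t0 : 0 < complex.Im t) (hu : ~ lattice t u).

Lemma lattice_shiftP m : ~ integer (m%:R * t + u).
Proof.
move=> [n hn]; apply: hu; exists (- m%:Z), n.
by rewrite rmorphN /= -pmulrn -hn; ring.
Qed.

Lemma lattice_shiftN m : ~ integer (m%:R * t - u).
Proof.
move=> [n hn]; apply: hu; exists m%:Z, (- n).
by rewrite rmorphN /= -pmulrn -hn; ring.
Qed.

Lemma Im_natM m z : complex.Im (m%:R * z : R[i]) = m%:R * complex.Im z.
Proof. by rewrite natrC; case: z => a b /=; rewrite mul0r addr0. Qed.

Lemma int_multiple m : ~ integer (m.+1%:R * t).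
Proof.
move=> [n /(congr1 (@complex.Im R))]; rewrite intrC Im_natM /= => /eqP.
by rewrite gt_eqF // mulr_gt0.
Qed.

Lemma row_neq0 m n : m.+1%:R * t + n.+1%:R != 0 /\ m.+1%:R * t - n.+1%:R != 0.
Proof.
split; apply/eqP => h; apply: (@int_multiple m).
  by exists (- n.+1%:Z); apply/eqP; rewrite rmorphN /= -addr_eq0 -pmulrn h.
by exists n.+1%:Z; apply/eqP; rewrite -subr_eq0 -pmulrn h.
Qed.

Lemma row_cvg m : ccvg (fun N => \prod_(n < N) xrow t u m n) (rrow t u m).
Proof.
set a := m.+1%:R * t.
have ha := sinc_prod (@int_multiple m); rewrite -/a in ha.
have h := ccvgM (ccvgM (sinc_prod (@lattice_shiftP m.+1))
  (sinc_prod (@lattice_shiftN m.+1)))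
  (ccvgV (expf_neq0 2 (sinc_neq0 (@int_multiple m))) (ccvgX 2 ha)).
apply: (eq_ccvg h) => N; rewrite -prodrXl -prodfV -!big_split /=.
apply: eq_bigr => n _; rewrite /xrow -/a.
have [] := row_neq0 m n; rewrite -/a; set w := (n.+1%:R : R[i]).
have w0 : w != 0 by rewrite pnatr_eq0.
move=> h1 h2; have h3 : w ^+ 2 - a ^+ 2 != 0.
  have -> : w ^+ 2 - a ^+ 2 = - (a + w) * (a - w) by ring.
  by rewrite mulf_neq0 ?oppr_eq0.
by clearbody w; field; rewrite w0 h1 h2 h3.
Qed.

(** The first factor restores the points [+-(m+1) t] that [rrow] leaves out; the complete pair of
    rows is one factor of the q-product [Kq]. *)
Lemma rrowE m : (1 - (u / t) ^+ 2 / m.+1%:R ^+ 2) * rrow t u m =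
  (1 - ee t * ee u * ee t ^+ m) * (1 - ee t * ee (- u) * ee t ^+ m) /
  (1 - ee t * ee t ^+ m) ^+ 2.
Proof.
have -> : ee t * ee t ^+ m = ee (m.+1%:R * t) by rewrite ee_natM exprS.
rewrite !ee_natMexp ![_ + m.+1%:R * t]addrC; set a := m.+1%:R * t.
have Sa : Sc a != 0 by apply/eqP => /Sc_eq0/int_multiple.
have nz (x : R[i]) : ~ integer x -> x != 0 by move=> h; apply/eqP => x0; apply: h; exists 0.
have a0 := nz _ (@int_multiple m); rewrite -/a in a0.
have au0 := nz _ (@lattice_shiftP m.+1); have au1 := nz _ (@lattice_shiftN m.+1).
rewrite -/a in au0 au1.
have p0 := two_pi_i_neq0 R; rewrite /rrow !sincE -/a !sub1_ee.
have -> : (u / t) ^+ 2 / m.+1%:R ^+ 2 = u ^+ 2 / a ^+ 2.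
  move: a0; rewrite /a mulf_eq0 negb_or => /andP[].
  by move: (m.+1%:R : R[i]) => w w0 tn0; field; rewrite w0 tn0.
have -> : ee ((a - u) / 2) = ee (a / 2) ^+ 2 / ee ((a + u) / 2).
  rewrite -eeN -ee_natM -eeD; congr ee; by field.
have := ee_neq0 ((a + u) / 2); have := ee_neq0 (a / 2).
move: p0; set p := 2 * _ * _ => p0 e0 e1.
field; rewrite ?e0 ?e1 ?p0 ?Sa ?a0 ?au0 ?au1 //.
Qed.

Lemma rows_cvg :
  ccvg (fun M => \prod_(m < M) rrow t u m) (Kq t u / sinc (u / t)).
Proof.
have q1 := nc_ee_lt1 t0.
have tn0 : t != 0 by apply/eqP => h; move: t0; rewrite h /= ltxx.
have ut : ~ integer (u / t).
  move=> [n hn]; apply: hu; exists n, 0.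
  by rewrite addr0 -hn divfK.
have qq0 : qpoch (ee t) (ee t) ^+ 2 != 0.
  rewrite expf_neq0 // qpoch_neq0 // => j; apply/eqP => h.
  have : nc (ee t * ee t ^+ j) < 1 by rewrite -exprS ncX expr_lt1 ?nc_ge0.
  by rewrite h nc1 ltxx.
have h := ccvgM (ccvgM (ccvgM (qpoch_cvg (ee t * ee u) q1)
   (qpoch_cvg (ee t * ee (- u)) q1)) (ccvgV qq0 (ccvgX 2 (qpoch_cvg (ee t) q1))))
   (ccvgV (sinc_neq0 ut) (sinc_prod ut)).
rewrite KqE; apply: (eq_ccvg h) => M; rewrite -prodrXl -!prodfV -!big_split /=.
apply: eq_bigr => m _; rewrite -rrowE mulrAC divff ?mul1r //.
apply/eqP => /eqP; rewrite subr_eq0 => /eqP h1.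
have m0 : (m.+1%:R : R[i]) != 0 by rewrite pnatr_eq0.
have : (u / t) ^+ 2 == m.+1%:R ^+ 2.
  by rewrite -[X in X == _](divfK (expf_neq0 2 m0)) -h1 mul1r.
rewrite eqf_sqr => /orP[] /eqP h2; apply: ut.
  by exists m.+1%:Z; rewrite h2 pmulrn.
by exists (- m.+1%:Z); rewrite h2 rmorphN /= -pmulrn.
Qed.

End Fixed.
End Klein.

(** * Estimates for the factors of the double product *)

Section Scaling.
Variable R : realType.
Local Notation ee := (@ee R).
Local Notation Sc := (@Sc R).
Implicit Types (t u w s : R[i]).

Lemma ReIm_lattice t (a b : int) :
  complex.Im (a%:~R * t + b%:~R) = a%:~R * complex.Im t.
Proof. by rewrite !intrC; case: t => x y /=; rewrite mul0r !addr0. Qed.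

Lemma lattice_norm t w : 0 < complex.Im t -> lattice t w -> w != 0 ->
  Num.min (complex.Im t) 1 <= nc w.
Proof.
move=> t0 [a [b ->]] w0.
have abs_int (c : int) : c != 0 -> 1 <= `|c%:~R : R|.
  by move=> c0; rewrite -intr_norm ler1z -gtz0_ge1 normr_gt0.
have [a0|a0] := eqVneq a 0; last first.
  rewrite ge_min; apply/orP; left; apply: le_trans (nc_Im _).
  rewrite ReIm_lattice normrM [`|complex.Im t|]gtr0_norm // ler_peMl ?(ltW t0) //.
  exact: abs_int.
have b0 : b != 0.
  by apply: contraNneq w0 => b0; rewrite a0 b0 mul0r addr0.
rewrite ge_min; apply/orP; right.
by rewrite a0 mul0r add0r intrC nc_real abs_int.
Qed.

Lemma latticeB t u w : lattice t u -> lattice t w -> lattice t (u - w).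
Proof.
by move=> [a [b ->]] [c [d ->]]; exists (a - c), (b - d); rewrite !intrB; ring.
Qed.

Lemma lattice_natM t u m : lattice t u -> lattice t (m%:R * u).
Proof.
by move=> [a [b ->]]; exists (m%:Z * a), (m%:Z * b); rewrite !intrM -!pmulrn; ring.
Qed.

Section Bounds.
Variables (t u : R[i]) (n : nat).
Hypotheses (t0 : 0 < complex.Im t) (hu : ~ lattice t u) (n0 : (0 < n)%N)
  (hn : lattice t (n%:R * u)).

(** For [w] in the lattice, [n (w - u)] is a nonzero lattice point, so [w - u] is bounded below, and
    likewise [w + u]. If [nc w >= 2 * nc u] the quantity is at least [1 - 1/4]; otherwise factor it
    as [(w - u) (w + u) / w^2]. *)
Lemma torsion_gap : exists2 d : R, 0 < d &
  forall w, lattice t w -> w != 0 -> d <= nc (1 - u ^+ 2 / w ^+ 2).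
Proof.
pose d0 := Num.min (complex.Im t) 1 / n%:R.
have nR : 0 < n%:R :> R by rewrite ltr0n.
have m0 : 0 < Num.min (complex.Im t) 1 by rewrite lt_min t0 ltr01.
have d00 : 0 < d0 by rewrite divr_gt0.
have dist w : lattice t w -> d0 <= nc (w - u).
  move=> hw; rewrite ler_pdivrMr // mulrC -[n%:R](nc_nat R) -ncM.
  apply: lattice_norm => //.
    by rewrite mulrBr; apply: latticeB => //; exact: lattice_natM.
  rewrite mulf_neq0 ?pnatr_eq0 -?lt0n // subr_eq0.
  by apply/eqP => h; apply: hu; rewrite -h.
have u0 : u != 0.
  by apply/eqP => h; apply: hu; exists 0, 0; rewrite h mul0r addr0.
have nu0 : 0 < nc u by rewrite nc_gt0.
exists (Num.min (3 / 4) (d0 ^+ 2 / (2 * nc u) ^+ 2)).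
  rewrite lt_min; apply/andP; split; first lra.
  by apply: divr_gt0; apply: exprn_gt0 => //; rewrite mulr_gt0.
move=> w hw w0; have nw0 : 0 < nc w by rewrite nc_gt0.
rewrite ge_min; have [h|h] := leP (2 * nc u) (nc w); apply/orP; [left|right].
  have := nc_lerB 1 (u ^+ 2 / w ^+ 2); rewrite nc1 ncM ncV !ncX.
  have : nc u ^+ 2 / nc w ^+ 2 <= 1 / 4.
    rewrite ler_pdivrMr ?exprn_gt0 //.
    have : (2 * nc u) ^+ 2 <= nc w ^+ 2 by rewrite ler_pXn2r ?nnegrE ?mulr_ge0 ?nc_ge0.
    by rewrite exprMn; lra.
  by move=> h1 h2; lra.
have -> : 1 - u ^+ 2 / w ^+ 2 = (w - u) * (w - - u) / w ^+ 2 by field.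
rewrite !ncM ncV ncX.
have h1 : d0 <= nc (w - u) := dist w hw.
have h2 : d0 <= nc (w - - u).
  have := dist (- w); rewrite -ncN opprB opprK addrC => h2; rewrite opprK.
  by apply: h2; apply: latticeN; rewrite opprK.
rewrite ler_pM //.
- by rewrite exprn_ge0 // ltW.
- by rewrite invr_ge0 exprn_ge0 // mulr_ge0 // ltW.
- by rewrite expr2 ler_pM // ltW.
by rewrite lef_pV2 ?posrE ?exprn_gt0 ?mulr_gt0 // ler_pXn2r ?nnegrE ?(ltW nw0) ?(ltW h) // mulr_ge0 // ltW.
Qed.

(** The imaginary part controls [m], and the triangle inequality then controls [j]. Two separate
    bounds are wanted so that [w^-4] is dominated by a product of [m^-2] and [j^-2], as
    [prod_fubini] requires; [e] selects the sign. *)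
Lemma lattice_growth : exists2 c : R, 0 < c &
  forall m j (e : bool), let w := m.+1%:R * t + (-1) ^+ e * j.+1%:R in
  c * m.+1%:R <= nc w /\ c * j.+1%:R <= nc w.
Proof.
pose y := complex.Im t; pose c1 := 1 + nc t / y.
have c10 : 0 < c1 by rewrite addr_gt0 // ?ltr01 // divr_gt0 // nc_gt0; apply/eqP => h;
  move: t0; rewrite h /= ltxx.
exists (Num.min y c1^-1); first by rewrite lt_min t0 invr_gt0.
move=> m j e w.
have wE : w = m.+1%:~R * t + ((-1) ^+ e * j.+1%:Z)%:~R.
  by rewrite /w intrM rmorphXn rmorphN rmorph1 /= -!pmulrn.
have hm : y * m.+1%:R <= nc w.
  apply: le_trans (nc_Im _); rewrite wE (ReIm_lattice t m.+1%:Z) -pmulrn.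
  by rewrite ger0_norm ?mulr_ge0 ?(ltW t0) // mulrC.
split.
  by apply: le_trans hm; rewrite ler_wpM2r // ge_min lexx.
have hj : j.+1%:R <= nc w + m.+1%:R * nc t.
  rewrite -(nc_nat R j.+1) -(nc_nat R m.+1) -ncM.
  have -> : nc (j.+1%:R : R[i]) = nc (w - m.+1%:R * t).
    by rewrite /w addrAC subrr add0r ncM ncX ncN nc1 expr1n mul1r.
  exact: ncB.
apply: (@le_trans _ _ (c1^-1 * j.+1%:R)).
  by rewrite ler_wpM2r // ge_min lexx orbT.
rewrite mulrC ler_pdivrMr // (le_trans hj) // /c1 mulrDr mulr1 lerD2l.
have -> : nc w * (nc t / y) = nc w / y * nc t by ring.
rewrite ler_wpM2r ?nc_ge0 // ler_pdivlMr // mulrC.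
exact: hm.
Qed.

End Bounds.

(** The coefficient [K^2] lets the induction close, by [K^2 + K <= (K + 1)^2]. *)
Lemma pow_taylor K s :
  nc ((1 - s) ^+ K - 1 + K%:R * s) <= K%:R ^+ 2 * (1 + nc s) ^+ K * nc s ^+ 2.
Proof.
have s0 := nc_ge0 s; have s1 : 1 <= 1 + nc s by rewrite lerDl.
elim: K => [|K IH].
  by rewrite expr0 subrr mul0r addr0 nc0 expr0n /= !mul0r.
set E := (1 - s) ^+ K - 1 + K%:R * s in IH.
have -> : (1 - s) ^+ K.+1 - 1 + K.+1%:R * s = (1 - s) * E + K%:R * s ^+ 2.
  by rewrite /E exprS -natr1; ring.
set P := (1 + nc s) ^+ K in IH.
have P1 : 1 <= P by rewrite /P exprn_ege1.
rewrite (le_trans (ncD _ _)) // (ncM (1 - s)) (ncM K%:R) ncX nc_nat (exprS (1 + nc s)) -/P.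
have h1 : nc (1 - s) * nc E <= (1 + nc s) * (K%:R ^+ 2 * P * nc s ^+ 2).
  by rewrite ler_pM ?nc_ge0 // (le_trans (ncB _ _)) // nc1.
have h2 : K%:R * nc s ^+ 2 <= (1 + nc s) * (K%:R * P * nc s ^+ 2).
  rewrite -[leLHS]mul1r ler_pM ?mulr_ge0 ?exprn_ge0 //.
  by rewrite ler_wpM2r ?exprn_ge0 // ler_peMr.
rewrite (le_trans (lerD h1 h2)) //.
have -> : (1 + nc s) * (K%:R ^+ 2 * P * nc s ^+ 2) +
    (1 + nc s) * (K%:R * P * nc s ^+ 2) =
  (K%:R ^+ 2 + K%:R) * ((1 + nc s) * P) * nc s ^+ 2 by ring.
have P0 : 0 <= P := le_trans ler01 P1.
rewrite ler_wpM2r ?exprn_ge0 // ler_wpM2r ?mulr_ge0 ?addr_ge0 //.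
have K0 : 0 <= K%:R :> R by [].
rewrite -natr1 sqrrD1; lra.
Qed.

(** Applied with [K = k^2] and [s = u^2 / w^2]: the linear terms of numerator and denominator agree,
    so the error has order [w^-4]. *)
Lemma ratio_taylor (d T : R) K : 0 < d -> exists2 C : R, 0 <= C &
  forall s, d <= nc (1 - s) -> nc s <= T ->
  nc ((1 - K%:R * s) / (1 - s) ^+ K - 1) <= C * nc s ^+ 2.
Proof.
move=> d0; exists (K%:R ^+ 2 * (1 + `|T|) ^+ K / d ^+ K).
  by rewrite divr_ge0 ?mulr_ge0 ?exprn_ge0 ?addr_ge0 // ltW.
move=> s hd hT; have ns0 := nc_ge0 s.
have s1 : (1 - s) ^+ K != 0.
  by rewrite expf_neq0 // -nc_gt0 (lt_le_trans d0).
have -> : (1 - K%:R * s) / (1 - s) ^+ K - 1 =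
    - ((1 - s) ^+ K - 1 + K%:R * s) / (1 - s) ^+ K.
  by field.
rewrite ncM ncN ncV ncX.
have h1 : d ^+ K <= nc (1 - s) ^+ K.
  by case: (K) => [|K']; rewrite ?expr0 // ler_pXn2r ?nnegrE ?nc_ge0 ?(ltW d0).
rewrite [leRHS]mulrAC ler_pM ?invr_ge0 ?exprn_ge0 ?nc_ge0 //.
  rewrite (le_trans (pow_taylor K s)) // ler_wpM2r ?exprn_ge0 // ler_wpM2l ?exprn_ge0 //.
  case: (K) => [|K']; rewrite ?expr0 // ler_pXn2r ?nnegrE ?addr_ge0 //.
  by rewrite lerD2l (le_trans hT) // ler_norm.
by rewrite lef_pV2 ?posrE ?exprn_gt0 // (lt_le_trans d0 hd).
Qed.

End Scaling.

(** * Exchanging rows and columns in the scaled product *)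

Section ScalingLaw.
Variable R : realType.
Local Notation ee := (@ee R).
Local Notation Sc := (@Sc R).
Implicit Types (t u w s : R[i]).

Lemma invsq_le1 k : invsq R k <= 1.
Proof. by rewrite /invsq invf_le1 ?exprn_gt0 // exprn_ege1 // ler1n. Qed.

Lemma inv_pow4_le (c a b W : R) : 0 < c -> 0 < a -> 0 < b ->
  c * a <= W -> c * b <= W ->
  (W ^+ 4)^-1 <= (c ^+ 4)^-1 * ((a ^+ 2)^-1 * (b ^+ 2)^-1).
Proof.
move=> c0 a0 b0 ha hb.
have ca : 0 < c * a by rewrite mulr_gt0.
have cb : 0 < c * b by rewrite mulr_gt0.
have W0 : 0 < W := lt_le_trans ca ha.
have -> : (c ^+ 4)^-1 * ((a ^+ 2)^-1 * (b ^+ 2)^-1) = ((c * a) ^+ 2 * (c * b) ^+ 2)^-1.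
  by field; rewrite !gt_eqF.
rewrite lef_pV2 ?posrE ?exprn_gt0 //; last by apply: mulr_gt0; exact: exprn_gt0.
have -> : W ^+ 4 = W ^+ 2 * W ^+ 2 by rewrite -exprD.
by rewrite ler_pM ?exprn_ge0 ?(ltW ca) ?(ltW cb) // ler_pXn2r ?nnegrE ?(ltW W0) ?(ltW ca) ?(ltW cb).
Qed.

Lemma xrow_ratio t u n k : 0 < complex.Im t -> ~ lattice t u -> (0 < n)%N ->
  lattice t (n%:R * u) -> exists B : R, forall m j,
  nc (xrow t (k%:R * u) m j / xrow t u m j ^+ (k ^ 2) - 1) <=
    B * invsq R m * invsq R j.
Proof.
move=> t0 hu n0 hn.
have [d d0 hd] := torsion_gap t0 hu n0 hn.
have [c c0 hc] := lattice_growth t0.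
have [C C0 hC] := ratio_taylor (nc u ^+ 2 / c ^+ 2) (k ^ 2) d0.
pose A := C * (nc u ^+ 4 / c ^+ 4).
have A0 : 0 <= A by rewrite mulr_ge0 // divr_ge0 ?exprn_ge0 ?nc_ge0 // ltW.
(* Two factors [1 + O(A I)] multiply to [1 + O(2 A I + (A I)^2)], and [I <= 1]. *)
exists ((2 + A) * A) => m j.
have factor (e : bool) : let w := m.+1%:R * t + (-1) ^+ e * j.+1%:R in
    nc ((1 - (k%:R * u) ^+ 2 / w ^+ 2) / (1 - u ^+ 2 / w ^+ 2) ^+ (k ^ 2) - 1)
      <= A * (invsq R m * invsq R j).
  move=> w; have [w1 w2] := hc m j e; rewrite -/w in w1 w2.
  have m0 : 0 < m.+1%:R :> R by rewrite ltr0n.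
  have j0 : 0 < j.+1%:R :> R by rewrite ltr0n.
  have nw0 : 0 < nc w by apply: lt_le_trans w1; rewrite mulr_gt0.
  have w0 : w != 0 by rewrite -nc_gt0.
  have hw : lattice t w.
    exists m.+1%:Z, ((-1) ^+ e * j.+1%:Z).
    by rewrite /w intrM rmorphXn rmorphN rmorph1 /= -!pmulrn.
  pose s := u ^+ 2 / w ^+ 2.
  have -> : (k%:R * u) ^+ 2 / w ^+ 2 = (k ^ 2)%:R * s.
    by rewrite /s exprMn natrX mulrA.
  have hs : nc s <= nc u ^+ 2 / c ^+ 2.
    rewrite /s ncM ncV !ncX ler_wpM2l ?exprn_ge0 ?nc_ge0 //.
    rewrite lef_pV2 ?posrE ?exprn_gt0 // ler_pXn2r ?nnegrE ?nc_ge0 ?(ltW c0) //.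
    by apply: le_trans w1; rewrite ler_peMr ?(ltW c0) // ler1n.
  apply: le_trans (hC s (hd _ hw w0) hs) _.
  have -> : nc s ^+ 2 = nc u ^+ 4 / nc w ^+ 4.
    by rewrite /s ncM ncV !ncX expr_div_n -!exprM.
  rewrite /A -mulrA ler_wpM2l // -[leRHS]mulrA ler_wpM2l ?exprn_ge0 ?nc_ge0 //.
  exact: inv_pow4_le.
pose I := invsq R m * invsq R j.
pose Y w := (1 - (k%:R * u) ^+ 2 / w ^+ 2) / (1 - u ^+ 2 / w ^+ 2) ^+ (k ^ 2).
have h1 : nc (Y (m.+1%:R * t + j.+1%:R) - 1) <= A * I.
  by have := factor false; rewrite /= expr0 mul1r.
have h2 : nc (Y (m.+1%:R * t - j.+1%:R) - 1) <= A * I.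
  by have := factor true; rewrite /= expr1 mulN1r.
have -> : xrow t (k%:R * u) m j / xrow t u m j ^+ (k ^ 2) =
    Y (m.+1%:R * t + j.+1%:R) * Y (m.+1%:R * t - j.+1%:R).
  by rewrite /xrow /Y mulf_div -exprMn.
move: h1 h2; set y1 := Y _; set y2 := Y _ => h1 h2.
have I0 : 0 <= I by apply: mulr_ge0; exact: invsq_ge0.
have I1 : I <= 1 by rewrite /I -[1]mul1r ler_pM ?invsq_ge0 ?invsq_le1.
have -> : y1 * y2 - 1 = (y1 - 1) + (y2 - 1) + (y1 - 1) * (y2 - 1) by ring.
have -> : (2 + A) * A * invsq R m * invsq R j = A * I + A * I + A * I * A.
  by rewrite /I; ring.
rewrite (le_trans (ncD _ _)) // lerD //.
  by rewrite (le_trans (ncD _ _)) // lerD.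
rewrite ncM ler_pM ?nc_ge0 // (le_trans h2) // -[leRHS]mulr1 ler_wpM2l //.
Qed.

Lemma Im_gt0_neq0 t : 0 < complex.Im t -> t != 0.
Proof. by move=> t0; apply/eqP => h; move: t0; rewrite h /= ltxx. Qed.

Lemma lattice_inv t u : 0 < complex.Im t -> lattice (- t^-1) (u / t) -> lattice t u.
Proof.
move=> /Im_gt0_neq0 t0 [a [b h]]; exists b, (- a).
by rewrite rmorphN /= -[LHS](divfK t0) h; field.
Qed.

Lemma Im_inv t : 0 < complex.Im t -> 0 < complex.Im (- t^-1).
Proof.
by case: t => x y /= y0; rewrite opprK divr_gt0 // ltr_wpDl ?sqr_ge0 ?exprn_gt0.
Qed.

(** Division by [t] maps [Z t + Z] onto the lattice of [- t^-1] and exchanges the two coordinates up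
    to sign, while [xrow] depends only on the squares of the quotients [u / w]. *)
Lemma xrow_inv t u m n : 0 < complex.Im t -> ~ lattice t u ->
  xrow (- t^-1) (u / t) n m = xrow t u m n.
Proof.
move=> t0 hu; have tn := Im_gt0_neq0 t0.
have [] := row_neq0 t0 m n; rewrite /xrow.
move: (m.+1%:R : R[i]) (n.+1%:R : R[i]) => a b h1 h2.
have -> : b * - t^-1 + a = (a * t - b) / t by field.
have -> : b * - t^-1 - a = - (a * t + b) / t by field.
by rewrite mulrC !expr_div_n sqrrN; field; rewrite h1 h2 tn.
Qed.

Lemma rrow_neq0 t u m : 0 < complex.Im t -> ~ lattice t u -> rrow t u m != 0.
Proof.
move=> t0 hu; apply: mulf_neq0; first apply: mulf_neq0; last first.
- by apply: invr_neq0; apply: expf_neq0; apply: sinc_neq0; exact: int_multiple.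
- by apply: sinc_neq0; exact: lattice_shiftN.
- by apply: sinc_neq0; exact: lattice_shiftP.
Qed.

Lemma sincN u : sinc (- u) = sinc u.
Proof. by rewrite !sincE ScN mulrN invrN mulrNN. Qed.

(** Dividing [Kq] by [sinc] leaves only points off both axes. Both sides are then the same
    absolutely convergent double product of [xrow] quotients, by rows on the left and by columns on
    the right. *)
Lemma Kq_scaling t u n k : 0 < complex.Im t -> ~ lattice t u -> (0 < n)%N ->
  lattice t (n%:R * u) -> ~ lattice t (k%:R * u) ->
  (Kq t (k%:R * u) / sinc (k%:R * u / t)) / (Kq t u / sinc (u / t)) ^+ (k ^ 2) =
  (Kq (- t^-1) (k%:R * u / t) / sinc (k%:R * u)) /
  (Kq (- t^-1) (u / t) / sinc u) ^+ (k ^ 2).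
Proof.
move=> t0 hu n0 hn hku; have tn := Im_gt0_neq0 t0; have t'0 := Im_inv t0.
have [B hB] := xrow_ratio k t0 hu n0 hn.
have hu' : ~ lattice (- t^-1) (u / t) by move=> /(lattice_inv t0).
have hku' : ~ lattice (- t^-1) (k%:R * u / t) by move=> /(lattice_inv t0).
have uu v : v / t / - t^-1 = - v by field.
have nz s v : 0 < complex.Im s -> ~ lattice s v -> ~ integer (v / s).
  move=> s0 hv [b hb]; apply: hv; exists b, 0.
  by rewrite addr0 -hb divfK // Im_gt0_neq0.
pose y m j := xrow t (k%:R * u) m j / xrow t u m j ^+ (k ^ 2) - 1.
have y1 m j : 1 + y m j = xrow t (k%:R * u) m j / xrow t u m j ^+ (k ^ 2).
  by rewrite /y; ring.
have rows s v (z : nat -> nat -> R[i]) : 0 < complex.Im s -> ~ lattice s v ->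
    ~ lattice s (k%:R * v) ->
    (forall m j, 1 + z m j = xrow s (k%:R * v) m j / xrow s v m j ^+ (k ^ 2)) ->
    (forall m, ccvg (fun N => \prod_(j < N) (1 + z m j))
       (rrow s (k%:R * v) m / rrow s v m ^+ (k ^ 2))) /\
    ccvg (fun N => \prod_(m < N) (rrow s (k%:R * v) m / rrow s v m ^+ (k ^ 2)))
      ((Kq s (k%:R * v) / sinc (k%:R * v / s)) / (Kq s v / sinc (v / s)) ^+ (k ^ 2)).
  move=> s0 hv hkv hz; split.
    move=> m; have r0 : rrow s v m ^+ (k ^ 2) != 0 by rewrite expf_neq0 // rrow_neq0.
    apply: (eq_ccvg (ccvgM (row_cvg s0 hkv m) (ccvgV r0 (ccvgX (k ^ 2) (row_cvg s0 hv m))))).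
    move=> N; rewrite -prodrXl -prodfV -big_split /=.
    by apply: eq_bigr => j _; rewrite hz.
  have r0 : (Kq s v / sinc (v / s)) ^+ (k ^ 2) != 0.
    rewrite expf_neq0 // mulf_neq0 ?Kq_neq0 // invr_neq0 // sinc_neq0 //.
    exact: nz.
  apply: (eq_ccvg (ccvgM (rows_cvg s0 hkv) (ccvgV r0 (ccvgX (k ^ 2) (rows_cvg s0 hv))))).
  by move=> N; rewrite -prodrXl -prodfV -big_split.
have [r1 r2] := rows t u y t0 hu hku y1.
have hku2 : ~ lattice (- t^-1) (k%:R * (u / t)) by rewrite mulrA.
have [|c1 c2] := rows (- t^-1) (u / t) (fun j m => y m j) t'0 hu' hku2.
  by move=> m j; rewrite y1 -(xrow_inv j m t0 hku) -(xrow_inv j m t0 hu) mulrA.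
have := prod_fubini (@invsq_ge0 R) (@summable_invsq R) hB r1 c1 r2 c2.
by rewrite (mulrA k%:R u t^-1) !uu !sincN.
Qed.

End ScalingLaw.

(** * Inversion of Klein forms at torsion points *)

Section KleinInversion.
Variable R : realType.
Local Notation ee := (@ee R).
Local Notation Sc := (@Sc R).
Implicit Types (t u v w s : R[i]).

Definition Kratio t u := Kf (- t^-1) (u / t) * t / Kf t u.

Lemma KratioE t u : u != 0 -> t != 0 ->
  Kratio t u = (Kq (- t^-1) (u / t) / sinc u) / (Kq t u / sinc (u / t)).
Proof.
move=> u0 t0; have Kf_sinc s v : v != 0 -> Kf s v = 2 * pi%:C * 'i%C * v * sinc v * Kq s v.
  move=> v0; rewrite !KfE !sincE; congr (_ * _).
  by rewrite mulrC divfK // mulf_neq0 // two_pi_i_neq0.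
rewrite /Kratio !Kf_sinc ?mulf_neq0 ?invr_neq0 //.
move: (2 * pi%:C * 'i%C) (two_pi_i_neq0 R) => p p0; rewrite !invfM !invrK.
rewrite (_ : p * (u / t) * sinc (u / t) * Kq (- t^-1) (u / t) * t =
  p * u * sinc (u / t) * Kq (- t^-1) (u / t)); last by field.
have -> : forall a b c d : R[i], p * u * a * b * (p^-1 * u^-1 * c * d) = b * c * (d * a).
  by move=> a b c d; field; rewrite u0 p0.
by [].
Qed.

Lemma Kratio_scaling t u n k : 0 < complex.Im t -> ~ lattice t u -> (0 < n)%N ->
  lattice t (n%:R * u) -> ~ lattice t (k%:R * u) ->
  Kratio t (k%:R * u) = Kratio t u ^+ (k ^ 2).
Proof.
move=> t0 hu n0 hn hku; have tn := Im_gt0_neq0 t0.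
have nz v : ~ lattice t v -> v != 0.
  by move=> hv; apply/eqP => v0; apply: hv; exists 0, 0; rewrite v0 mul0r addr0.
have nq v : ~ lattice t v -> Kq t v / sinc (v / t) != 0.
  move=> hv; apply: mulf_neq0; first exact: Kq_neq0.
  apply: invr_neq0; apply: sinc_neq0 => -[b hb]; apply: hv; exists b, 0.
  by rewrite addr0 -hb divfK.
have nq' v : ~ lattice t v -> Kq (- t^-1) (v / t) / sinc v != 0.
  move=> hv; apply: mulf_neq0.
    by apply: Kq_neq0; [exact: Im_inv | move=> /(lattice_inv t0)].
  by apply: invr_neq0; apply: sinc_neq0 => /(integer_lattice t).
rewrite (KratioE (nz _ hku) tn) (KratioE (nz _ hu) tn).
have := Kq_scaling t0 hu n0 hn hku.
have := nq _ hku; have := nq _ hu; have := nq' _ hku; have := nq' _ hu.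
set A := Kq t (k%:R * u) / sinc (k%:R * u / t); set B := Kq t u / sinc (u / t).
set A' := Kq (- t^-1) (k%:R * u / t) / sinc (k%:R * u).
set B' := Kq (- t^-1) (u / t) / sinc u.
move=> B'0 A'0 B0 A0 h; rewrite expr_div_n.
have B1 : B ^+ (k ^ 2) != 0 by rewrite expf_neq0.
have B1' : B' ^+ (k ^ 2) != 0 by rewrite expf_neq0.
move: h B1 B1'; set X := B ^+ _; set X' := B' ^+ _ => h X0 X'0.
have -> : A' = A / X * X' by rewrite h divfK.
by field; rewrite A0 X0.
Qed.

(* The Gaussian factor makes the quotient of Klein forms doubly periodic. *)
Definition Kdefect t u := Kratio t u * ee (- (u ^+ 2 / (2 * t))).

Lemma KdefectN t u : Kdefect t (- u) = Kdefect t u.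
Proof. by rewrite /Kdefect /Kratio sqrrN mulNr !KfN invrN mulNr mulrNN. Qed.

Lemma Kdefect_period t u : 0 < complex.Im t -> Kdefect t (u + t) = Kdefect t u.
Proof.
move=> t0; have tn := Im_gt0_neq0 t0; rewrite /Kdefect /Kratio Kf_period //.
have -> : (u + t) / t = u / t + 1%:~R by field.
have -> : - ((u + t) ^+ 2 / (2 * t)) = - (u ^+ 2 / (2 * t)) + (- u - t / 2) by field.
rewrite Kf_int expr1z invfM invrN -eeN.
rewrite eeD eeN; have := ee_neq0 (- u - t / 2); set E := ee _ => E0.
have -> : forall a b c : R[i], -1 * a * t * (- E^-1 * b) * (c * E) = a * t * b * c.
  by move=> a b c; field.
by [].
Qed.

Lemma Kdefect_period1 t u : 0 < complex.Im t -> Kdefect t (u + 1) = Kdefect t u.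
Proof.
move=> t0; have tn := Im_gt0_neq0 t0; have t'0 := Im_inv t0.
rewrite /Kdefect /Kratio.
have -> : Kf t (u + 1) = - Kf t u by rewrite (Kf_int t u 1) expr1z mulN1r.
have := Kf_period (u / t + 1 / t) t'0.
have -> : u / t + 1 / t + - t^-1 = u / t by field.
have -> : (u + 1) / t = u / t + 1 / t by field.
move=> ->; set K := Kf _ (u / t + _).
have -> : - ((u + 1) ^+ 2 / (2 * t)) =
    - (u ^+ 2 / (2 * t)) + (- (u / t + 1 / t) - - t^-1 / 2) by field.
by rewrite eeD invrN; ring.
Qed.

Lemma Kdefect_lattice t u w : 0 < complex.Im t -> lattice t w ->
  Kdefect t (u + w) = Kdefect t u.
Proof.
move=> t0 [a [b ->]].
have natm v x : (forall y, Kdefect t (y + v) = Kdefect t y) ->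
    forall c : int, Kdefect t (x + c%:~R * v) = Kdefect t x.
  move=> h; have hn m y : Kdefect t (y + m%:R * v) = Kdefect t y.
    elim: m => [|m IH]; first by rewrite mul0r addr0.
    by rewrite -natr1 mulrDl mul1r addrA h IH.
  case=> m; first by rewrite -pmulrn hn.
  by rewrite NegzE mulrNz -pmulrn -(hn m.+1 (x + _)) -addrA -mulrDl addNr mul0r addr0.
rewrite addrA -[b%:~R]mulr1.
by rewrite (natm 1 _ (fun y => Kdefect_period1 y t0))
  (natm t _ (fun y => Kdefect_period y t0)).
Qed.

(** The exponent of the Gaussian is quadratic in [u], so it scales exactly as [Kratio] does. *)
Lemma Kdefect_scaling t u n k : 0 < complex.Im t -> ~ lattice t u -> (0 < n)%N ->
  lattice t (n%:R * u) -> ~ lattice t (k%:R * u) ->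
  Kdefect t (k%:R * u) = Kdefect t u ^+ (k ^ 2).
Proof.
move=> t0 hu n0 hn hku; rewrite /Kdefect (Kratio_scaling t0 hu n0 hn hku).
rewrite [RHS]exprMn -ee_natM; congr (_ * ee _).
by rewrite [in LHS]exprMn natrX mulrN -mulrA.
Qed.

Lemma Kdefect_neq0 t u : 0 < complex.Im t -> ~ lattice t u -> Kdefect t u != 0.
Proof.
move=> t0 hu; have tn := Im_gt0_neq0 t0; rewrite /Kdefect mulf_neq0 ?ee_neq0 //.
rewrite /Kratio mulf_neq0 ?invr_neq0 ?Kf_neq0 // mulf_neq0 // Kf_neq0 //.
  exact: Im_inv.
by move=> /(lattice_inv t0).
Qed.

(* The defect of an n-torsion point is a root of unity of order dividing 4 n;
   as it is also the (4 n)^2-th power of the defect of a 4 n^2-torsion point,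
   it is 1. *)
Lemma Kdefect_torsion t u n : 0 < complex.Im t -> ~ lattice t u -> (0 < n)%N ->
  lattice t (n%:R * u) -> Kdefect t u = 1.
Proof.
move=> t0 hu n0 hn; pose N := (4 * n)%N; pose v := u / N%:R.
have N0 : (0 < N)%N by rewrite /N muln_gt0.
have N0' : (N%:R : R[i]) != 0 by rewrite pnatr_eq0 -lt0n.
have uE : u = N%:R * v by rewrite /v mulrC divfK.
have hv : ~ lattice t v by move=> h; apply: hu; rewrite uE; exact: lattice_natM.
pose n' := (N * n)%N.
have n'4 : (4 <= n')%N by rewrite /n' /N; nia.
have n'0 : (0 < n')%N by exact: leq_trans n'4.
have hn' : lattice t (n'%:R * v) by rewrite natrM mulrAC -uE mulrC.
have up : n'.+1%:R * v = v + n'%:R * v by rewrite -natr1; ring.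
have down : n'.-1%:R * v = - v + n'%:R * v.
  have -> : n'%:R = n'.-1%:R + 1 :> R[i] by rewrite natr1 prednK.
  by ring.
have h1 : Kdefect t v = Kdefect t v ^+ (n'.+1 ^ 2).
  rewrite -(Kdefect_scaling t0 hv n'0 hn') up ?Kdefect_lattice // => h.
  by apply: hv; have := latticeB h hn'; rewrite addrK.
have h2 : Kdefect t v = Kdefect t v ^+ (n'.-1 ^ 2).
  rewrite -(Kdefect_scaling t0 hv n'0 hn') down ?Kdefect_lattice ?KdefectN // => h.
  by apply: hv; apply: latticeN; have := latticeB h hn'; rewrite addrK.
rewrite uE (Kdefect_scaling t0 hv n'0 hn') -?uE //.
have := Kdefect_neq0 t0 hv; move: h1 h2; set x := Kdefect t v => h1 h2 x0.
(* The reason for [N = 4 n] and [n' = N n]: the difference of the squares is [4 n' = N^2]. As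
   [(n' + 1) v] and [(n' - 1) v] are [v] and [- v] modulo the lattice, [x ^+ (N ^ 2) = 1], and this
   power is the defect of [u = N v]. *)
have e : (n'.+1 ^ 2 = n'.-1 ^ 2 + N ^ 2)%N by rewrite /n' /N; nia.
move: h1; rewrite e exprD -h2 => h1.
by apply: (mulfI x0); rewrite -h1 mulr1.
Qed.

Lemma Kf_inversion t u n : 0 < complex.Im t -> ~ lattice t u -> (0 < n)%N ->
  lattice t (n%:R * u) ->
  Kf (- t^-1) (u / t) = t^-1 * ee (u ^+ 2 / (2 * t)) * Kf t u.
Proof.
move=> t0 hu n0 hn; have tn := Im_gt0_neq0 t0.
have := Kdefect_torsion t0 hu n0 hn; rewrite /Kdefect /Kratio eeN.
have := ee_neq0 (u ^+ 2 / (2 * t)); have := Kf_neq0 t0 hu.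
set E := ee _; set K := Kf t u; set K' := Kf _ _ => K0 E0 h.
by rewrite -[RHS]mulr1 -h; field; rewrite tn E0 K0.
Qed.

End KleinInversion.

(* The discriminant, i.e. the 24th power of the eta function. *)
HB.lock Definition Dl (R : realType) (t : R[i]) : R[i] :=
  ee t * qpoch (ee t) (ee t) ^+ 24.

(** * Inversion of the discriminant from the points of order 2 *)

Section Discriminant.
Variable R : realType.
Local Notation ee := (@ee R).
Local Notation Sc := (@Sc R).
Implicit Types (t u : R[i]).

Lemma DlE t : Dl t = ee t * qpoch (ee t) (ee t) ^+ 24.
Proof. by rewrite unlock. Qed.

Lemma Dl_int t (n : int) : Dl (t + n%:~R) = Dl t.
Proof. by rewrite !DlE ee_intD. Qed.

Lemma qpoch_self_neq0 t : 0 < complex.Im t -> qpoch (ee t) (ee t) != 0.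
Proof.
move=> t0; have q1 := nc_ee_lt1 t0; apply: qpoch_neq0 => // j; apply/eqP => h.
have : nc (ee t * ee t ^+ j) < 1 by rewrite -exprS ncX expr_lt1 ?nc_ge0.
by rewrite h nc1 ltxx.
Qed.

Lemma Dl_neq0 t : 0 < complex.Im t -> Dl t != 0.
Proof.
by move=> t0; rewrite DlE mulf_neq0 ?ee_neq0 // expf_neq0 // qpoch_self_neq0.
Qed.

Lemma Kf_half t : Kf t (1 / 2) =
  Sc (1 / 2) * (qpoch (- ee t) (ee t) ^+ 2 / qpoch (ee t) (ee t) ^+ 2).
Proof.
rewrite KfE KqE eeN ee_half invrN1 mulrN1; congr (_ * (_ / _)).
Qed.

(** Serves both [t / 2] and [t / 2 + 1 / 2]. Here [ee t * ee (- u) = ee u], and [Sc u] supplies the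
    first factor missing from the other symbol, so the two symbols coincide. *)
Lemma Kf_sqrt t u : 0 < complex.Im t -> ee t = ee u ^+ 2 -> Kf t u =
  - ee (- (u / 2)) * (qpoch (ee u) (ee t) ^+ 2 / qpoch (ee t) (ee t) ^+ 2).
Proof.
move=> t0 h; have q1 := nc_ee_lt1 t0; rewrite KfE KqE.
have -> : ee t * ee (- u) = ee u by rewrite h eeN expr2 mulfK ?ee_neq0.
rewrite [ee t * ee u]mulrC eeN.
have := qpochS (ee u) q1; rewrite sub1_ee.
have := ee_neq0 (u / 2); have := qpoch_self_neq0 t0.
set E := ee (u / 2); set Q := qpoch (ee t) (ee t); set A := qpoch (ee u) _.
set B := qpoch _ _; move: (Sc u) => S Q0 E0 hA.
have -> : - E^-1 * (A ^+ 2 / Q ^+ 2) = (- E^-1 * A) * (A / Q ^+ 2) by ring.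
by have -> : - E^-1 * A = S * B; [rewrite hA; field | ring].
Qed.

Definition Khalf t := Kf t (1 / 2) * Kf t (t / 2) * Kf t (t / 2 + 1 / 2).

(** By [qpoch_half_periods] only [(q; q)^-6] and a power of [q] survive in [Khalf]. The fourth power
    reaches the exponent 24 and removes the constant [exp (- pi i / 2)] contained in [e1 * e2]. *)
Lemma Khalf4 t : 0 < complex.Im t ->
  Khalf t ^+ 4 = Sc (1 / 2) ^+ 4 * ee (- t) / Dl t.
Proof.
move=> t0; have q1 := nc_ee_lt1 t0; pose s := ee (t / 2).
have sE : ee t = s ^+ 2 by rewrite -ee_natM; congr ee; field.
have sN : ee (t / 2 + 1 / 2) = - s by rewrite eeD ee_half mulrN1.
rewrite /Khalf Kf_half !Kf_sqrt ?sN ?sqrrN // -/s.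
have := qpoch_half_periods (s := s); cbv zeta; rewrite -sE => /(_ q1) h.
rewrite DlE; set Q := qpoch (ee t) (ee t) in h *.
have Q0 : Q != 0 by exact: qpoch_self_neq0.
set e1 := ee (- (_ / 2 / 2)); set e2 := ee (- (_ / 2)).
have he : (e1 * e2) ^+ 4 = ee (- t) ^+ 2.
  rewrite -eeD -!ee_natM -[LHS](ee_intD 1); congr ee; by field.
move: h; set X := qpoch (- ee t) _; set Y := qpoch s _; set Z := qpoch (- s) _ => h.
have -> : Sc (1 / 2) * (X ^+ 2 / Q ^+ 2) * (- e1 * (Y ^+ 2 / Q ^+ 2)) *
   (- e2 * (Z ^+ 2 / Q ^+ 2)) = Sc (1 / 2) * (e1 * e2) * (X * Y * Z) ^+ 2 / Q ^+ 6.
  by field.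
have -> : (Sc (1 / 2) * (e1 * e2) * (X * Y * Z) ^+ 2 / Q ^+ 6) ^+ 4 =
    Sc (1 / 2) ^+ 4 * (e1 * e2) ^+ 4 * (X * Y * Z) ^+ 8 / Q ^+ 24 by field.
rewrite h expr1n mulr1 he eeN.
have := ee_neq0 t; set E := ee t => E0.
by field; rewrite E0 Q0.
Qed.

Lemma half_lattice t (a b : int) : 0 < complex.Im t ->
  lattice t (a%:~R * (t / 2) + b%:~R * (1 / 2)) ->
  exists c d : int, a = 2 * c /\ b = 2 * d.
Proof.
move=> t0 [c [d h]]; exists c, d.
have {}h : (a - 2 * c)%:~R * t + (b - 2 * d)%:~R = 0.
  have : 2 * (a%:~R * (t / 2) + b%:~R * (1 / 2)) = 2 * (c%:~R * t + d%:~R) by rewrite h.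
  rewrite !intrB !intrM => h2.
  have -> : forall x y : R[i], (a%:~R - 2%:~R * x) * t + (b%:~R - 2%:~R * y) =
    2 * (a%:~R * (t / 2) + b%:~R * (1 / 2)) - 2 * (x * t + y) by move=> x y; field.
  by rewrite h2 subrr.
have := congr1 (@complex.Im R) h; rewrite ReIm_lattice /= => /eqP.
rewrite mulf_eq0 (gt_eqF t0) orbF intr_eq0 => /eqP ac.
move: h; rewrite ac mul0r add0r => /eqP; rewrite intr_eq0 => /eqP bd.
by split; apply/eqP; rewrite -subr_eq0 ?ac ?bd.
Qed.

(** Up to sign and lattice translation, [t |-> - t^-1] swaps the half periods [1 / 2] and [t / 2]
    and fixes the third. The minus sign comes from [e1]; the period in [e3] contributes the factor
    1. *)
Lemma Khalf_inversion t : 0 < complex.Im t ->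
  Khalf (- t^-1) = - (t^-1 ^+ 3 *
    ee (((1 / 2) ^+ 2 + (t / 2) ^+ 2 + (t / 2 + 1 / 2) ^+ 2) / (2 * t))) * Khalf t.
Proof.
move=> t0; have tn := Im_gt0_neq0 t0; have t'0 := Im_inv t0.
have tor (a b : int) u : u = a%:~R * (t / 2) + b%:~R * (1 / 2) -> lattice t (2%:R * u).
  by move=> ->; exists a, b; field.
have inv (a b : int) u : u = a%:~R * (t / 2) + b%:~R * (1 / 2) ->
    (a = 1 \/ b = 1) ->
    Kf (- t^-1) (u / t) = t^-1 * ee (u ^+ 2 / (2 * t)) * Kf t u.
  move=> uE ab; apply: (@Kf_inversion _ t u 2) => //; last exact: tor uE.
  rewrite uE => /(half_lattice t0)[c [d [hc hd]]]; lia.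
have h1 : Kf (- t^-1) (1 / 2 / t) = t^-1 * ee ((1 / 2) ^+ 2 / (2 * t)) * Kf t (1 / 2).
  by apply: (inv 0 1); [ring | right].
have h2 : Kf (- t^-1) (t / 2 / t) = t^-1 * ee ((t / 2) ^+ 2 / (2 * t)) * Kf t (t / 2).
  by apply: (inv 1 0); [ring | left].
have h3 : Kf (- t^-1) ((t / 2 + 1 / 2) / t) =
    t^-1 * ee ((t / 2 + 1 / 2) ^+ 2 / (2 * t)) * Kf t (t / 2 + 1 / 2).
  by apply: (inv 1 1); [ring | left].
have e1 : Kf (- t^-1) (- t^-1 / 2) = - Kf (- t^-1) (1 / 2 / t).
  by rewrite -KfN; congr (Kf _ _); field.
have e2 : Kf (- t^-1) (1 / 2) = Kf (- t^-1) (t / 2 / t) by congr (Kf _ _); field.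
have e3 : Kf (- t^-1) (- t^-1 / 2 + 1 / 2) = Kf (- t^-1) ((t / 2 + 1 / 2) / t).
  have := Kf_period (1 / 2 - - t^-1 / 2) t'0.
  have -> : 1 / 2 - - t^-1 / 2 + - t^-1 = - t^-1 / 2 + 1 / 2 by field.
  have -> : - (1 / 2 - - t^-1 / 2) - - t^-1 / 2 = - (1 / 2) :> R[i] by field.
  have -> : (t / 2 + 1 / 2) / t = 1 / 2 - - t^-1 / 2 by field.
  have -> : - ee (- (1 / 2)) = 1 by rewrite eeN ee_half invrN1 opprK.
  by rewrite (mul1r (Kf _ _)).
rewrite /Khalf e1 e2 e3 h1 h2 h3.
have -> : ee (((1 / 2) ^+ 2 + (t / 2) ^+ 2 + (t / 2 + 1 / 2) ^+ 2) / (2 * t)) =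
    ee ((1 / 2) ^+ 2 / (2 * t)) * ee ((t / 2) ^+ 2 / (2 * t)) *
    ee ((t / 2 + 1 / 2) ^+ 2 / (2 * t)) by rewrite -!eeD -!mulrDl.
ring.
Qed.

Lemma Dl_inversion t : 0 < complex.Im t -> Dl (- t^-1) = t ^+ 12 * Dl t.
Proof.
move=> t0; have tn := Im_gt0_neq0 t0; have t'0 := Im_inv t0.
have h4 : Khalf (- t^-1) ^+ 4 = (t^-1 ^+ 3 *
    ee (((1 / 2) ^+ 2 + (t / 2) ^+ 2 + (t / 2 + 1 / 2) ^+ 2) / (2 * t))) ^+ 4 *
    Khalf t ^+ 4.
  by rewrite Khalf_inversion // [LHS]exprMn exprNn -signr_odd expr0 mul1r.
move: h4; rewrite Khalf4 // Khalf4 // exprMn -exprM -ee_natM.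
(* The exponent equals [t^-1 + t + 1]; these two exponentials cancel those that [Khalf4] produces at
   [- t^-1] and at [t]. *)
have -> : ee (4%:R * (((1 / 2) ^+ 2 + (t / 2) ^+ 2 + (t / 2 + 1 / 2) ^+ 2) / (2 * t)))
    = ee (t^-1) * ee t.
  by rewrite -eeD -[RHS](ee_intD 1); congr ee; field.
have D0 := Dl_neq0 t0; have D0' := Dl_neq0 t'0.
have S0 : Sc (1 / 2) != 0.
  apply/eqP => /Sc_eq0[n hn].
  have : (1%:Z = 2 * n)%R.
    by apply/eqP; rewrite -(eqr_int R[i]) intrM -hn; apply/eqP; field.
  lia.
have := ee_neq0 t; have := ee_neq0 t^-1; rewrite opprK eeN.
move: D0 D0' S0; set D := Dl t; set D' := Dl _; set S := Sc _.
set E := ee t; set E' := ee _ => D0 D0' S0 E'0 E0 h.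
have SE : S ^+ 4 * E' != 0 by rewrite mulf_neq0 ?expf_neq0.
have {}h : D'^-1 = t^-1 ^+ 12 / D.
  apply: (mulfI SE); rewrite h; field.
  by rewrite D0 E0 tn.
by rewrite -[LHS]invrK h; field; rewrite D0 tn.
Qed.

End Discriminant.

(** * The functions of Biagioli in terms of Klein forms *)

Section Transformation.
Variable R : realType.
Local Notation ee := (@ee R).
Local Notation Sc := (@Sc R).
Implicit Types (t u z : R[i]).

Lemma qpowE z (s : rat) : qpow z s = ee (ratr s * z).
Proof. by rewrite eeE /qpow; congr cexp; rewrite -[in LHS]mulrA. Qed.

(** Up to the factor [- eta (p z)^3], this is the product formula for [f_(p,r)] before its sign is
    normalised: it changes sign under [r |-> r + p], which is where the floors in [Lexp] come
    from. *)
Definition kap (p : nat) (r : int) z :=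
  ee (r%:~R ^+ 2 * z / (2 * p%:R)) * Kf (p%:R * z) (r%:~R * z).

Lemma kap_period p (r : int) z : (0 < p)%N -> 0 < complex.Im z ->
  kap p (r + p%:Z) z = - kap p r z.
Proof.
move=> p0 z0; have pn : (p%:R : R[i]) != 0 by rewrite pnatr_eq0 -lt0n.
have pz0 : 0 < complex.Im (p%:R * z) by rewrite Im_natM mulr_gt0 // ltr0n.
rewrite /kap intrD -pmulrn [(_ + _) * z]mulrDl Kf_period //.
have -> : (r%:~R + p%:R) ^+ 2 * z / (2 * p%:R) = r%:~R ^+ 2 * z / (2 * p%:R) +
   (r%:~R * z + p%:R * z / 2) by field.
have -> : - (r%:~R * z) - p%:R * z / 2 = - (r%:~R * z + p%:R * z / 2) by ring.
rewrite eeD eeN; have := ee_neq0 (r%:~R * z + p%:R * z / 2); set E := ee _ => E0.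
by field.
Qed.

Lemma kap_mod p (r : int) z : (0 < p)%N -> 0 < complex.Im z ->
  kap p r z = (-1) ^ (r %/ p%:Z)%Z * kap p (r %% p%:Z)%Z z.
Proof.
move=> p0 z0.
have shift (l : int) x : kap p (x + l * p%:Z) z = (-1) ^ l * kap p x z.
  have shiftn (m : nat) y : kap p (y + m%:Z * p%:Z) z = (-1) ^+ m * kap p y z.
    elim: m => [|m IH]; first by rewrite mul0r addr0 expr0 mul1r.
    rewrite -addn1 PoszD mulrDl mul1r addrA kap_period // IH addn1 exprS; ring.
  case: l => m; first by rewrite shiftn.
  rewrite NegzE -exprnN; apply: (mulfI (_ : (-1) ^+ m.+1 != 0 :> R[i])).
    by rewrite signr_eq0.
  rewrite -shiftn mulrA divff ?signr_eq0 // mul1r; congr (kap _ _ _); ring.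
by rewrite {1}(divz_eq r p%:Z) addrC shift.
Qed.

Definition etaQ t := ee (t / 24) * qpoch (ee t) (ee t).

Lemma dedekind_etaE t : dedekind_eta t = etaQ t.
Proof.
have e1 : ratr (1 / 24 : rat) = 24^-1 :> R[i].
  by rewrite rmorphM rmorph1 mul1r fmorphV rmorph_nat.
have e2 : ratr (1 : rat) = 1 :> R[i] by rewrite rmorph1.
by rewrite /dedekind_eta /etaQ !qpowE e1 e2 mul1r [_^-1 * t]mulrC.
Qed.

Lemma etaQ24 t : etaQ t ^+ 24 = Dl t.
Proof.
rewrite DlE /etaQ exprMn -ee_natM; congr (ee _ * _); by field.
Qed.

Lemma etaQ_neq0 t : 0 < complex.Im t -> etaQ t != 0.
Proof. by move=> t0; rewrite /etaQ mulf_neq0 ?ee_neq0 // qpoch_self_neq0. Qed.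

Lemma fBiagioli_kap p (r : int) z : (0 < p)%N -> 0 < complex.Im z ->
  fBiagioli p r z = - etaQ (p%:R * z) ^+ 3 * kap p (r %% p%:Z)%Z z.
Proof.
move=> p0 z0; have pn : (p%:R : R[i]) != 0 by rewrite pnatr_eq0 -lt0n.
have pz0 : 0 < complex.Im (p%:R * z) by rewrite Im_natM mulr_gt0 // ltr0n.
have q1 := nc_ee_lt1 pz0; have Q0 := qpoch_self_neq0 pz0.
rewrite /fBiagioli /kap /etaQ; set x := (r %% _)%Z.
rewrite !qpowE rmorph_nat.
have -> : (ratr (((p%:R - 2 * x%:~R) ^+ 2 / (8 * p%:R)) : rat) : R[i]) =
    (p%:R - 2 * x%:~R) ^+ 2 / (8 * p%:R).
  by rewrite rmorphM fmorphV rmorphXn rmorphB !rmorphM !rmorph_nat rmorph_int.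
have -> : (ratr (x%:~R : rat) : R[i]) = x%:~R by rewrite rmorph_int.
have -> : (ratr (p%:R - x%:~R : rat) : R[i]) = p%:R - x%:~R.
  by rewrite rmorphB rmorph_nat rmorph_int.
have -> : (p%:R - 2 * x%:~R) ^+ 2 / (8 * p%:R) * z =
  x%:~R ^+ 2 * z / (2 * p%:R) + 3%:R * (p%:R * z / 24) - x%:~R * z / 2.
  by field.
rewrite KfE KqE (qpochS (ee (x%:~R * z)) q1) sub1_ee.
have -> : ee (p%:R * z) * ee (- (x%:~R * z)) = ee ((p%:R - x%:~R) * z).
  by rewrite -eeD mulrBl.
rewrite [ee (p%:R * z) * ee (x%:~R * z)]mulrC eeD eeD ee_natM eeN.
have := ee_neq0 (x%:~R * z / 2); move: Q0.
set E := ee (x%:~R * z / 2); set Q := qpoch (ee (p%:R * z)) _.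
set A := qpoch _ _; set B := qpoch _ _; move: (Sc _) (ee _) (ee _) => S E1 E2.
by move=> Q0 E0; field; rewrite E0 Q0.
Qed.

Lemma prod_expz_const (I : finType) (P : pred I) (x : R[i]) (F : I -> int) : x != 0 ->
  \prod_(i | P i) x ^ F i = x ^ (\sum_(i | P i) F i).
Proof.
move=> x0; elim/big_rec2: _ => [|i a b _ ->]; first by rewrite expr0z.
by rewrite expfzDr.
Qed.

Lemma prod_expzM (I : finType) (P : pred I) (F G : I -> R[i]) (k : I -> int) :
  \prod_(i | P i) (F i * G i) ^ k i =
  \prod_(i | P i) F i ^ k i * \prod_(i | P i) G i ^ k i.
Proof. by rewrite -big_split /=; apply: eq_bigr => i _; rewrite expfzMl. Qed.

Lemma expz_expz (x : R[i]) (a b : int) : (x ^ a) ^ b = x ^ (a * b).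
Proof. by rewrite exprz_exp. Qed.

(* With [n 0 + 3 s = 24 T], the eta factors combine into a power of the
   discriminant, leaving only weight -1 Klein forms. *)
Lemma eta_f_prod p (n : expvec p) (r : 'I_((p.-1)./2).+1 -> int) (T : int) z :
  (0 < p)%N -> 0 < complex.Im z ->
  n ord0 + 3 * \sum_(k < ((p.-1)./2).+1 | (0 < k)%N) n k = 24 * T ->
  dedekind_eta (p%:R * z) ^ n ord0 *
  \prod_(k < ((p.-1)./2).+1 | (0 < k)%N) fBiagioli p (r k) z ^ n k =
  (-1) ^ (\sum_(k < ((p.-1)./2).+1 | (0 < k)%N) n k) * Dl (p%:R * z) ^ T *
  \prod_(k < ((p.-1)./2).+1 | (0 < k)%N) kap p (r k %% p%:Z)%Z z ^ n k.
Proof.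
move=> p0 z0 hT.
have pz0 : 0 < complex.Im (p%:R * z) by rewrite Im_natM mulr_gt0 // ltr0n.
have H0 := etaQ_neq0 pz0.
under eq_bigr do rewrite fBiagioli_kap //.
rewrite prod_expzM mulrA dedekind_etaE; congr (_ * _).
rewrite prod_expz_const ?oppr_eq0 ?expf_neq0 //.
set s := \sum_(_ < _ | _) _ in hT *.
move: H0 (etaQ24 (p%:R * z)).
move: (etaQ (p%:R * z)) (Dl (p%:R * z)) => H D H0 <-.
rewrite -[- H ^+ 3]mulN1r expfzMl mulrCA; congr (_ * _).
by rewrite (exprnP H 3) (exprnP H 24) !expz_expz -hT expfzDr.
Qed.

End Transformation.

Lemma double_index_lt p (k : 'I_((p.-1)./2).+1) : odd p -> (k + k < p)%N.
Proof.
move=> podd; have pE := odd_double_half p; rewrite podd in pE.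
have h : ((p.-1)./2 = p./2)%N by rewrite -[in LHS]pE add1n /= doubleK.
by case: k => j /=; rewrite h => hj; lia.
Qed.

Lemma even_sqrB (k : nat) : (2 %| k%:Z ^+ 2 - k%:Z)%Z.
Proof.
elim: k => [|k IH]; first by rewrite expr0n subrr.
have -> : k.+1%:Z ^+ 2 - k.+1%:Z = (k%:Z ^+ 2 - k%:Z) + 2 * k%:Z.
  by rewrite -addn1 PoszD; ring.
by rewrite rpredD // dvdz_mulr.
Qed.

Lemma even_predz p : odd p -> (2 %| p%:Z - 1)%Z.
Proof.
move=> podd; rewrite -(odd_double_half p) podd PoszD addrAC subrr add0r.
by rewrite -muln2 PoszM dvdz_mull.
Qed.

(** The automorphy factors cancel: exponent -1 from the stroke operator, [12 T] from the
    discriminant and -1 from each of the [v] Klein forms. *)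
Lemma weight_arith (u v T : int) :
  u + v = 2 -> u + 3 * v = 24 * T -> -1 + 12%:Z * T - v = 0.
Proof. lia. Qed.

(** * The action of a matrix with lower row [(p, d)] *)

Section Gamma0Action.
Variable R : realType.
Local Notation ee := (@ee R).
Local Notation Sc := (@Sc R).
Implicit Types (t u z : R[i]).

(** For [t = p z + d] and the image [w] of [z], [p w = a - 1 / t] and [k w = u / t] with
    [u = k (a z + b)]. The determinant gives [p u = k a t - k], so [u] is a torsion point, and it is
    not a lattice point because [p] does not divide [k a]. *)
Lemma kap_transform p (k a b d : int) z : prime p ->
  a * d - b * p%:Z = 1 -> ~~ (p%:Z %| k)%Z -> ~~ (p%:Z %| a)%Z ->
  0 < complex.Im z ->
  kap p k ((a%:~R * z + b%:~R) / (p%:R * z + d%:~R)) =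
  (p%:R * z + d%:~R)^-1 * (-1) ^ (k * b) *
  ee ((k ^+ 2 * a * b)%:~R / (2 * p%:R)) * kap p (k * a) z.
Proof.
move=> pp det pk pa z0; have p0 := prime_gt0 pp.
have pn : (p%:R : R[i]) != 0 by rewrite pnatr_eq0 -lt0n.
have pz0 : 0 < complex.Im (p%:R * z) by rewrite Im_natM mulr_gt0 // ltr0n.
set t := p%:R * z + d%:~R.
have t0 : 0 < complex.Im t by rewrite /t intrC; move: pz0; case: (_ * z) => x y /=; rewrite addr0.
have tn := Im_gt0_neq0 t0.
have detC : a%:~R * d%:~R - b%:~R * p%:R = 1 :> R[i].
  by rewrite [p%:R]pmulrn -!intrM -intrB det.
pose u := k%:~R * (a%:~R * z + b%:~R).
have hpu : lattice t (p%:R * u).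
  by exists (k * a), (k * (b * p%:Z - a * d)); rewrite /u /t !intrM intrB !intrM -pmulrn; ring.
have hu : ~ lattice t u.
  move=> [x [y h]]; have {}h : (k * a - x * p%:Z)%:~R * z + (k * b - x * d - y)%:~R = 0.
    rewrite !intrB !intrM -pmulrn; apply/eqP.
    have -> : (k%:~R * a%:~R - x%:~R * p%:R) * z + (k%:~R * b%:~R - x%:~R * d%:~R - y%:~R) =
      u - (x%:~R * t + y%:~R) by rewrite /u /t; ring.
    by rewrite h subrr.
  have := congr1 (@complex.Im R) h; rewrite ReIm_lattice /= => /eqP.
  rewrite mulf_eq0 (gt_eqF z0) orbF intr_eq0 subr_eq0 => /eqP ka.
  have : (p%:Z %| k * a)%Z by rewrite ka dvdz_mull.
  move: pk pa; rewrite !dvdzE => /negbTE h1 /negbTE h2.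
  by rewrite abszM Euclid_dvdM // h1 h2.
have hinv := Kf_inversion t0 hu p0 hpu.
have zE : (a%:~R * z + b%:~R) / t = u / t / k%:~R.
  rewrite /u; field; rewrite tn intr_eq0 andbT.
  by apply: contraNneq pk => ->; rewrite dvdz0.
have pzE : p%:R * ((a%:~R * z + b%:~R) / t) = - t^-1 + a%:~R.
  apply: (mulIf tn); rewrite mulrA divfK // mulrDl mulNr mulVf //.
  rewrite -[X in _ = - X + _]detC /t; ring.
have kzE : k%:~R * ((a%:~R * z + b%:~R) / t) = u / t by rewrite mulrA.
rewrite /kap pzE kzE Kf_modint hinv.
have -> : Kf t u = (-1) ^ (k * b) * Kf (p%:R * z) ((k * a)%:~R * z).
  rewrite /t Kf_modint -Kf_int; congr (Kf _ _); rewrite /u !intrM; ring.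
set K := Kf _ ((k * a)%:~R * z).
(* The denominator [t] disappears from the Gaussians because [1 + p (a z + b) = a t], again by the
   determinant. *)
have hE : ee (k%:~R ^+ 2 * ((a%:~R * z + b%:~R) / t) / (2 * p%:R)) * ee (u ^+ 2 / (2 * t)) =
  ee ((k ^+ 2 * a * b)%:~R / (2 * p%:R)) * ee ((k * a)%:~R ^+ 2 * z / (2 * p%:R)).
  rewrite -!eeD; congr ee; rewrite !intrM.
  have -> : k%:~R ^+ 2 * ((a%:~R * z + b%:~R) / t) / (2 * p%:R) + u ^+ 2 / (2 * t) =
    k%:~R ^+ 2 * (a%:~R * z + b%:~R) * (1 + p%:R * (a%:~R * z + b%:~R)) / (2 * p%:R * t).
    by rewrite /u; field; rewrite tn pn.
  have -> : 1 + p%:R * (a%:~R * z + b%:~R) = a%:~R * t.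
    by rewrite -[X in X + _]detC /t; ring.
  by field; rewrite tn pn.
move: hE; set e1 := ee _; set e2 := ee _; set e3 := ee _; set e4 := ee _ => hE.
have -> : e1 * (t^-1 * e2 * ((-1) ^ (k * b) * K)) = t^-1 * (-1) ^ (k * b) * (e1 * e2) * K by ring.
by rewrite hE; ring.
Qed.

Lemma exp_sign_mod2 (x y : int) : (2 %| x - y)%Z -> (-1) ^ x = (-1) ^ y :> R[i].
Proof.
move=> /dvdzP[k h]; have -> : x = y + 2%:Z * k by rewrite [2%:Z * k]mulrC -h; ring.
by rewrite expfzDr ?oppr_eq0 ?oner_eq0 // -exprz_exp -exprnP sqrrN expr1n exp1rz mulr1.
Qed.

Lemma sum_dvdz (I : finType) (P : pred I) (F G : I -> int) (q : int) :
  (forall i, P i -> (q %| F i - G i)%Z) ->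
  (q %| \sum_(i | P i) F i - \sum_(i | P i) G i)%Z.
Proof.
by move=> h; rewrite -sumrB; apply: (big_ind (fun x => (q %| x)%Z)) => // x y; exact: rpredD.
Qed.

Lemma jfun_transform p (m : int) (n : expvec p) (a b d : int) z : prime p ->
  (3 < p)%N -> frakF_cond m n -> a * d - b * p%:Z = 1 -> ~~ (p%:Z %| a)%Z ->
  0 < complex.Im z ->
  (p%:R * z + d%:~R) ^ (-1) *
    jfun n ((a%:~R * z + b%:~R) / (p%:R * z + d%:~R)) =
  (-1) ^ Lexp n a b * ee (a%:~R * b%:~R * m%:~R / p%:R) *
   (dedekind_eta (p%:R * z) ^ n ord0 *
    \prod_(k < ((p.-1)./2).+1 | (0 < k)%N) fBiagioli p (k%:Z * a) z ^ n k).
Proof.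
move=> pp p3 [c1 c2 c3] det pa z0; have p0 := prime_gt0 pp.
have pn : (p%:R : R[i]) != 0 by rewrite pnatr_eq0 -lt0n.
have pz0 : 0 < complex.Im (p%:R * z) by rewrite Im_natM mulr_gt0 // ltr0n.
have podd : odd p by case/even_prime: pp => // pE; rewrite pE in p3.
set t := p%:R * z + d%:~R.
have t0 : 0 < complex.Im t by rewrite /t intrC; move: pz0; case: (_ * z) => x y /=; rewrite addr0.
have tn := Im_gt0_neq0 t0.
have detC : a%:~R * d%:~R - b%:~R * p%:R = 1 :> R[i].
  by rewrite [p%:R]pmulrn -!intrM -intrB det.
set s := \sum_(k < _ | _) n k in c1 c3.
have [T hT] : exists T : int, n ord0 + 3 * s = 24 * T.
  by move: c3 => /eqP; rewrite eqz_mod_dvd subr0 => /dvdzP[T ->]; exists T; rewrite mulrC.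
set w := _ / t.
have wE : p%:R * w = - t^-1 + a%:~R.
  apply: (mulIf tn); rewrite /w mulrA divfK // mulrDl mulNr mulVf //.
  rewrite -[X in _ = - X + _]detC /t; ring.
have w0 : 0 < complex.Im w.
  have : 0 < complex.Im (p%:R * w).
    rewrite wE intrC; have := Im_inv t0; case: (- t^-1) => x y /=; by rewrite addr0.
  by rewrite Im_natM pmulr_rgt0 // ltr0n.
have klt (k : 'I_((p.-1)./2).+1) : (k < p)%N.
  exact: leq_ltn_trans (leq_addr _ _) (double_index_lt k podd).
have pk (k : 'I_((p.-1)./2).+1) : (0 < k)%N -> ~~ (p%:Z %| k%:Z)%Z.
  by move=> k0; rewrite dvdzE /= gtnNdvd.
have kmod (k : 'I_((p.-1)./2).+1) : (k%:Z %% p%:Z)%Z = k%:Z.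
  by rewrite modz_small // lez_nat ltz_nat klt.
have E1 : jfun n w = (-1) ^ s * Dl (p%:R * w) ^ T *
    \prod_(k < ((p.-1)./2).+1 | (0 < k)%N) kap p (k%:Z %% p%:Z)%Z w ^ n k.
  exact: (@eta_f_prod R p n (fun k => k%:Z) T w p0 w0 hT).
have := @eta_f_prod R p n (fun k => k%:Z * a) T z p0 z0 hT; cbv beta; move=> E2.
rewrite E1 E2 -/s.
have -> : Dl (p%:R * w) = t ^+ 12 * Dl (p%:R * z).
  by rewrite wE Dl_int Dl_inversion // /t Dl_int.
pose X := \sum_(k < ((p.-1)./2).+1 | (0 < k)%N) k%:Z * n k.
pose Y := \sum_(k < ((p.-1)./2).+1 | (0 < k)%N) k%:Z ^+ 2 * n k.
pose F := \sum_(k < ((p.-1)./2).+1 | (0 < k)%N) ((k%:Z * a) %/ p%:Z)%Z * n k.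
pose e := ee ((a * b)%:~R / (2 * p%:R)).
have e0 : e != 0 by exact: ee_neq0.
have N10 : (-1 : R[i]) != 0 by rewrite oppr_eq0 oner_eq0.
(* The factors are the weight, the integer translations [k b], the Gaussians and the reductions of
   [k a] modulo [p], in this order. *)
have -> : \prod_(k < ((p.-1)./2).+1 | (0 < k)%N) kap p (k%:Z %% p%:Z)%Z w ^ n k =
    t ^ (- s) * (-1) ^ (b * X) * e ^ Y * (-1) ^ F *
    \prod_(k < ((p.-1)./2).+1 | (0 < k)%N) kap p ((k%:Z * a) %% p%:Z)%Z z ^ n k.
  have -> : - s = \sum_(k < ((p.-1)./2).+1 | (0 < k)%N) - n k by rewrite sumrN.
  rewrite mulr_sumr -!prod_expz_const // -!big_split /=.
  apply: eq_bigr => k k0; rewrite kmod.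
  have -> : kap p k%:Z w = t^-1 * (-1) ^ (k%:Z * b) * e ^ (k%:Z ^+ 2) *
      ((-1) ^ ((k%:Z * a) %/ p%:Z)%Z * kap p ((k%:Z * a) %% p%:Z)%Z z).
    rewrite kap_transform // ?pk // -/t -(kap_mod _ p0 z0); congr (_ * _ * _).
    by rewrite /e -ee_intM; congr ee; rewrite !intrM; ring.
  move: (kap p (_ %% _)%Z z) (_ %/ _)%Z => K q.
  rewrite !expfzMl !exprz_exp exprz_inv.
  by have -> : k%:Z * b * n k = b * (k%:Z * n k); [ring | rewrite !mulrA].
have [l hl] : exists l : int, Y = 2 * m + p%:Z * l.
  move: c2 => /eqP; rewrite eqz_mod_dvd => /dvdzP[l hl]; exists l.
  by rewrite [p%:Z * _]mulrC -hl /Y; ring.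
have YX : (2 %| Y - X)%Z.
  by apply: sum_dvdz => k _; rewrite -mulrBl dvdz_mulr // even_sqrB.
(* Since [Y = 2 m + p l], the power is [exp (2 pi i a b m / p)] times [(-1) ^ (a b l)]. As [p] is
   odd and [k^2 = k] modulo 2, [l], [Y] and [X] have the same parity. With [(-1) ^ (b * X)] this
   yields the term [b (a + 1) X] of [Lexp]. *)
have hsign : e ^ Y = ee (a%:~R * b%:~R * m%:~R / p%:R) * (-1) ^ (a * b * X).
  have -> : (-1) ^ (a * b * X) = (-1) ^ (a * b * l) :> R[i].
    apply: exp_sign_mod2; rewrite -mulrBr dvdz_mull //.
    have -> : X - l = 2 * m + (p%:Z - 1) * l - (Y - X) by rewrite hl; ring.
    apply: rpredB => //; apply: rpredD; first exact: dvdz_mulr.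
    by rewrite dvdz_mulr // even_predz.
  rewrite /e -ee_intM -ee_half_int -eeD; congr ee.
  rewrite hl intrD !intrM -pmulrn; by field.
rewrite hsign /Lexp -/X -/F.
have -> : b * (a + 1) * X + F = a * b * X + b * X + F by ring.
rewrite !expfzDr // expfzMl.
have hw : t ^ (-1) * (t ^+ 12) ^ T * t ^ (- s) = 1.
  rewrite (exprnP t 12) exprz_exp -!expfzDr //.
  by rewrite (weight_arith c1 hT) expr0z.
move: hw; set t1 := t ^ _; set t2 := (t ^+ 12) ^ _; set t3 := t ^ _ => hw.
set P := \prod_(_ < _ | _) _; set E := ee _; set D := Dl _ ^ _.
have -> : t1 * ((-1) ^ s * (t2 * D) * (t3 * (-1) ^ (b * X) * (E * (-1) ^ (a * b * X)) * (-1) ^ F * P)) =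
  (t1 * t2 * t3) * ((-1) ^ s * D * ((-1) ^ (b * X) * (E * (-1) ^ (a * b * X)) * (-1) ^ F * P)) by ring.
rewrite hw; ring.
Qed.

End Gamma0Action.

(** * Permuted exponent vectors *)

Section PermutedExponents.
Variables (p r : nat).
Hypotheses (p_prime : prime p) (p_gt3 : (3 < p)%N) (hr : (1 <= r <= (p.-1)./2)%N).
Implicit Types (i j : 'I_((p.-1)./2).+1).

Let p_gt2 : (2 < p)%N := ltnW p_gt3.

Lemma p_odd : odd p.
Proof. by case/even_prime: (p_prime) => // pE; move: p_gt3; rewrite pE. Qed.

Lemma pi_idx_dvd i : (0 < i)%N ->
  (p%:Z %| r%:Z * (pi_idx r i)%:Z - i%:Z)%Z \/ (p%:Z %| r%:Z * (pi_idx r i)%:Z + i%:Z)%Z.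
Proof.
move=> i0; have /andP[_] := pi_idxP p_prime p_gt2 hr i0.
case/orP => [h|h]; [left|right].
  by rewrite -eqz_mod_dvd -PoszM !modz_nat eqz_nat.
by rewrite -PoszM -PoszD.
Qed.

(** Fixing the index 0 gives an injection of the whole index type, by which sums can be
    reindexed. *)
Definition pi_total i := if (0 < i)%N then pi_idx r i else i.

Lemma pi_total_gt0 i : (0 < pi_total i)%N = (0 < i)%N.
Proof.
rewrite /pi_total; case: ifP => // i0.
by have /andP[->] := pi_idxP p_prime p_gt2 hr i0.
Qed.

(** A common image [i'] satisfies [r i' = +-i1] and [r i' = +-i2] modulo [p], so [p] divides
    [i1 - i2] or [i1 + i2]. Both are smaller than [p] in absolute value and the sum is positive, so
    [i1 = i2]. *)
Lemma pi_total_inj : injective pi_total.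
Proof.
move=> i1 i2 h; have := pi_total_gt0 i1; rewrite h pi_total_gt0 => h0.
move: h; rewrite /pi_total h0; case: ifP => // i10 h.
have i20 : (0 < i2)%N by rewrite h0.
have key : (p%:Z %| i1%:Z - i2%:Z)%Z \/ (p%:Z %| i1%:Z + i2%:Z)%Z.
  have := pi_idx_dvd i20; have := pi_idx_dvd i10; rewrite h.
  set w := r%:Z * _ => -[] d1 [] d2; [left|right|right|left].
  - have -> : i1%:Z - i2%:Z = (w - i2%:Z) - (w - i1%:Z) by ring.
    exact: rpredB.
  - have -> : i1%:Z + i2%:Z = (w + i2%:Z) - (w - i1%:Z) by ring.
    exact: rpredB.
  - have -> : i1%:Z + i2%:Z = (w + i1%:Z) - (w - i2%:Z) by ring.
    exact: rpredB.
  - have -> : i1%:Z - i2%:Z = (w + i1%:Z) - (w + i2%:Z) by ring.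
    exact: rpredB.
have l1 := double_index_lt i1 p_odd; have l2 := double_index_lt i2 p_odd.
apply: val_inj => /=; case: key; rewrite dvdzE /= => d; last first.
  by move: d; rewrite gtnNdvd //; lia.
have [|dn0] := posnP `|i1%:Z - i2%:Z|%N; first by lia.
by move: d; rewrite gtnNdvd //; lia.
Qed.

(** Squaring removes the sign in [r k' = +-k]: [k^2 = r^2 k'^2] modulo [p], so the quadratic sum is
    multiplied by [r^2]. The other two conditions are invariant under permutation. *)
Lemma frakF_cond_pi_vec (m m' : int) (n : expvec p) :
  (m' = r%:Z ^+ 2 * m %[mod p%:Z])%Z -> frakF_cond m n -> frakF_cond m' (pi_vec r n).
Proof.
move=> hm [c1 c2 c3].
have sumE : \sum_(k < ((p.-1)./2).+1 | (0 < k)%N) pi_vec r n k =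
    \sum_(k < ((p.-1)./2).+1 | (0 < k)%N) n k.
  rewrite [RHS](reindex_inj pi_total_inj) /=; apply: eq_big => k.
    by rewrite pi_total_gt0.
  by move=> k0; rewrite ffunE /pi_total k0.
have n0E : pi_vec r n ord0 = n ord0 by rewrite ffunE.
split; rewrite ?n0E ?sumE //.
apply/eqP; rewrite eqz_mod_dvd.
pose S := \sum_(k < ((p.-1)./2).+1 | (0 < k)%N) k%:Z ^+ 2 * n k.
move: c2 hm => /eqP; rewrite eqz_mod_dvd -/S => hS /eqP; rewrite eqz_mod_dvd => hm.
have SE : S = \sum_(k < ((p.-1)./2).+1 | (0 < k)%N)
    (pi_total k)%:Z ^+ 2 * n (pi_total k).
  by rewrite /S (reindex_inj pi_total_inj) /=; apply: eq_bigl => k; rewrite pi_total_gt0.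
set S' := \sum_(_ < _ | _) _.
have hS' : (p%:Z %| S' - r%:Z ^+ 2 * S)%Z.
  rewrite SE mulr_sumr; apply: sum_dvdz => k k0; rewrite ffunE /pi_total k0.
  have -> : k%:Z ^+ 2 * n (pi_idx r k) - r%:Z ^+ 2 * ((pi_idx r k)%:Z ^+ 2 * n (pi_idx r k)) =
    (r%:Z * (pi_idx r k)%:Z - k%:Z) * ((r%:Z * (pi_idx r k)%:Z + k%:Z) * - n (pi_idx r k)).
    by ring.
  by case: (pi_idx_dvd k0) => h; [rewrite dvdz_mulr | rewrite dvdz_mull // dvdz_mulr].
have -> : S' - 2 * m' = (S' - r%:Z ^+ 2 * S) + r%:Z ^+ 2 * (S - 2 * m) -
  2 * (m' - r%:Z ^+ 2 * m) by ring.
by apply: rpredB; [apply: rpredD => //; exact: dvdz_mull | exact: dvdz_mull].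
Qed.

End PermutedExponents.

(** * The exponents are determined by the function *)

Section Injectivity.
Variable R : realType.
Local Notation ee := (@ee R).
Implicit Types (f g : nat -> R[i]) (c : R[i]).

(* The nome exp (- 2 pi (N + 1)) of the point (N + 1) i. *)
Definition nome (N : nat) : R[i] := ee 'i%C ^+ N.+1.

Lemma Im_i : complex.Im ('i%C : R[i]) = 1.
Proof. by []. Qed.

Lemma nc_ei_lt1 : nc (ee 'i%C) < 1.
Proof. by apply: nc_ee_lt1; rewrite Im_i ltr01. Qed.

Lemma nome_neq0 N : nome N != 0.
Proof. by rewrite expf_neq0 // ee_neq0. Qed.

Lemma nc_nome_le N : nc (nome N) <= nc (ee 'i%C).
Proof.
by rewrite /nome ncX exprS ler_piMr ?nc_ge0 // exprn_ile1 ?nc_ge0 // ltW // nc_ei_lt1.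
Qed.

Lemma nome_cvg0 : ccvg nome 0.
Proof.
apply: (@ccvg_squeeze _ _ _ (fun N => nc (ee 'i%C) ^+ N.+1)).
  by move=> N; rewrite subr0 /nome ncX.
rewrite (cvg_shiftS (fun N => nc (ee 'i%C) ^+ N)).
have := @cvg_geometric R 1 (nc (ee 'i%C)); rewrite ger0_norm ?nc_ge0 // => /(_ nc_ei_lt1).
by apply: cvg_trans; apply: near_eq_cvg; apply: nearW => N; rewrite /= mul1r.
Qed.

(* [f = 1 + c q^k + o(q^k)] along the nomes. *)
Definition asym k f c := ccvg (fun N => (f N - 1) / nome N ^+ k) c.

Lemma asym_cvg1 k f c : (0 < k)%N -> asym k f c -> ccvg f 1.
Proof.
move=> k0 h; have := ccvgD (ccvgM h (ccvgX k nome_cvg0)) (ccvg_cst 1).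
rewrite expr0n eqn0Ngt k0 mulr0 add0r => h2; apply: (eq_ccvg h2) => N.
by rewrite divfK ?subrK // expf_neq0 // nome_neq0.
Qed.

Lemma asym1 k : asym k (fun=> 1) 0.
Proof. by apply: (eq_ccvg (ccvg_cst 0)) => N; rewrite subrr mul0r. Qed.

Lemma asymM k f g c d : (0 < k)%N -> asym k f c -> asym k g d ->
  asym k (fun N => f N * g N) (c + d).
Proof.
move=> k0 hf hg; have := ccvgD (ccvgM hf (asym_cvg1 k0 hg)) hg.
rewrite mulr1 => h; apply: (eq_ccvg h) => N; ring.
Qed.

Lemma asymV k f c : (0 < k)%N -> (forall N, f N != 0) -> asym k f c ->
  asym k (fun N => (f N)^-1) (- c).
Proof.
move=> k0 f0 hf.
have := ccvgN (ccvgM hf (ccvgV (oner_neq0 _) (asym_cvg1 k0 hf))).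
rewrite invr1 mulr1 => h; apply: (eq_ccvg h) => N.
by have := f0 N; have := expf_neq0 k (nome_neq0 N);
  move: (nome N ^+ k) (f N) => a b a0 b0; field; rewrite a0 b0.
Qed.

Lemma asym_expz k f c (m : int) : (0 < k)%N -> (forall N, f N != 0) -> asym k f c ->
  asym k (fun N => f N ^ m) (c * m%:~R).
Proof.
move=> k0 f0 hf.
have hn (j : nat) : asym k (fun N => f N ^+ j) (c * j%:R).
  elim: j => [|j IH]; first by rewrite mulr0; exact: asym1.
  rewrite -natr1 mulrDr mulr1 addrC.
  by apply: (eq_ccvg (asymM k0 hf IH)) => N; rewrite exprS.
case: m => j; first by rewrite -pmulrn; exact: hn.
rewrite NegzE mulrNz mulrN -pmulrn.
apply: (eq_ccvg (asymV k0 _ (hn j.+1))) => N; first by rewrite expf_neq0.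
by rewrite -exprnN.
Qed.

Lemma asym_prod k (I : finType) (P : pred I) (F : I -> nat -> R[i]) (C : I -> R[i]) :
  (0 < k)%N -> (forall i, P i -> asym k (F i) (C i)) ->
  asym k (fun N => \prod_(i | P i) F i N) (\sum_(i | P i) C i).
Proof.
move=> k0 h; rewrite /asym.
under [fun N => _]eq_fun do rewrite -(big_filter _ P).
rewrite -(big_filter _ P).
have : forall i, i \in [seq i <- index_enum I | P i] -> asym k (F i) (C i).
  by move=> i; rewrite mem_filter => /andP[/h].
elim: [seq i <- _ | _] => [|i s IH] hs.
  rewrite big_nil; apply: (eq_ccvg (asym1 k)) => N; by rewrite big_nil.
rewrite big_cons.
have h1 : asym k (F i) (C i) by apply: hs; rewrite mem_head.
have h2 := IH (fun j hj => hs j (mem_behead (s := i :: s) hj)).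
by apply: (eq_ccvg (asymM k0 h1 h2)) => N; rewrite big_cons.
Qed.

Definition Apoch p j N := qpoch (nome N ^+ j) (nome N ^+ p).

Lemma nc_nomeX_lt1 p N : (0 < p)%N -> nc (nome N ^+ p) < 1.
Proof.
move=> p0; rewrite ncX exprn_ilt1 ?nc_ge0 -?lt0n //.
exact: le_lt_trans (nc_nome_le N) nc_ei_lt1.
Qed.

Lemma Apoch_neq0 p j N : (0 < p)%N -> (0 < j)%N -> Apoch p j N != 0.
Proof.
move=> p0 j0; apply: qpoch_neq0; first exact: nc_nomeX_lt1.
move=> l; apply/eqP => h; have : nc (nome N ^+ (j + p * l)) < 1.
  by apply: nc_nomeX_lt1; rewrite addn_gt0 j0.
by rewrite exprD exprM h nc1 ltxx.
Qed.

(** The symbol is [1 + O(q^j)]. Every nome is at most [r = exp (- 2 pi)] in modulus, so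
    [c = 1 / (1 - r)] bounds [1 / (1 - q^p)], and [exp y - 1 <= y * exp y] gives the constant
    [c * expR c]. *)
Lemma asym_Apoch_gt p j k : (0 < p)%N -> (k < j)%N -> asym k (Apoch p j) 0.
Proof.
move=> p0 kj; pose r := nc (ee 'i%C); have r0 : 0 <= r := nc_ge0 _.
have r1 : r < 1 := nc_ei_lt1.
pose c := (1 - r)^-1; have c0 : 0 < c by rewrite invr_gt0 subr_gt0.
apply: (@ccvg_squeeze _ _ _ (fun N => c * expR c * nc (nome N))).
  move=> N; rewrite subr0 ncM ncV ncX.
  have x0 : 0 <= nc (nome N) := nc_ge0 _.
  have xr : nc (nome N) <= r := nc_nome_le N.
  have xp : 0 < nc (nome N) by rewrite nc_gt0 nome_neq0.
  have hA := nc_qpoch_sub1 (nome N ^+ j) (nc_nomeX_lt1 N p0).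
  rewrite (ncX (nome N) j) (ncX (nome N) p) -/(Apoch p j N) in hA.
  move: hA x0 xr xp; move: (nc (nome N)) (nc (Apoch p j N - 1)) => x w hA x0 xr xp.
  rewrite ler_pdivrMr ?exprn_gt0 // -[c * expR c * x * _]mulrA -exprS.
  apply: (le_trans hA).
  have x1 : x <= 1 by rewrite (le_trans xr) ?ltW.
  pose y := x ^+ j / (1 - x ^+ p).
  have xpr : x ^+ p <= r.
    by case: (p) p0 => // p' _; rewrite exprS (le_trans _ xr) // ler_piMr // exprn_ile1.
  have hc : (1 - x ^+ p)^-1 <= c.
    by rewrite lef_pV2 ?posrE ?subr_gt0 // ?(le_lt_trans xpr) // lerD2l lerN2.
  have xj : x ^+ j <= x ^+ k.+1 by apply: ler_wiXn2l.
  have hy : y <= c * x ^+ k.+1.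
    rewrite mulrC /y mulrC mulrC ler_pM ?exprn_ge0 // invr_ge0 subr_ge0.
    by rewrite (le_trans xpr) // ltW.
  have y0 : 0 <= y.
    by rewrite divr_ge0 ?exprn_ge0 // subr_ge0 (le_trans xpr) // ltW.
  have yc : y <= c.
    by rewrite (le_trans hy) // ler_piMr ?(ltW c0) // exprn_ile1.
  have h1 : expR y - 1 <= y * expR y.
    have h : 1 - y <= expR (- y) by have := expR_ge1Dx (- y).
    have : (1 - y) * expR y <= 1.
      by rewrite (le_trans (ler_wpM2r (expR_ge0 y) h)) // -expRD addNr expR0.
    rewrite mulrBl mul1r => h2; lra.
  rewrite -/y; apply: (le_trans h1).
  have -> : c * expR c * x ^+ k.+1 = (c * x ^+ k.+1) * expR c by ring.
  by rewrite ler_pM ?expR_ge0 ?ler_expR.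
rewrite -[X in _ --> X](mulr0 (c * expR c)); apply: cvgM; first exact: cvg_cst.
have := ccvgP nome_cvg0; apply: cvg_trans; apply: near_eq_cvg.
by apply: nearW => N; rewrite subr0.
Qed.

Lemma asym_Apoch_eq p k : (0 < p)%N -> (0 < k)%N -> asym k (Apoch p k) (-1).
Proof.
move=> p0 k0.
have h1 : asym k (fun N => 1 - nome N ^+ k) (-1).
  apply: (eq_ccvg (ccvg_cst (-1))) => N.
  by rewrite addrAC subrr add0r mulNr divff // expf_neq0 // nome_neq0.
have h2 : asym k (Apoch p (k + p)) 0.
  by apply: asym_Apoch_gt => //; rewrite -[X in (X < _)%N]addn0 ltn_add2l.
have := asymM k0 h1 h2; rewrite addr0 => h; apply: (eq_ccvg h) => N.
by rewrite /Apoch [in RHS]qpochS ?nc_nomeX_lt1 // -exprD.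
Qed.

(* The q-exponent of the leading term of [jfun n]. *)
Definition jexp p (n : expvec p) : rat := (n ord0)%:~R * (p%:R / 24) +
  \sum_(k < ((p.-1)./2).+1 | (0 < k)%N)
    (n k)%:~R * ((p%:R - 2 * k%:R) ^+ 2 / (8 * p%:R)).

Definition jprod p (n : expvec p) N :=
  Apoch p p N ^ (n ord0) *
  \prod_(k < ((p.-1)./2).+1 | (0 < k)%N)
    (Apoch p k N * Apoch p (p - k) N * Apoch p p N) ^ n k.

Lemma ratr_ee (s : rat) (m : int) z : ee (ratr (m%:~R * s) * z) = ee (ratr s * z) ^ m.
Proof. by rewrite -ee_intM mulrA; congr (ee (_ * _)); rewrite rmorphM /= rmorph_int. Qed.

Lemma ee_sum (I : finType) (P : pred I) (F : I -> R[i]) :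
  ee (\sum_(i | P i) F i) = \prod_(i | P i) ee (F i).
Proof.
by elim/big_rec2: _ => [|i a b _ <-]; rewrite ?ee0 // eeD.
Qed.

Lemma jfun_nome p (n : expvec p) N : odd p ->
  jfun n (N.+1%:R * 'i%C) = ee (ratr (jexp n) * (N.+1%:R * 'i%C)) * jprod n N.
Proof.
move=> podd; have p0 : (0 < p)%N by case: (p) podd.
set z := N.+1%:R * 'i%C.
have zq (j : nat) : ee (j%:R * z) = nome N ^+ j.
  by rewrite ee_natM /z ee_natM.
have hEta : dedekind_eta (p%:R * z) = ee (ratr (p%:R / 24 : rat) * z) * Apoch p p N.
  have e1 : ratr (1 / 24 : rat) = 24^-1 :> R[i].
    by rewrite rmorphM rmorph1 mul1r fmorphV rmorph_nat.
  have e2 : ratr (1 : rat) = 1 :> R[i] by rewrite rmorph1.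
  have e3 : ratr (p%:R / 24 : rat) = p%:R / 24 :> R[i].
    by rewrite rmorphM fmorphV !rmorph_nat.
  rewrite /dedekind_eta !qpowE e1 e2 e3 mul1r zq /Apoch; congr (ee _ * _).
  by rewrite mulrA [24^-1 * _]mulrC.
have hF (k : 'I_((p.-1)./2).+1) : (0 < k)%N -> fBiagioli p k%:Z z =
    ee (ratr ((p%:R - 2 * k%:R) ^+ 2 / (8 * p%:R) : rat) * z) *
    (Apoch p k N * Apoch p (p - k) N * Apoch p p N).
  move=> k0; have kp : (k < p)%N.
    exact: leq_ltn_trans (leq_addr _ _) (double_index_lt k podd).
  rewrite /fBiagioli modz_small; last by rewrite lez_nat ltz_nat.
  rewrite !(qpowE z); congr (_ * _).
  have -> : ratr (p%:R : rat) = p%:R :> R[i] by rewrite rmorph_nat.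
  have -> : ratr (((k : nat)%:Z)%:~R : rat) = k%:R :> R[i] by rewrite rmorph_int.
  have -> : ratr (p%:R - ((k : nat)%:Z)%:~R : rat) = (p - k)%:R :> R[i].
    by rewrite rmorphB /= rmorph_nat rmorph_int natrB // ltnW.
  by rewrite !zq.
rewrite /jfun /jexp /jprod hEta expfzMl rmorphD /= rmorph_sum /= mulrDl mulr_suml.
rewrite eeD ee_sum ratr_ee.
have -> : \prod_(k < ((p.-1)./2).+1 | (0 < k)%N) fBiagioli p k%:Z z ^ n k =
  \prod_(k < ((p.-1)./2).+1 | (0 < k)%N)
    ee (ratr ((n k)%:~R * ((p%:R - 2 * k%:R) ^+ 2 / (8 * p%:R)) : rat) * z) *
  \prod_(k < ((p.-1)./2).+1 | (0 < k)%N)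
    (Apoch p k N * Apoch p (p - k) N * Apoch p p N) ^ n k.
  rewrite -big_split /=; apply: eq_bigr => k k0.
  by rewrite hF // expfzMl ratr_ee.
exact: mulrACA.
Qed.

(** Passing from [N] to [N + 1] multiplies the sequence by [ee (ratr s * 'i)]; as the limit is 1,
    this factor is 1, and its modulus is [exp (- 2 pi s)]. *)
Lemma ee_neq0_rat_one (s : rat) : ccvg (fun N => ee (ratr s * (N.+1%:R * 'i%C))) 1 -> s = 0.
Proof.
move=> h; have hS := ccvgS h.
have h2 := ccvgZ (ee (ratr s * 'i%C)) h.
have : ee (ratr s * 'i%C) * 1 = 1.
  apply: (ccvg_unique h2); apply: (eq_ccvg hS) => N.
  by rewrite -eeD; congr ee; rewrite -[in LHS]natr1; ring.
rewrite mulr1 => h1.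
have : nc (ee (ratr s * 'i%C)) = 1 by rewrite h1 nc1.
have -> : (ratr s : R[i]) = (ratr s : R)%:C by rewrite -(fmorph_rat (real_complex R)).
rewrite nc_ee -[1 in RHS]expR0 => /expR_inj/eqP.
rewrite oppr_eq0 /= mulr0 mulr1 addr0 ?add0r.
rewrite mulf_eq0 gt_eqF ?mulr_gt0 ?pi_gt0 //= => /eqP h0.
by move/eqP: h0; rewrite fmorph_eq0 => /eqP.
Qed.

(** As [jprod] tends to 1, the leading exponent [jexp n] vanishes and [jprod] is identically 1. If
    the exponents below [k] are 0, its coefficient of [q^k] is [- n k], because [k < p - k]; so all
    [n k] with [k > 0] vanish by induction, and then [jexp n = 0] gives [n ord0 = 0]. *)
Lemma jfun_eq1 p (n : expvec p) : odd p -> (3 < p)%N ->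
  (forall z : R[i], 0 < complex.Im z -> jfun n z = 1) -> n =1 (fun=> 0).
Proof.
move=> podd p3 h; have p0 : (0 < p)%N by exact: leq_trans p3.
have kp (k : 'I_((p.-1)./2).+1) : (k + k < p)%N by exact: double_index_lt.
have hN N : ee (ratr (jexp n) * (N.+1%:R * 'i%C)) * jprod n N = 1.
  by rewrite -jfun_nome // h // Im_natM Im_i mulr1 ltr0n.
have F0 (k : 'I_((p.-1)./2).+1) N : (0 < k)%N ->
    Apoch p k N * Apoch p (p - k) N * Apoch p p N != 0.
  move=> k0; rewrite !mulf_neq0 ?Apoch_neq0 // subn_gt0.
  by have := kp k; lia.
have asymj (k : nat) (c : 'I_((p.-1)./2).+1 -> R[i]) : (0 < k)%N -> (k < p)%N ->
    (forall j : 'I_((p.-1)./2).+1, (0 < j)%N -> n j != 0 ->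
      asym k (fun N => Apoch p j N * Apoch p (p - j) N * Apoch p p N) (c j)) ->
    asym k (jprod n) (\sum_(j < ((p.-1)./2).+1 | (0 < j)%N) c j * (n j)%:~R).
  move=> k0 kltp hc.
  have h1 : asym k (fun N => Apoch p p N ^ n ord0) 0.
    rewrite -[0](mul0r (n ord0)%:~R); apply: asym_expz => //.
      by move=> N; apply: Apoch_neq0.
    exact: asym_Apoch_gt.
  rewrite -[X in asym _ _ X]add0r; apply: asymM => //; apply: asym_prod => // j j0.
  have [nj|nj] := eqVneq (n j) 0.
    by rewrite nj mulr0; apply: (eq_ccvg (asym1 k)).
  by apply: asym_expz => //; [move=> N; exact: F0 | exact: hc].
have asym0 (j : 'I_((p.-1)./2).+1) (k : nat) : (k < j)%N ->
    asym k (fun N => Apoch p j N * Apoch p (p - j) N * Apoch p p N) 0 \/ k = 0%N.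
  move=> kj; case: k kj => [|k] kj; [by right|left].
  have := kp j => jj.
  rewrite -[0](addr0 0) -[X in asym _ _ (X + _)](addr0 0).
  by apply: asymM => //; [apply: asymM => // |]; apply: asym_Apoch_gt => //; lia.
have asymk (j : 'I_((p.-1)./2).+1) : (0 < j)%N ->
    asym j (fun N => Apoch p j N * Apoch p (p - j) N * Apoch p p N) (-1).
  move=> j0; have := kp j => jj.
  rewrite -[-1](addr0 (-1)) -[X in asym _ _ (X + _)](addr0 (-1)).
  apply: asymM => //; first apply: asymM => //.
  - exact: asym_Apoch_eq.
  - by apply: asym_Apoch_gt => //; lia.
  - by apply: asym_Apoch_gt => //; lia.
have j1 : ccvg (jprod n) 1.
  have p1 : (1 < p)%N by lia.
  pose c (j : 'I_((p.-1)./2).+1) : R[i] := if j == 1%N :> nat then -1 else 0.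
  apply: (asym_cvg1 (k := 1) _ (asymj 1%N c _ p1 _)) => // j j0 _; rewrite /c.
  case: eqP => [jE|jE]; first by have := asymk j j0; rewrite jE.
  by case: (asym0 j 1%N) => //; lia.
have e0 : jexp n = 0.
  apply: ee_neq0_rat_one; rewrite -[X in ccvg _ X]invr1.
  apply: (eq_ccvg (ccvgV (oner_neq0 _) j1)) => N.
  have jN : jprod n N != 0.
    by apply/eqP => h0; have /eqP := hN N; rewrite h0 mulr0 eq_sym oner_eq0.
  by apply: (mulIf jN); rewrite mulVf // hN.
have jp1 N : jprod n N = 1 by have := hN N; rewrite e0 rmorph0 mul0r ee0 mul1r.
have pos (k : nat) (j : 'I_((p.-1)./2).+1) : j = k :> nat -> (0 < j)%N -> n j = 0.
  elim/ltn_ind: k j => k IH j jk j0.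
  have k0 : (0 < k)%N by rewrite -jk.
  have kltp : (k < p)%N by have := kp j; lia.
  pose c (i : 'I_((p.-1)./2).+1) : R[i] := if i == j then -1 else 0.
  have hj : asym k (jprod n) (\sum_(i < ((p.-1)./2).+1 | (0 < i)%N) c i * (n i)%:~R).
    apply: asymj => // i i0 ni; rewrite /c; case: eqP => [->|ij].
      by have := asymk j j0; rewrite jk.
    have ki : (k < i)%N.
      rewrite ltnNge; apply/negP; rewrite leq_eqVlt => /orP[/eqP ik|ik].
        by apply: ij; apply: val_inj; rewrite /= ik jk.
      by move: ni; rewrite (IH i ik i) // eqxx.
    by case: (asym0 i k ki) => // k00; rewrite k00 in k0.
  have h0 : asym k (jprod n) 0.
    by apply: (eq_ccvg (asym1 k)) => N; rewrite jp1.
  have := ccvg_unique hj h0; rewrite (bigD1 j) //= big1; last first.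
    by move=> i /andP[_ ij]; rewrite /c (negbTE ij) mul0r.
  rewrite /c eqxx addr0 mulN1r => /eqP; rewrite oppr_eq0 intr_eq0 => /eqP //.
move=> k; have [k0|] := posnP k; last exact: (pos k).
have -> : k = ord0 by apply: val_inj.
move: e0; rewrite /jexp big1 ?addr0; last first.
  by move=> j j0; rewrite (pos j) // mul0r.
move/eqP; rewrite mulf_eq0 intr_eq0 => /orP[/eqP//|].
by rewrite mulf_eq0 invr_eq0 !pnatr_eq0 orbF => /eqP pE; rewrite pE in p0.
Qed.

(** The functions have no zeros, so subtracting exponents divides them. That [f_(p,k)] has no zero
    amounts to [k z] not lying in [Z p z + Z], as [0 < k < p]. *)
Lemma jfun_inj p (n n' : expvec p) : odd p -> (3 < p)%N ->
  (forall z : R[i], 0 < complex.Im z -> jfun n z = jfun n' z) -> n = n'.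
Proof.
move=> podd p3 h; have p0 : (0 < p)%N by exact: leq_trans p3.
have pn : (p%:R : R[i]) != 0 by rewrite pnatr_eq0 -lt0n.
pose d : expvec p := [ffun k => n k - n' k].
suff d0 : d =1 (fun=> 0).
  by apply/ffunP => k; have := d0 k; rewrite ffunE => /eqP; rewrite subr_eq0 => /eqP.
apply: jfun_eq1 => // z z0.
have pz0 : 0 < complex.Im (p%:R * z) by rewrite Im_natM mulr_gt0 // ltr0n.
have eta0 : dedekind_eta (p%:R * z) != 0 by rewrite dedekind_etaE etaQ_neq0.
have f0 (k : 'I_((p.-1)./2).+1) : (0 < k)%N -> fBiagioli p k%:Z z != 0.
  move=> k0; rewrite fBiagioli_kap // mulf_neq0 ?oppr_eq0 ?expf_neq0 ?etaQ_neq0 //.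
  have kp : (k < p)%N by have := double_index_lt k podd; lia.
  rewrite modz_small; last by rewrite lez_nat ltz_nat kp.
  rewrite /kap mulf_neq0 ?ee_neq0 // Kf_neq0 // => -[a [b]] /eqP.
  rewrite -subr_eq0 => /eqP hk.
  have : (k%:Z - a * p%:Z)%:~R * z + (- b)%:~R = 0.
    by rewrite -hk intrB intrM rmorphN -pmulrn /=; ring.
  move=> /(congr1 (@complex.Im R)); rewrite ReIm_lattice /= => /eqP.
  rewrite mulf_eq0 (gt_eqF z0) orbF intr_eq0 subr_eq0 => /eqP ka.
  have : (p %| k)%N by apply/dvdnP; exists `|a|%N; have := congr1 absz ka; rewrite abszM.
  by rewrite gtnNdvd.
have J0 : jfun n z != 0.
  rewrite /jfun mulf_neq0 ?expfz_neq0 //; apply/prodf_neq0 => k k0.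
  by rewrite expfz_neq0 // f0.
have : jfun d z * jfun n' z = jfun n z.
  rewrite /jfun mulrACA -expfzDr // ffunE subrK; congr (_ * _).
  rewrite -big_split /=; apply: eq_bigr => k k0.
  by rewrite -expfzDr ?f0 // ffunE subrK.
rewrite -h // => hd; apply: (mulIf J0); by rewrite hd mul1r.
Qed.

End Injectivity.

Unset Implicit Arguments.

Theorem theorem3p6 (R : realType) (p : nat) (m : int) (n : expvec p)
    (p_prime : prime p) (p_gt3 : (3 < p)%N) (m_range : 0 <= m <= p%:Z - 1)
    (jF : frakF m p (@jfun R p n)) :
  (forall (a b d : int),
     Gamma0 p (mat2 a b p%:Z d) ->
     1 <= a <= p%:Z - 1 -> 1 <= d <= p%:Z - 1 ->
     forall z : R[i], 0 < complex.Im z ->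
       stroke 1 (@jfun R p n) (map_mx intr (mat2 a b p%:Z d)) z =
       (-1) ^ Lexp n a b *
       cexp (2 * pi%:C * 'i%C * a%:~R * b%:~R * m%:~R / p%:R) *
       (dedekind_eta (p%:R * z) ^ n ord0 *
        \prod_(k < ((p.-1)./2).+1 | (0 < k)%N) fBiagioli p (k%:Z * a) z ^ n k)) /\
  (forall (r : nat) (m' : int),
     (1 <= r <= (p.-1)./2)%N ->
     (m' = r%:Z ^+ 2 * m %[mod p%:Z])%Z ->
     frakF m' p (@jfun R p (pi_vec r n))).
Proof.
have podd : odd p by case/even_prime: (p_prime) => // pE; move: p_gt3; rewrite pE.
have cond : frakF_cond m n.
  by case: jF => n' hn' h; rewrite (jfun_inj podd p_gt3 h).
split=> [a b d [det _] /andP[a1 a2] _ z z0 | r m' hr hm]; last first.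
  by exists (pi_vec r n) => //; exact: frakF_cond_pi_vec hm cond.
have detE (T : comPzRingType) (x y u v : T) : \det (mat2 x y u v) = x * v - y * u.
  rewrite (expand_det_row _ 0) !big_ord_recl big_ord0 /cofactor !det_mx11 !mxE /=.
  by rewrite expr0 expr1; ring.
have hdet : a * d - b * p%:Z = 1 by rewrite -detE.
have pa : ~~ (p%:Z %| a)%Z by rewrite dvdzE /= gtnNdvd //; lia.
have mapE : map_mx intr (mat2 a b p%:Z d) =
    mat2 (a%:~R : R) b%:~R (p%:Z)%:~R d%:~R.
  by apply/matrixP => i j; rewrite !mxE; do 2?case: ifP.
rewrite /stroke mapE detE -!intrM -intrB hdet sqrtr1 exp1rz mul1r.
rewrite /moebius !mxE /= -!intrC -pmulrn.
rewrite (jfun_transform p_prime p_gt3 cond hdet pa z0) eeE.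
by congr (_ * cexp _ * _); ring.
Qed.
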